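(* For each $n\ge1$ let $\sigma=\sigma_n>0$, $\mu=\mu_n\in\mathbb{R}^n$, $y=\mu+\varepsilon$ with $\varepsilon\sim N(0,\sigma^2I_n)$, and let $\hat\mu=\hat\mu_n:\mathbb{R}^n\to\mathbb{R}^n$ be such that each component of $x\mapsto\hat\mu(\mu+\sigma x)$ belongs to $W^{1,2}(\gamma_n)$; write $\hat\mu=\hat\mu(y)$ and $\widehat{\mathsf{SURE}}=\|y-\hat\mu\|^2+2\sigma^2\operatorname{div}\hat\mu-\sigma^2n$. If for some sequence $(\gamma_n^* )$ of real numbers with $\gamma_n^*\to0$ $$\mathbb{E}\Big[\frac{4\|\hat\mu-\mu\|^2}{n\sigma^2}+\frac{4\operatorname{trace}\{(\nabla\hat\mu)^2\}}{n}\Big]\le\gamma_n^*\quad\text{for all }n,$$ then for every fixed $\alpha\in(0,1)$ independent of $n$, as $n\to\infty$, $$\mathbb{P}\Big\{\big|\widehat{\mathsf{SURE}}-\|\mu-\hat\mu\|^2\big|\le\sigma^2v_\alpha\sqrt{2n}\Big\}\to1-\alpha,$$ $$\mathbb{P}\Big\{\|\mu-\hat\mu\|^2\le\widehat{\mathsf{SURE}}+\sigma^2v_{-,\alpha}\sqrt{2n}\Big\}\to1-\alpha,$$ where $v_\alpha$ and $v_{-,\alpha}$ (depending on $n$) are defined by $\mathbb{P}\{(2n)^{-1/2}|\chi^2_n-n|>v_\alpha\}=\alpha$ and $\mathbb{P}\{(2n)^{-1/2}(n-\chi^2_n)>v_{-,\alpha}\}=\alpha$.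
   Context: $\chi^2_n$ denotes a chi-square random variable with $n$ degrees of freedom. $\|\cdot\|$ is the Euclidean norm; $\operatorname{div}\hat\mu=\sum_i\partial\hat\mu_i/\partial y_i$; $\nabla\hat\mu$ is the $n\times n$ matrix whose columns are the gradients of the components of $\hat\mu$, evaluated at $y$ (weak derivatives). $\gamma_n$ (without star) is the standard Gaussian measure on $\mathbb{R}^n$ and $W^{1,2}(\gamma_n)$ is the set of locally integrable, weakly differentiable $g:\mathbb{R}^n\to\mathbb{R}$ with $\int(g^2+\|\nabla g\|^2)\,d\gamma_n<\infty$. *)

(* Defs.v *)
From HB Require Import structures.
From mathcomp Require Import all_boot all_order all_algebra.
From mathcomp Require Import all_classical all_reals all_analysis.

Set Implicit Arguments.
Unset Strict Implicit.
Unset Printing Implicit Defensive.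

Import Order.TTheory GRing.Theory Num.Theory.
Import numFieldNormedType.Exports.

Local Open Scope classical_set_scope.
Local Open Scope ring_scope.

(* R^n is 'rV[R]_n with the sigma-algebra generated by the coordinates, as in
   the library's instance for n.-tuple. *)
Definition measure_row_display : measure_display.
Proof. exact. Qed.

Section measurable_row.
Context {R : realType} (n : nat).

Let coors : 'I_n -> 'rV[R]_n -> R := fun i x => x 0 i.

Let row_set0 : g_sigma_preimage coors set0.
Proof. exact: sigma_algebra0. Qed.

Let row_setC A : g_sigma_preimage coors A -> g_sigma_preimage coors (~` A).
Proof. exact: sigma_algebraC. Qed.

Let row_bigcup (F : (set 'rV[R]_n)^nat) :
  (forall i, g_sigma_preimage coors (F i)) ->
  g_sigma_preimage coors (\bigcup_i (F i)).
Proof. exact: sigma_algebra_bigcup. Qed.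

HB.instance Definition _ := @isMeasurable.Build measure_row_display
  'rV[R]_n (g_sigma_preimage coors) row_set0 row_setC row_bigcup.

End measurable_row.

Section row_product_measure.
Context {R : realType}.

Lemma measurable_fun_rowP d (T : measurableType d) n (f : T -> 'rV[R]_n) :
  (forall i, measurable_fun [set: T] (fun x => f x 0 i)) ->
  measurable_fun [set: T] f.
Proof.
move=> mf _ A; rewrite setTI => mA.
have : g_sigma_preimage (fun i : 'I_n => (fun x : 'rV[R]_n => x 0 i) \o f)
  (f @^-1` A).
  by rewrite g_sigma_preimage_comp; exists A; rewrite ?setTI.
apply: smallest_sub; first exact: sigma_algebra_measurable.
move=> B; rewrite -bigcup_seq => -[i _ [C mC <-]]; exact: mf.
Qed.

Lemma measurable_coord n (i : 'I_n) :
  measurable_fun [set: 'rV[R]_n] (fun x : 'rV[R]_n => x 0 i).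
Proof.
move=> _ Y mY; rewrite setTI; apply: sub_sigma_algebra => /=.
rewrite -bigcup_seq/=; exists i => /=; first by rewrite mem_index_enum.
by exists Y => //; rewrite setTI.
Qed.

Definition row_cons n (p : measurableTypeR R * 'rV[R]_n) : 'rV[R]_n.+1 :=
  row_mx (p.1%:M : 'rV[R]_1) p.2.

Definition row_uncons n (x : 'rV[R]_n.+1) : measurableTypeR R * 'rV[R]_n :=
  (x 0 0, @rsubmx R 1 1 n x).

Lemma row_consK n : cancel (@row_cons n) (@row_uncons n).
Proof.
case=> a x; rewrite /row_uncons /row_cons row_mxKr; congr pair.
rewrite (_ : (0 : 'I_n.+1) = @lshift 1 n 0); last exact/val_inj.
by rewrite (@row_mxEl R 1 1 n) mxE eqxx mulr1n.
Qed.

Lemma measurable_row_cons n : measurable_fun [set: measurableTypeR R * 'rV[R]_n] (@row_cons n).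
Proof.
apply: measurable_fun_rowP => i; rewrite /row_cons.
case: (splitP (i : 'I_(1 + n))) => j ij.
- rewrite (_ : (fun _ => _) = fst); first exact: measurable_fst.
  apply/funext => x; rewrite (_ : i = lshift n j); last exact/val_inj.
  by rewrite (@row_mxEl R 1 1 n) mxE (ord1 j) eqxx mulr1n.
- rewrite (_ : (fun _ => _) = (fun y : 'rV[R]_n => y 0 j) \o snd).
    apply: measurableT_comp; [exact: measurable_coord|exact: measurable_snd].
  apply/funext => x; rewrite (_ : i = rshift 1 j); last exact/val_inj.
  by rewrite (@row_mxEr R 1 1 n).
Qed.

Lemma measurable_row_uncons n :
  measurable_fun [set: 'rV[R]_n.+1] (@row_uncons n).
Proof.
apply/measurable_fun_pairP; split; first exact: measurable_coord.
apply: measurable_fun_rowP => i.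
rewrite (_ : (fun _ => _) = (fun x : 'rV[R]_n.+1 => x 0 (rshift 1 i))).
  exact: measurable_coord.
by apply/funext => x; rewrite mxE.
Qed.

Section step.
Variables (n : nat) (m1 : {sigma_finite_measure set (measurableTypeR R) -> \bar R})
  (m2 : {sigma_finite_measure set 'rV[R]_n -> \bar R}).

Let m12 : {measure set (measurableTypeR R * 'rV[R]_n) -> \bar R} := (m1 \x m2)%E.

Definition row_prod_step := pushforward (m1 \x m2)%E (@row_cons n).

Let prod0 : row_prod_step set0 = 0%E.
Proof. by rewrite /row_prod_step /pushforward preimage_set0 (measure0 m12). Qed.

Let prod_ge0 A : (0 <= row_prod_step A)%E.
Proof. exact: (measure_ge0 m12). Qed.

Let prod_sigma_additive : semi_sigma_additive row_prod_step.
Proof.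
have mc := @measurable_row_cons n.
move=> F mF tF mUF; rewrite /row_prod_step /pushforward preimage_bigcup.
apply: (@measure_semi_sigma_additive _ _ _ m12).
- by move=> k; rewrite -[X in measurable X]setTI; exact: mc.
- apply/trivIsetP => /= i j _ _ ij; rewrite -preimage_setI.
  by move/trivIsetP : tF => /(_ _ _ _ _ ij) ->//; rewrite preimage_set0.
- by rewrite -preimage_bigcup -[X in measurable X]setTI; exact: mc.
Qed.

HB.instance Definition _ := isMeasure.Build _ _ _ row_prod_step
  prod0 prod_ge0 prod_sigma_additive.

Let prod_sigma_finite : sigma_finite setT row_prod_step.
Proof.
have [F FT Ffin] := sigma_finiteT m1.
have [G GT Gfin] := sigma_finiteT m2.
pose H (k : nat) : set (measurableTypeR R * 'rV[R]_n) :=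
  if (unpickle k : option (nat * nat)) is Some ij then F ij.1 `*` G ij.2
  else set0.
have mH k : measurable (H k).
  rewrite /H; case: unpickle => [ij|] //.
  by apply: measurableX; [have [] := Ffin ij.1|have [] := Gfin ij.2].
exists (fun k => @row_uncons n @^-1` H k).
  apply/esym; rewrite -subTset => x _.
  have [i _ Fi] : (\bigcup_i F i) (row_uncons x).1 by rewrite -FT.
  have [j _ Gj] : (\bigcup_i G i) (row_uncons x).2 by rewrite -GT.
  by exists (pickle (i, j)) => //; rewrite /preimage/= /H pickleK.
move=> k; split.
  by rewrite -[X in measurable X]setTI; exact: measurable_row_uncons.
rewrite /row_prod_step /pushforward -comp_preimage.
rewrite (_ : _ \o _ = id) ?preimage_id; last first.
  by apply/funext => p /=; rewrite row_consK.
rewrite /H; case: unpickle => [[i j]|]; last by rewrite (measure0 m12).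
have [mF Foo] := Ffin i; have [mG Goo] := Gfin j.
rewrite /= product_measure1E//; apply: lte_mul_pinfty => //.
by rewrite ge0_fin_numE.
Qed.

HB.instance Definition _ :=
  Measure_isSigmaFinite.Build _ _ _ row_prod_step prod_sigma_finite.

End step.

Fixpoint row_prod (m : {sigma_finite_measure set (measurableTypeR R) -> \bar R}) (n : nat) :
    {sigma_finite_measure set 'rV[R]_n -> \bar R} :=
  if n is n'.+1 then row_prod_step m (row_prod m n')
  else \d_(0 : 'rV[R]_0).

End row_product_measure.

Section gaussian_measure.
Context {R : realType}.

(* N(0, s^2 I_n): the n coordinates are independent N(0, s^2) *)
Definition gaussian (n : nat) (s : R) :
    {sigma_finite_measure set 'rV[R]_n -> \bar R} :=
  row_prod (normal_prob 0 s) n.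

(* `|x| on 'rV[R]_n is the sup norm *)
Definition enorm n (x : 'rV[R]_n) : R := Num.sqrt (\sum_i x 0 i ^+ 2).

Definition chi_square (n : nat) : set R -> \bar R :=
  pushforward (gaussian n 1) (fun x : 'rV[R]_n => enorm x ^+ 2).

End gaussian_measure.

Section weak_derivatives.
Context {R : realType} (n : nat).
Implicit Types (g h phi : 'rV[R]_n -> R) (i : 'I_n).

Let leb : set 'rV[R]_n -> \bar R := row_prod lebesgue_measure n.

Definition partial i phi : 'rV[R]_n -> R := 'D_(delta_mx 0 i) phi.

(* foldr partial phi s ranges over all iterated partial derivatives of phi *)
Definition smooth phi := forall s : seq 'I_n,
  continuous (foldr partial phi s) /\
  forall i x, derivable (foldr partial phi s) x (delta_mx 0 i).

Definition test_function phi :=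
  smooth phi /\ compact (closure [set x | phi x != 0]).

Definition loc_integrable g := measurable_fun [set: 'rV[R]_n] g /\
  forall K, compact K -> (\int[leb]_(x in K) `|g x|%:E < +oo)%E.

Definition weak_partial i g h :=
  [/\ loc_integrable g, loc_integrable h &
      forall phi, test_function phi ->
        (\int[leb]_x (g x * partial i phi x)%:E =
         - \int[leb]_x (h x * phi x)%:E)%E].

Definition gaussian_W12 g := loc_integrable g /\
  exists G : 'rV[R]_n -> 'rV[R]_n,
    (forall i, weak_partial i g (fun x => G x 0 i)) /\
    (\int[gaussian n 1]_x (g x ^+ 2 + enorm (G x) ^+ 2)%:E < +oo)%E.

(* D is a version of the weak gradient of f, with the gradients of the
   components of f as columns: D x i j is the i-th partial derivative of
   the j-th component of f *)
Definition weak_gradient (f : 'rV[R]_n -> 'rV[R]_n) (D : 'rV[R]_n -> 'M[R]_n) :=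
  forall i j, weak_partial i (fun x => f x 0 j) (fun x => D x i j).

(* \tr (D y) is the divergence of f at y *)
Definition SURE (s : R) (f : 'rV[R]_n -> 'rV[R]_n) (D : 'rV[R]_n -> 'M[R]_n)
    (y : 'rV[R]_n) : R :=
  enorm (y - f y) ^+ 2 + 2 * s ^+ 2 * \tr (D y) - s ^+ 2 * n%:R.

End weak_derivatives.

(* Main.v *)
(** Let x be a standard Gaussian vector, f(x) = (muhat(mu + sigma x) - mu) / sigma
    and delta f = x . f - div f. Then SURE - |mu - muhat|^2 equals
    sigma^2 (|x|^2 - n - 2 delta f). The second-order Stein identity
    E (delta f)^2 = E |f|^2 + E tr (Df)^2 shows that 2 delta f / sqrt (2 n) has
    second moment at most gamma_n / 2, hence tends to 0 in probability. So only
    |x|^2 - n matters, once the law of X = |x|^2 is known to give a mass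
    O(d) + O(1/n) to intervals of length d sqrt (2 n), uniformly in their
    position; no central limit theorem is needed. This follows from
    E (X - n) h(X) = 2 E X h'(X), taken for an arctangent h that increases
    steeply on the interval, and from Var X = 2 n.

    The second-order identity is checked on combinations of products of smooth
    compactly supported functions of one variable, where it factors into
    one-dimensional Stein identities. It extends to W^{1,2}, as a tail bound,
    because these combinations approximate a function and its weak gradient
    simultaneously in L2. *)

Require Import Defs.
From mathcomp Require Import all_boot all_order all_algebra.
From mathcomp Require Import all_classical all_reals all_analysis.
From mathcomp Require Import measurable_realfun ring lra.

Import Order.TTheory GRing.Theory Num.Theory.
Import numFieldNormedType.Exports.

Local Open Scope classical_set_scope.
Local Open Scope ring_scope.

Set Implicit Arguments.
Unset Strict Implicit.
Unset Printing Implicit Defensive.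

(** * Integration over products *)

Section row_prod_integral.
Context {R : realType}.
Implicit Types (m : {sigma_finite_measure set (measurableTypeR R) -> \bar R}).

(** For f in L2 the function x . f is only known to be integrable, so delta f has no second moment
    to start with. The approximants do have one and converge to delta f in L1, which is why the
    outcome is a bound in probability. The hypothesis controls tr (Df)^2 only in mean and with its
    sign, so the identity has to be kept exact, entry by entry, and each entry of Df must be square
    integrable before approximation begins. The given gradient is an arbitrary version; its
    integrability is borrowed from the Sobolev gradient by uniqueness almost everywhere. Everything
    in n variables is reduced to one variable through products: indicators of orthants, whose
    mollifications are explicit products, product test functions, and affine maps acting
    coordinatewise. Coverage is compared in each fixed dimension with a free parameter [de]; the
    error 2 rho / de^2 + 16 de + 16 / n contains neither alpha nor the quantile, which enters only
    through its defining equation. *)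

Definition tensor n (phi : 'I_n -> R -> R) (x : 'rV[R]_n) : R :=
  \prod_i phi i (x 0 i).

Lemma row_cons0 n (p : measurableTypeR R * 'rV[R]_n) : row_cons p 0 ord0 = p.1.
Proof. by have := row_consK p; rewrite /row_uncons; case: p => a x [-> _]. Qed.

Lemma row_consS n (p : measurableTypeR R * 'rV[R]_n) i :
  row_cons p 0 (lift ord0 i) = p.2 0 i.
Proof.
rewrite /row_cons (_ : lift ord0 i = rshift 1 i); last exact/val_inj.
by rewrite (@row_mxEr R 1 1 n).
Qed.

Lemma measurable_tensor n (phi : 'I_n -> R -> R) :
  (forall i, measurable_fun setT (phi i)) ->
  measurable_fun [set: 'rV[R]_n] (tensor phi).
Proof.
move=> mphi; apply: measurable_prod => i _.
by apply: measurableT_comp => //; exact: measurable_coord.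
Qed.

Lemma tensor_row_cons n (phi : 'I_n.+1 -> R -> R) p :
  tensor phi (row_cons p) = phi ord0 p.1 * tensor (fun i => phi (lift ord0 i)) p.2.
Proof.
rewrite /tensor big_ord_recl row_cons0; congr (_ * _).
by apply: eq_bigr => i _; rewrite row_consS.
Qed.

Lemma ge0_integral_rowS m n (f : 'rV[R]_n.+1 -> \bar R) :
  measurable_fun [set: 'rV[R]_n.+1] f -> (forall x, 0 <= f x)%E ->
  (\int[row_prod m n.+1]_x f x =
   \int[m]_a \int[row_prod m n]_x f (row_cons (a, x)))%E.
Proof.
move=> mf f0; rewrite /= /row_prod_step.
rewrite (@ge0_integral_pushforward _ _ _ _ _ _ (@measurable_row_cons R n))//.
rewrite preimage_setT fubini_tonelli1//; last by move=> x; exact: f0.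
by apply: measurableT_comp => //; exact: measurable_row_cons.
Qed.


Lemma integrable_rowS m n (f : 'rV[R]_n.+1 -> \bar R) :
  (row_prod m n.+1).-integrable [set: 'rV[R]_n.+1] f <->
  (measurable_fun [set: 'rV[R]_n.+1] f /\
  (\int[m]_a \int[row_prod m n]_x `|f (row_cons (a, x))| < +oo)%E).
Proof.
split=> [/integrableP[mf foo]|[mf foo]]; [split=> //|apply/integrableP; split=> //].
  by rewrite -(ge0_integral_rowS m (f := fun x => `|f x|%E))//; exact: measurableT_comp.
by rewrite (ge0_integral_rowS m (f := fun x => `|f x|%E))//; exact: measurableT_comp.
Qed.

Lemma integral_rowS m n (f : 'rV[R]_n.+1 -> \bar R) :
  (row_prod m n.+1).-integrable [set: 'rV[R]_n.+1] f ->
  (\int[row_prod m n.+1]_x f x =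
   \int[m]_a \int[row_prod m n]_x f (row_cons (a, x)))%E.
Proof.
move=> /integrable_rowS[mf foo].
have mfc : measurable_fun setT (f \o @row_cons R n).
  by apply: measurableT_comp => //; exact: measurable_row_cons.
have intf : (m \x row_prod m n)%E.-integrable setT (f \o @row_cons R n).
  exact/integrable12ltyP.
rewrite /= /row_prod_step.
rewrite (@integral_pushforward _ _ _ _ _ _ (@measurable_row_cons R n))//.
by rewrite preimage_setT -integral12_prod_meas1.
Qed.

Lemma integral_row0 m (f : 'rV[R]_0 -> \bar R) :
  measurable_fun [set: 'rV[R]_0] f ->
  (\int[row_prod m 0]_x f x = f 0%R)%E.
Proof. by move=> mf; rewrite /= integral_dirac// diracT mul1e. Qed.

Lemma integrable_row0 m (f : 'rV[R]_0 -> R) :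
  measurable_fun [set: 'rV[R]_0] f ->
  (row_prod m 0).-integrable [set: 'rV[R]_0] (EFin \o f).
Proof.
move=> mf; apply/integrableP; split; first exact/measurable_EFinP.
by rewrite integral_row0 ?ltry//; do 2 apply: measurableT_comp => //.
Qed.

Lemma integrable_tensor m n (phi : 'I_n -> R -> R) :
  (forall i, m.-integrable setT (EFin \o phi i)) ->
  (row_prod m n).-integrable [set: 'rV[R]_n] (EFin \o tensor phi) /\
  (\int[row_prod m n]_x tensor phi x = \prod_i (\int[m]_a phi i a))%R.
Proof.
elim: n phi => [|n IH] phi iphi.
  have mt : measurable_fun [set: 'rV[R]_0] (tensor phi).
    by apply: measurable_tensor => -[].
  split; first exact: integrable_row0.
  rewrite /Rintegral integral_row0 ?big_ord0 /tensor ?big_ord0//.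
  exact: measurableT_comp.
have mphi i : measurable_fun setT (phi i).
  by have /measurable_int /measurable_EFinP := iphi i.
have [it Et] := IH (fun i => phi (lift ord0 i)) (fun i => iphi _).
set t := tensor _ in it Et.
have iphi0 := iphi ord0.
have int1 : (row_prod m n.+1).-integrable [set: 'rV[R]_n.+1] (EFin \o tensor phi).
  apply/integrable_rowS.
  have mt := measurable_tensor mphi.
  split.
    exact/measurable_EFinP.
  under eq_integral => a _.
    under eq_integral => x _ do rewrite /= tensor_row_cons/= normrM EFinM.
    rewrite ge0_integralZl//; last first.
      do 2 apply: measurableT_comp => //; exact: measurable_tensor.
    over.
  have /integrableP[_ +] := it.
  have /integrableP[_ +] := iphi0.
  move=> H1 H2; rewrite ge0_integralZr//.
  - apply: lte_mul_pinfty => //; first exact: integral_ge0.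
    by rewrite ge0_fin_numE//; exact: integral_ge0.
  - by do 2 apply: measurableT_comp => //; exact: mphi.
  - exact: integral_ge0.
split=> //.
rewrite /Rintegral /= integral_rowS//.
under eq_integral => a _.
  under eq_integral => x _ do rewrite /= tensor_row_cons/= EFinM.
  rewrite integralZl//.
  over.
rewrite big_ord_recl -Et.
have fI : (\int[row_prod m n]_x (t x)%:E)%E \is a fin_num.
  by apply: integrable_fin_num.
rewrite -/t /Rintegral -(fineK fI) integralZr//=.
by rewrite fineM//; exact: (integrable_fin_num _ iphi0).
Qed.

Definition row_map n (T : 'I_n -> R -> R) (x : 'rV[R]_n) : 'rV[R]_n :=
  \row_i T i (x 0 i).

Lemma row_map_row_cons n (T : 'I_n.+1 -> R -> R) (a : measurableTypeR R)
    (x : 'rV[R]_n) :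
  row_map T (row_cons (a, x)) =
  row_cons (T ord0 a : measurableTypeR R,
            row_map (fun i => T (lift ord0 i)) x).
Proof.
apply/rowP => i; rewrite mxE; case: (unliftP ord0 i) => [j ->|->].
  by rewrite !row_consS/= mxE.
by rewrite !row_cons0.
Qed.

Lemma measurable_row_map n (T : 'I_n -> R -> R) :
  (forall i, measurable_fun setT (T i)) ->
  measurable_fun [set: 'rV[R]_n] (row_map T).
Proof.
move=> mT; apply: measurable_fun_rowP => i.
under eq_fun do rewrite mxE.
by apply: measurableT_comp => //; exact: measurable_coord.
Qed.

(** A one-dimensional comparison tensorises by Tonelli, the constant being raised to the power [n].
    As an inequality with a weight it covers densities bounded above, or below on a cube; equalities
    for affine maps come from applying it to the map and to its inverse. *)
Lemma ge0_row_transfer m1 m2 n (T : 'I_n -> R -> R) (w : R -> R) (C : R) :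
  0 <= C -> measurable_fun setT w -> (forall a, 0 <= w a) ->
  (forall i, measurable_fun setT (T i)) ->
  (forall i (g : R -> \bar R), measurable_fun setT g -> (forall a, 0 <= g a)%E ->
    (\int[m1]_a (g (T i a) * (w a)%:E) <= C%:E * \int[m2]_a g a)%E) ->
  forall f : 'rV[R]_n -> \bar R,
    measurable_fun [set: 'rV[R]_n] f -> (forall x, 0 <= f x)%E ->
  (\int[row_prod m1 n]_x (f (row_map T x) * (tensor (fun=> w) x)%:E) <=
   (C ^+ n)%:E * \int[row_prod m2 n]_x f x)%E.
Proof.
move=> C0 mw w0; elim: n T => [|n IH] T mT H f mf f0.
  have m0 : measurable_fun [set: 'rV[R]_0]
      (fun x => (f (row_map T x) * (tensor (fun=> w) x)%:E)%E).
    apply: emeasurable_funM.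
      by apply: measurableT_comp => //; exact: measurable_row_map.
    by apply/measurable_EFinP; apply: measurable_tensor.
  rewrite !integral_row0// expr0 mul1e /tensor big_ord0 mule1.
  by rewrite (_ : row_map T 0 = 0%R)//; apply/rowP => -[].
have t0 k (x : 'rV[R]_k) : 0 <= tensor (fun=> w) x by apply: prodr_ge0.
have mft : measurable_fun [set: 'rV[R]_n.+1]
    (fun x => (f (row_map T x) * (tensor (fun=> w) x)%:E)%E).
  apply: emeasurable_funM.
    by apply: measurableT_comp => //; exact: measurable_row_map.
  by apply/measurable_EFinP; apply: measurable_tensor.
have mfc : measurable_fun setT (f \o @row_cons R n).
  by apply: measurableT_comp => //; exact: measurable_row_cons.
rewrite (ge0_integral_rowS m1 mft); last first.
  by move=> x; rewrite mule_ge0// lee_fin.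
rewrite (ge0_integral_rowS m2 mf)//.
pose G (b : measurableTypeR R) := (\int[row_prod m2 n]_x f (row_cons (b, x)))%E.
have G0 b : (0 <= G b)%E by apply: integral_ge0.
have mG : measurable_fun setT G.
  by apply: (@measurable_fun_fubini_tonelli_F _ _ _ _ _ (row_prod m2 n) (f \o @row_cons R n)) => // x; exact: f0.
have C1 : 0 <= C ^+ n by exact: exprn_ge0.
rewrite exprS EFinM -muleA.
have -> : (C%:E * ((C ^+ n)%:E * \int[m2]_a \int[row_prod m2 n]_x f (row_cons (a, x))) =
     (C ^+ n)%:E * (C%:E * \int[m2]_a G a))%E by rewrite muleCA.
apply: (@le_trans _ _ ((C ^+ n)%:E * \int[m1]_a (G (T ord0 a) * (w a)%:E))%E); last first.
  by apply: lee_pmul => //; [apply: integral_ge0 => a _; rewrite mule_ge0// lee_fin|exact: H].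
have mGw : measurable_fun setT (fun a => (G (T ord0 a) * (w a)%:E)%E).
  apply: emeasurable_funM; last exact/measurable_EFinP.
  exact: (measurableT_comp mG (mT ord0)).
rewrite -ge0_integralZl//; last by move=> a _; rewrite mule_ge0// lee_fin.
apply: ge0_le_integral => //.
- by move=> a _; apply: integral_ge0 => x _; rewrite mule_ge0// lee_fin.
- have : measurable_fun setT ((fun x => (f (row_map T x) * (tensor (fun=> w) x)%:E)%E) \o @row_cons R n).
    by apply: measurableT_comp => //; exact: measurable_row_cons.
  move=> /measurable_fun_fubini_tonelli_F; apply.
  by move=> x /=; rewrite mule_ge0// lee_fin.
- exact: measurable_funeM.
move=> a _.
under eq_integral => x _ do rewrite row_map_row_cons tensor_row_cons/= mulrC EFinM muleA.
have mfa (b : measurableTypeR R) : measurable_fun [set: 'rV[R]_n] (fun x => f (row_cons (b, x))).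
  by apply: (measurableT_comp mfc); exact: measurable_pair1.
have mft' : measurable_fun [set: 'rV[R]_n] (fun x : 'rV[R]_n => (f (row_cons (T ord0 a : measurableTypeR R, row_map (fun i => T (lift ord0 i)) x)) *
          (tensor (fun=> w) x)%:E)%E).
  apply: emeasurable_funM.
    by apply: (measurableT_comp (mfa _)); apply: measurable_row_map.
  by apply/measurable_EFinP; apply: measurable_tensor.
rewrite ge0_integralZr//; [|by move=> x _; rewrite mule_ge0// lee_fin|by rewrite lee_fin].
rewrite muleA; apply: lee_wpmul2r; first by rewrite lee_fin.
apply: (IH (fun i => T (lift ord0 i)) _ _ (fun x => f (row_cons (T ord0 a : measurableTypeR R, x)))) => //.
by move=> i g mg g0; apply: H.
Qed.

End row_prod_integral.

(** * Approximation by step functions *)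

Section sqnorm.
Context d (T : measurableType d) (R : realType) (m : {measure set T -> \bar R}).
Implicit Types u v : T -> R.

(** The squared L2 norm, extended-valued so that estimates can be chained before finiteness is
    known. *)
Definition sqnorm u : \bar R := (\int[m]_x ((u x) ^+ 2)%:E)%E.

Lemma sqnorm_ge0 u : (0 <= sqnorm u)%E.
Proof. by apply: integral_ge0 => x _; rewrite lee_fin sqr_ge0. Qed.

Lemma measurable_sqr u : measurable_fun setT u ->
  measurable_fun setT (fun x => ((u x) ^+ 2)%:E).
Proof. by move=> mu; apply/measurable_EFinP; exact: measurable_funX. Qed.

Lemma le_sqnorm u v : measurable_fun setT u -> measurable_fun setT v ->
  (forall x, `|u x| <= `|v x|) -> (sqnorm u <= sqnorm v)%E.
Proof.
move=> mu mv uv; apply: ge0_le_integral => //.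
- by move=> x _; rewrite lee_fin sqr_ge0.
- exact: measurable_sqr.
- exact: measurable_sqr.
- by move=> x _; rewrite lee_fin -(real_normK (num_real (u x)))
    -(real_normK (num_real (v x))) lerXn2r// ?nnegrE.
Qed.

Lemma sqnormD u v : measurable_fun setT u -> measurable_fun setT v ->
  (sqnorm (fun x => (u x + v x)%R) <= 2%:E * (sqnorm u + sqnorm v))%E.
Proof.
move=> mu mv; rewrite -ge0_integralD//; try exact: measurable_sqr;
  try by move=> x _; rewrite lee_fin sqr_ge0.
rewrite -ge0_integralZl//; last 2 first.
- by apply: emeasurable_funD; exact: measurable_sqr.
- by move=> x _; rewrite adde_ge0// lee_fin sqr_ge0.
apply: ge0_le_integral => //.
- by move=> x _; rewrite lee_fin sqr_ge0.
- by apply: measurable_sqr; exact: measurable_funD.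
- apply: measurable_funeM.
  by apply: emeasurable_funD; exact: measurable_sqr.
- move=> x _; rewrite -EFinD -EFinM lee_fin.
  by have := sqr_ge0 (u x - v x); nra.
Qed.

Lemma sqnormZ (c : R) u : measurable_fun setT u ->
  (sqnorm (fun x => c * u x)%R = (c ^+ 2)%:E * sqnorm u)%E.
Proof.
move=> mu; rewrite /sqnorm -ge0_integralZl//.
- by apply: eq_integral => x _; rewrite -EFinM exprMn.
- exact: measurable_sqr.
- by move=> x _; rewrite lee_fin sqr_ge0.
- by rewrite lee_fin sqr_ge0.
Qed.

Lemma sqnorm_cvg0 (u : nat -> T -> R) (g : T -> R) :
  (forall k, measurable_fun setT (u k)) -> measurable_fun setT g ->
  (sqnorm g < +oo)%E -> (forall k x, `|u k x| <= `|g x|) ->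
  (forall x, u k x @[k --> \oo] --> 0) ->
  sqnorm (u k) @[k --> \oo] --> 0%E.
Proof.
move=> mu mg goo ug u0.
have ig : m.-integrable setT (fun x => ((g x) ^+ 2)%:E).
  apply/integrableP; split; first exact: measurable_sqr.
  by under eq_integral do rewrite gee0_abs ?lee_fin ?sqr_ge0//.
have [||||_ _] := @dominated_convergence _ _ _ m setT measurableT
  (fun k x => ((u k x) ^+ 2)%:E) (cst 0%E) _ _ _ _ ig _.
- by move=> k; exact: measurable_sqr.
- by [].
- apply: aeW => x _; apply/fine_cvgP; split; first exact: nearW.
  under eq_fun do rewrite /= expr2.
  by rewrite -(mulr0 (0 : R)); apply: cvgM; exact: u0.
- apply: aeW => x k _ /=; rewrite lee_fin ger0_norm ?sqr_ge0//.
  by rewrite -(real_normK (num_real (u k x)))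
    -(real_normK (num_real (g x))) lerXn2r// ?nnegrE.
- by rewrite integral0.
Qed.

End sqnorm.

Lemma cvge0_near_lt (R : realType) (u : nat -> \bar R) :
  u k @[k --> \oo] --> 0%E ->
  forall e : R, 0 < e -> \forall k \near \oo, (u k < e%:E)%E.
Proof.
move=> /fine_cvgP[uf /cvgr_lt u0] e e0; near=> k.
rewrite -[u k]fineK; first by rewrite lte_fin; near: k; exact: u0.
by near: k; exact: uf.
Unshelve. all: by end_near. Qed.

Section steps.
Context {R : realType} (n : nat).
Implicit Types (c : 'I_n -> R) (u v : 'rV[R]_n -> R).

(** Closed upper orthants form a pi-system generating the sigma-algebra; they are also products of
    rays, so that smoothing by a product kernel acts on each coordinate separately. *)
Definition upper c : set 'rV[R]_n := [set x | forall i, c i <= x 0 i].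

Lemma row_bound (x : 'rV[R]_n) : exists k : nat, forall j, `|x 0 j| <= k%:R.
Proof.
exists (\sum_j (Num.truncn `|x 0%R j|%R).+1)%N => j.
apply: (@le_trans _ _ (Num.truncn `|x 0 j|).+1%:R).
  exact/ltW/truncnS_gt.
by rewrite ler_nat (bigD1 j)//= leq_addr.
Qed.

Lemma measurable_upper c : measurable (upper c).
Proof.
rewrite (_ : upper c = \bigcap_(i in [set: 'I_n]) [set x | c i <= x 0 i]); last first.
  by apply/seteqP; split => x /= cx i; [move=> _|]; exact: cx.
apply: fin_bigcap_measurable; first exact: finite_finset.
move=> i _.
have := measurable_coord i measurableT (measurable_itv `[c i, +oo[).
rewrite setTI; congr (measurable _).
by apply/seteqP; split => x /=; rewrite in_itv/= andbT.
Qed.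

Lemma setI_closed_upper : setI_closed (range upper).
Proof.
move=> _ _ [b _ <-] [c _ <-]; exists (fun i => Num.max (b i) (c i)) => //.
apply/seteqP; split => x /=.
  by move=> h; split => i; have := h i; rewrite ge_max => /andP[].
by move=> [h1 h2] i; rewrite ge_max h1 h2.
Qed.

Lemma measurable_row_upper : @measurable _ 'rV[R]_n = <<s range upper >>.
Proof.
apply/seteqP; split; last first.
  apply: smallest_sub; first exact: sigma_algebra_measurable.
  by move=> _ [c _ <-]; exact: measurable_upper.
apply: smallest_sub; first exact: smallest_sigma_algebra.
move=> A; rewrite -bigcup_seq => -[i _ [C mC <-]].
suff : measurable_fun setT (fun x : g_sigma_algebraType (range upper) => (x : 'rV[R]_n) 0 i).
  by move=> /(_ measurableT _ mC).
apply: (measurability (@RGenCInfty.G R)); first exact: RGenCInfty.measurableE.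
move=> _ [_ [t ->] <-]; rewrite setTI.
(* A half-space in coordinate [i] is the union of the orthants that bound the other coordinates
   below by [- k]. *)
rewrite (_ : _ @^-1` _ = \bigcup_k upper (fun j => if j == i then t else - k%:R)).
  apply: bigcupT_measurable => k; apply: sub_sigma_algebra.
  by exists (fun j => if j == i then t else - k%:R).
apply/seteqP; split => x /=.
  rewrite in_itv/= andbT => tx.
  have [k hk] := row_bound x.
  exists k => // j; case: eqP => [->|_]//; by rewrite lerNl (le_trans _ (hk j))// -normrN ler_norm.
move=> [k _] /(_ i); rewrite eqxx in_itv/= andbT; exact.
Qed.


Definition stepf (s : seq (R * ('I_n -> R))) (x : 'rV[R]_n) : R :=
  \sum_(p <- s) p.1 * \1_(upper p.2) x.

Lemma measurable_stepf s : measurable_fun [set: 'rV[R]_n] (stepf s).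
Proof.
apply: measurable_sum => p; apply: measurable_funM => //.
by apply: measurable_indic; exact: measurable_upper.
Qed.

Lemma stepf_cat s t x : stepf (s ++ t) x = stepf s x + stepf t x.
Proof. by rewrite /stepf big_cat. Qed.

Lemma stepfZ k s x :
  stepf [seq (k * p.1, p.2) | p <- s] x = k * stepf s x.
Proof.
rewrite /stepf big_map mulr_sumr; apply: eq_bigr => p _ /=.
by rewrite mulrA.
Qed.

Section density.
Variable m : {measure set 'rV[R]_n -> \bar R}.
Hypothesis moo : (m setT < +oo)%E.

Let appr u := measurable_fun [set: 'rV[R]_n] u /\ forall e : R, 0 < e ->
  exists s, (sqnorm m (fun x => u x - stepf s x)%R <= e%:E)%E.

Let apprD u v : appr u -> appr v -> appr (fun x => u x + v x).
Proof.
move=> [mu hu] [mv hv]; split=> [|e e0]; first exact: measurable_funD.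
have e4 : 0 < e / 4 by rewrite divr_gt0.
have [s hs] := hu _ e4; have [t ht] := hv _ e4; exists (s ++ t).
have -> : (fun x => u x + v x - stepf (s ++ t) x) =
  (fun x => (u x - stepf s x) + (v x - stepf t x)).
  by apply/funext => x; rewrite stepf_cat opprD addrACA.
apply: (le_trans (sqnormD m _ _)).
- by apply: measurable_funB => //; exact: measurable_stepf.
- by apply: measurable_funB => //; exact: measurable_stepf.
apply: (@le_trans _ _ (2%:E * ((e / 4)%:E + (e / 4)%:E))%E).
  by apply: lee_pmul => //; [exact: adde_ge0 (sqnorm_ge0 _ _) (sqnorm_ge0 _ _)|exact: leeD].
by rewrite -EFinD -EFinM lee_fin; lra.
Qed.

Let apprZ k u : appr u -> appr (fun x => k * u x).
Proof.
move=> [mu hu]; split=> [|e e0]; first exact: measurable_funM.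
have k0 : 0 < k ^+ 2 + 1 by rewrite ltr_wpDl// sqr_ge0.
have [s hs] := hu (e / (k ^+ 2 + 1)) (divr_gt0 e0 k0).
exists [seq (k * p.1, p.2) | p <- s].
have -> : (fun x => k * u x - stepf [seq (k * p.1, p.2) | p <- s] x) =
  (fun x => k * (u x - stepf s x)).
  by apply/funext => x; rewrite stepfZ mulrBr.
rewrite sqnormZ; last by apply: measurable_funB => //; exact: measurable_stepf.
apply: (@le_trans _ _ ((k ^+ 2)%:E * (e / (k ^+ 2 + 1))%:E)%E).
  by apply: lee_pmul => //; [rewrite lee_fin sqr_ge0|exact: sqnorm_ge0].
rewrite -EFinM lee_fin mulrCA ler_piMr ?ltW//.
by rewrite ltr_pdivrMr// mul1r ltrDl.
Qed.

Let appr_limit u (v : nat -> 'rV[R]_n -> R) :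
  measurable_fun [set: 'rV[R]_n] u -> (forall k, appr (v k)) ->
  sqnorm m (fun x => u x - v k x) @[k --> \oo] --> 0%E -> appr u.
Proof.
move=> mu hv uv; split=> // e e0.
have e4 : 0 < e / 4 by rewrite divr_gt0.
have := cvge0_near_lt uv e4.
case=> k _ /(_ k (leqnn k)) /= uvk.
have [mvk /(_ _ e4)[s hs]] := hv k; exists s.
have -> : (fun x => u x - stepf s x) =
  (fun x => (u x - v k x) + (v k x - stepf s x)).
  by apply/funext => x; rewrite addrA subrK.
apply: (le_trans (sqnormD m _ _)).
- exact: measurable_funB.
- by apply: measurable_funB => //; exact: measurable_stepf.
apply: (@le_trans _ _ (2%:E * ((e / 4)%:E + (e / 4)%:E))%E).
  apply: lee_pmul => //; first exact: adde_ge0 (sqnorm_ge0 _ _) (sqnorm_ge0 _ _).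
  by apply: leeD => //; exact: ltW.
by rewrite -EFinD -EFinM lee_fin; lra.
Qed.

Let sqnorm1 : (sqnorm m (cst 1%R) < +oo)%E.
Proof.
rewrite /sqnorm; under eq_integral do rewrite expr1n.
by rewrite integral_cst// mul1e.
Qed.

Let appr_upper c : appr \1_(upper c).
Proof.
split; first by apply: measurable_indic; exact: measurable_upper.
move=> e e0; exists [:: (1, c)].
have -> : (fun x => \1_(upper c) x - stepf [:: (1, c)] x) = cst 0 :> (_ -> R).
  by apply/funext => x; rewrite /stepf big_seq1 mul1r subrr.
by rewrite /sqnorm; under eq_integral do rewrite expr0n; rewrite integral0 lee_fin ltW.
Qed.

Let appr_indic_limit (A : set 'rV[R]_n) (v : nat -> 'rV[R]_n -> R) :
  measurable A -> (forall k, appr (v k)) ->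
  (forall k x, 0 <= v k x <= 1) ->
  (forall x, \forall k \near \oo, v k x = \1_A x) -> appr \1_A.
Proof.
move=> mA av v01 vA.
have m1 : measurable_fun [set: 'rV[R]_n] (\1_A : _ -> R) by exact: measurable_indic.
apply: (appr_limit m1 av).
apply: (sqnorm_cvg0 (g := cst 1%R)) => //.
- by move=> k; apply: measurable_funB => //; have [] := av k.
- move=> k x; rewrite normr1 /indic; have /andP[h0 h1] := v01 k x.
  by rewrite ler_norml; case: (x \in A) => /=; apply/andP; split; lra.
- move=> x; apply: cvg_near_cst; near=> k; apply/eqP; rewrite subr_eq0 eq_sym.
  by apply/eqP; near: k; exact: vA.
Unshelve. all: by end_near. Qed.

(** Dynkin's pi-lambda theorem. Complements come from linearity; disjoint unions come from partial
    sums that stay in [0, 1] and are eventually constant at each point, the constant 1 being a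
    dominating function because the measure is finite. *)
Let appr_indic A : measurable A -> appr \1_A.
Proof.
have aT : appr \1_setT.
  apply: (@appr_indic_limit _ (fun k => \1_(upper (fun=> - k%:R)))) => //.
    by move=> k x; rewrite /indic; case: (_ \in _); rewrite ?lexx ler01.
  move=> x; have [K hK] := row_bound x; exists K => // k /= Kk.
  rewrite /indic in_setT mem_set// => j.
  by rewrite lerNl (le_trans _ (le_trans (hK j) _)) ?ler_nat// -normrN ler_norm.
rewrite {1}measurable_row_upper.
move: A; apply: (@dynkin_induction _ 'rV[R]_n (range upper) (fun A => appr \1_A)).
- exact: measurable_row_upper.
- exact: setI_closed_upper.
- by [].
- by move=> _ [c _ <-].
- move=> S mS aS.
  have -> : \1_(~` S) = (fun x => \1_(setT : set 'rV[R]_n) x + (-1) * \1_S x) :> (_ -> R).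
    apply/funext => x; rewrite /indic in_setT in_setC; case: (_ \in _) => /=; lra.
  by apply: apprD => //; exact: apprZ.
- move=> F mF tF aF.
  have F1 x i j : F j x -> \1_(F i) x = (i == j)%:R :> R.
    move=> Fjx; have [->|ij] := eqVneq i j; first by rewrite /indic mem_set.
    rewrite /indic memNset// => Fix; move/eqP : ij; apply.
    by apply: tF => //; exists x.
  have sumF k x j : F j x -> \sum_(i < k) \1_(F i) x = (j < k)%N%:R :> R.
    move=> Fjx; under eq_bigr do rewrite (F1 _ _ _ Fjx).
    elim: k => [|k IH]; first by rewrite big_ord0.
    by rewrite big_ord_recr/= IH ltnS; case: ltngtP => _ /=; rewrite ?addr0 ?add0r.
  have sumN k x : ~ (\bigcup_i F i) x -> \sum_(i < k) \1_(F i) x = 0 :> R.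
    move=> NF; rewrite big1// => i _; rewrite /indic memNset// => Fx.
    by apply: NF; exists i.
  apply: (@appr_indic_limit _ (fun k x => \sum_(i < k) \1_(F i) x)).
  + exact: bigcupT_measurable.
  + elim=> [|k IH].
      rewrite (_ : (fun _ => _) = (fun x => 0 * \1_setT x)); first exact: apprZ.
      by apply/funext => x; rewrite big_ord0 mul0r.
    under eq_fun do rewrite big_ord_recr/=.
    exact: apprD.
  + move=> k x; have [[j _ Fjx]|NF] := pselect ((\bigcup_i F i) x).
      by rewrite (sumF _ _ _ Fjx); case: (_ < _)%N; rewrite ?lexx ler01.
    by rewrite sumN// lexx ler01.
  + move=> x; have [[j _ Fjx]|NF] := pselect ((\bigcup_i F i) x).
      exists j.+1 => // k /= jk; rewrite (sumF _ _ _ Fjx) jk /indic mem_set//.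
      by exists j.
    by near=> k; rewrite sumN// /indic memNset.
Unshelve. all: by end_near. Qed.

Import HBNNSimple.

Let appr_nnsfun (f : {nnsfun 'rV[R]_n >-> R}) : appr f.
Proof.
rewrite (_ : (f : _ -> R) = (fun x => \sum_(y \in range f) (y * \1_(f @^-1` [set y]) x))); last first.
  by apply/funext => x; rewrite fimfunE.
under eq_fun do rewrite fsbig_finite//=.
elim: (finmap.enum_fset _) => [|y s IH].
  rewrite (_ : (fun _ => _) = (fun x => 0 * \1_setT x)); first exact/apprZ/appr_indic.
  by apply/funext => x; rewrite big_nil mul0r.
under eq_fun do rewrite big_cons.
apply: apprD => //; apply: apprZ; apply: appr_indic.
by rewrite -[X in measurable X]setTI; exact: measurable_funPT.
Qed.

Let appr_ge0 u : measurable_fun [set: 'rV[R]_n] u -> (forall x, 0 <= u x) ->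
  (sqnorm m u < +oo)%E -> appr u.
Proof.
move=> mu u0 uoo.
have meu : measurable_fun [set: 'rV[R]_n] (EFin \o u) by exact/measurable_EFinP.
pose f k := nnsfun_approx measurableT meu k.
apply: (appr_limit mu (fun k => appr_nnsfun (f k))).
have fu k x : 0 <= f k x <= u x.
  rewrite fun_ge0/= -lee_fin /f nnsfun_approxE.
  by apply: (@le_approx _ _ R setT (EFin \o u)) => // y _; rewrite lee_fin.
apply: (sqnorm_cvg0 (g := u)) => //.
- by move=> k; exact: measurable_funB.
- move=> k x; have /andP[h0 h1] := fu k x.
  by rewrite !ger0_norm ?subr_ge0 ?gerBl.
- move=> x; rewrite -(subrr (u x)).
  apply: cvgB; first exact: cvg_cst.
  have : EFin \o (f ^~ x) @ \oo --> (u x)%:E.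
    by apply: (cvg_nnsfun_approx measurableT meu) => // y _; rewrite lee_fin.
  by move=> /fine_cvgP[].
Qed.

Lemma stepf_dense u : measurable_fun [set: 'rV[R]_n] u ->
  (sqnorm m u < +oo)%E -> forall e : R, 0 < e ->
  exists s, (sqnorm m (fun x => u x - stepf s x)%R <= e%:E)%E.
Proof.
move=> mu uoo.
have mp : measurable_fun [set: 'rV[R]_n] (fun x => Num.max (u x) 0) by exact: measurable_maxr.
have mn : measurable_fun [set: 'rV[R]_n] (fun x => Num.max (- u x) 0).
  by apply: measurable_maxr => //; exact: measurableT_comp.
have -> : u = fun x => Num.max (u x) 0 + (-1) * Num.max (- u x) 0.
  by apply/funext => x; rewrite /Num.max; do 2 case: ifP => ?; lra.
have [] // : appr (fun x => Num.max (u x) 0 + (-1) * Num.max (- u x) 0).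
apply: apprD; last apply: apprZ; apply: appr_ge0 => //; try by move=> x; rewrite le_max lexx orbT.
- apply: le_lt_trans uoo; apply: le_sqnorm => // x.
  by rewrite ger0_norm ?le_max ?lexx ?orbT// ge_max normr_ge0 ler_norm.
- apply: le_lt_trans uoo; apply: le_sqnorm => // x.
  by rewrite ger0_norm ?le_max ?lexx ?orbT// ge_max normr_ge0 -normrN ler_norm.
Qed.

End density.

End steps.

(** * Smooth functions of one variable *)

Section smooth1.
Context {R : realType}.
Implicit Types f g : R -> R.

(** Differentiability of order [k] as mere existence of successive derivatives, so that closure
    under sums, products and affine substitutions goes by induction on [k] without formulas for
    iterated derivatives. *)
Fixpoint diffn k f : Prop :=
  if k is k'.+1 then
    exists2 f', (forall x : R, is_derive x 1 f (f' x)) & diffn k' f'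
  else True.

Definition smooth1 f := forall k, diffn k f.

Lemma diffnS k f : diffn k.+1 f -> diffn k f.
Proof. by elim: k f => // k IH f [f' hf hf']; exists f' => //; exact: IH. Qed.

Lemma diffn_ext k f g : f =1 g -> diffn k f -> diffn k g.
Proof. by move=> /funext ->. Qed.

Lemma diffn_cst k c : diffn k (fun=> c).
Proof.
by elim: k c => // k IH c; exists (fun=> 0) => [x|]; [exact: is_derive_cst|exact: IH].
Qed.

Lemma diffnD k f g : diffn k f -> diffn k g -> diffn k (fun x => f x + g x).
Proof.
elim: k f g => // k IH f g [f' hf kf] [g' hg kg].
exists (fun x => f' x + g' x); last exact: IH.
by move=> x; have := is_deriveD (hf x) (hg x).
Qed.

Lemma diffnM k f g : diffn k f -> diffn k g -> diffn k (fun x => f x * g x).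
Proof.
elim: k f g => // k IH f g fk gk.
have [f' hf kf] := fk; have [g' hg kg] := gk.
exists (fun x => f x * g' x + g x * f' x).
  by move=> x; have := is_deriveM (hf x) (hg x).
by apply: diffnD; apply: IH => //; exact: diffnS.
Qed.

Lemma is_derive_affine (a b x : R) : is_derive x 1 (fun y => a * y + b) a.
Proof.
have := is_deriveD (is_deriveZ a (is_derive_id x (1 : R))) (is_derive_cst b x (1 : R)).
by rewrite addr0 /GRing.scale/= mulr1.
Qed.

Lemma is_derive_comp_affine f (a b x df : R) :
  is_derive (a * x + b) 1 f df -> is_derive x 1 (fun y => f (a * y + b)) (a * df).
Proof.
move=> hf; rewrite mulrC.
exact: (@is_derive1_comp _ f (fun y => a * y + b) x _ _ hf (is_derive_affine a b x)).
Qed.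

Lemma diffn_affine k f a b : diffn k f -> diffn k (fun x => f (a * x + b)).
Proof.
elim: k f => // k IH f [f' hf kf].
exists (fun x => a * f' (a * x + b)).
  by move=> x; apply: is_derive_comp_affine.
by apply: diffnM; [exact: diffn_cst|exact: IH].
Qed.

Lemma smooth1_derive f : smooth1 f ->
  smooth1 f^`()%classic /\ forall x : R, is_derive x 1 f (f^`()%classic x).
Proof.
move=> sf; have [f' hf _] := sf 1%N.
have f'E : f^`()%classic = f'.
  by apply/funext => x; rewrite derive1E; apply: derive_val.
split=> [k|x]; last by rewrite f'E.
have [g hg kg] := sf k.+1.
by rewrite (_ : f^`()%classic = g)//; apply/funext => x; rewrite derive1E; apply: derive_val.
Qed.

(** The functions x^-k exp(-1/x) on the positive axis. Their derivatives are linear combinations of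
    members of the same family, which makes all of them smooth at once. *)
Definition expinv k (x : R) : R :=
  if 0 < x then x^-1 ^+ k * expR (- x^-1) else 0.

(** The term of order [k.+2] in the series of exp(1/x) beats x^-k and leaves a factor x^2, which
    makes the derivative at 0 vanish. *)
Lemma expinv_le k (x : R) : 0 < x -> `|expinv k x| <= (k.+2)`!%:R * x ^+ 2.
Proof.
move=> x0; have x0' := ltW x0.
rewrite /expinv x0 ger0_norm ?mulr_ge0 ?exprn_ge0 ?invr_ge0 ?expR_ge0//.
have := @expR_ge1Dxn R x^-1 k.+1; rewrite invr_ge0 => /(_ x0') h.
have f0 : 0 < (k.+2)`!%:R :> R by rewrite ltr0n fact_gt0.
rewrite expRN ler_pdivrMr ?expR_gt0//.
apply: (@le_trans _ _ ((k.+2)`!%:R * x ^+ 2 * (x^-1 ^+ k.+2 / (k.+2)`!%:R))); last first.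
  rewrite ler_wpM2l ?mulr_ge0 ?exprn_ge0//.
  by apply: le_trans h; rewrite lerDr.
rewrite le_eqVlt; apply/orP; left; apply/eqP.
rewrite -addn2 exprD mulrACA mulrA [(_ * _ / _)]mulrC.
by field; rewrite !gt_eqF.
Qed.

Lemma is_derive_expinv k (x : R) :
  is_derive x 1 (expinv k) (expinv k.+2 x - k%:R * expinv k.+1 x).
Proof.
have [x0|x0|->] := ltgtP x 0.
- rewrite {2 3}/expinv ltNge (ltW x0)/= mulr0 subr0.
  apply: (near_eq_is_derive _ (is_derive_cst 0 x 1)).
  near=> y; rewrite /expinv ltNge ltW//.
  by near: y; exact: lt_nbhsl.
- rewrite {2 3}/expinv x0.
  have xn0 : x != 0 by rewrite gt_eqF.
  have dV : is_derive x 1 (fun y : R => y^-1) (- x ^- 2).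
    by have := @is_deriveV R id x 1 1 xn0 (is_derive_id _ _); rewrite /= /GRing.scale/= mulr1.
  have dE : is_derive x 1 (fun y : R => expR (- y^-1)) (expR (- x^-1) * (x ^- 2)).
    have := is_derive1_comp (is_derive_expR _) (is_deriveN dV).
    by rewrite opprK.
  have dP : is_derive x 1 (fun y : R => y^-1 ^+ k) (k%:R * x^-1 ^+ k.-1 * (- x ^- 2)).
    by have := is_deriveX k dV; rewrite exprfctE.
  apply: (near_eq_is_derive _ (is_derive_eq (is_deriveM dP dE) _)).
    near=> y; rewrite /expinv (_ : 0 < y)//.
    by near: y; exact: lt_nbhsr.
  rewrite /GRing.scale/=.
  case: k {dP} => [|k]; first by rewrite mul0r !expr0 !mul0r; field.
  by rewrite /= -[x ^- 2]exprVn !exprS; ring.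
- rewrite {2 3}/expinv ltxx mulr0 subr0.
  have C0 : 0 < (k.+2)`!%:R :> R by rewrite ltr0n fact_gt0.
  have H : (h^-1 *: ((expinv k \o shift 0) (h *: (1 : R)) - expinv k 0)) @[h --> (0 : R)^'] --> (0 : R).
    apply/cvgr0Pnorm_le => e e0.
    have dC : 0 < e / (k.+2)`!%:R by rewrite divr_gt0.
    near=> h.
    have h0 : h != 0 by near: h; exact: nbhs_dnbhs_neq.
    rewrite /= addr0 /GRing.scale/= mulr1 {2}/expinv ltxx subr0 normrM normfV.
    have [hp|hn] := ltP 0 h; last by rewrite /expinv ltNge hn/= normr0 mulr0 ltW.
    rewrite ler_pdivrMl ?normr_gt0//; apply: (le_trans (expinv_le k hp)).
    rewrite (gtr0_norm hp) expr2 mulrA mulrC ler_pM2l// mulrC -ler_pdivlMr// ltW//.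
    rewrite -[h]gtr0_norm//; near: h; apply: dnbhs0_lt; exact: dC.
  apply: DeriveDef; first by apply/cvg_ex; exists 0.
  by rewrite /derive; exact/cvg_lim.
Unshelve. all: end_near. Qed.


Lemma smooth_expinv k : smooth1 (expinv k).
Proof.
move=> m; elim: m k => // m IH k.
exists (fun x => expinv k.+2 x - k%:R * expinv k.+1 x).
  exact: is_derive_expinv.
apply: (@diffn_ext _ (fun x => expinv k.+2 x + (- k%:R) * expinv k.+1 x)).
  by move=> x; rewrite mulNr.
by apply: diffnD => //; apply: diffnM => //; exact: diffn_cst.
Qed.

Lemma is_derive_continuous (F f : R -> R) :
  (forall x : R, is_derive x 1 F (f x)) -> continuous F.
Proof.
move=> Ff x; apply: differentiable_continuous; apply/derivable1_diffP.
by have [] := Ff x.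
Qed.

Lemma smooth1_continuous f : smooth1 f -> continuous f.
Proof. by move=> /smooth1_derive[_]; exact: is_derive_continuous. Qed.

Lemma continuous_measurable f : continuous f -> measurable_fun [set: R] f.
Proof. by move=> ?; exact: continuous_measurable_fun. Qed.

Local Notation mu := (@lebesgue_measure R).

Lemma FTC2_segment (f F : R -> R) c d : c < d -> continuous f ->
  (forall x : R, is_derive x 1 F (f x)) ->
  mu.-integrable `[c, d] (EFin \o f) /\
  (\int[mu]_(x in `[c, d]) (f x)%:E = (F d - F c)%:E)%E.
Proof.
move=> cd cf Ff; have cF := is_derive_continuous Ff; split.
  apply: continuous_compact_integrable; first exact: segment_compact.
  exact: continuous_subspaceT.
rewrite (@continuous_FTC2 _ f F)//.
- exact: continuous_subspaceT.
- split.
  + by move=> x _; have [] := Ff x.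
  + by apply: cvg_at_right_filter; exact: cF.
  + by apply: cvg_at_left_filter; exact: cF.
- by move=> x _; rewrite derive1E; apply: derive_val.
Qed.

Lemma FTC2_ray (f F : R -> R) c d : c < d -> continuous f ->
  (forall x : R, is_derive x 1 F (f x)) -> (forall x, d <= x -> f x = 0) ->
  mu.-integrable `[c, +oo[ (EFin \o f) /\
  (\int[mu]_(x in `[c, +oo[) (f x)%:E = (F d - F c)%:E)%E.
Proof.
move=> cd cf Ff f0; have [h1 h2] := FTC2_segment cd cf Ff.
have E : (EFin \o f) \_ `[c, +oo[ = (EFin \o f) \_ `[c, d].
  apply/funext => x; rewrite !patchE !mem_setE !in_itv/= andbT.
  by case: (leP c x) => //= cx; case: (leP x d) => //= dx; rewrite f0 ?ltW.
split.
  apply/(@integrable_mkcond _ _ _ mu _ (EFin \o f) (measurable_itv `[c, +oo[)); rewrite E.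
  exact/(@integrable_mkcond _ _ _ mu _ (EFin \o f) (measurable_itv `[c, d])).
by rewrite integral_mkcond E -integral_mkcond.
Qed.

Lemma FTC2_line (f F : R -> R) c d : c < d -> continuous f ->
  (forall x : R, is_derive x 1 F (f x)) -> (forall x, d <= x -> f x = 0) ->
  (forall x, x <= c -> f x = 0) ->
  mu.-integrable setT (EFin \o f) /\
  (\int[mu]_x (f x)%:E = (F d - F c)%:E)%E.
Proof.
move=> cd cf Ff f0 f0'; have [h1 h2] := FTC2_segment cd cf Ff.
have E : (EFin \o f) = (EFin \o f) \_ `[c, d].
  apply/funext => x; rewrite !patchE !mem_setE !in_itv/=.
  by case: (leP c x) => /= cx; [case: (leP x d) => //= dx; rewrite f0 ?ltW|rewrite f0' ?ltW].
split; last by rewrite -h2 [RHS]integral_mkcond -E.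
by rewrite E; apply/(@integrable_mkcond _ _ _ mu _ (EFin \o f) (measurable_itv `[c, d])).
Qed.

Definition bump0 (x : R) : R := expinv 0 x * expinv 0 (1 - x).

Lemma bump0_ge0 x : 0 <= bump0 x.
Proof.
rewrite /bump0 /expinv; apply: mulr_ge0; case: ifP => // _; rewrite expr0 mul1r expR_ge0//.
Qed.

Lemma bump0_out x : x <= 0 \/ 1 <= x -> bump0 x = 0.
Proof.
rewrite /bump0 /expinv => -[x0|x1]; first by rewrite (ltNge 0 x) x0/= mul0r.
by rewrite subr_gt0 (ltNge x) x1/= mulr0.
Qed.

Lemma smooth_bump0 : smooth1 bump0.
Proof.
move=> k; apply: diffnM; first exact: smooth_expinv.
apply: (@diffn_ext _ (fun x => expinv 0 (-1 * x + 1))).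
  by move=> x; congr expinv; ring.
by apply: diffn_affine; exact: smooth_expinv.
Qed.

Definition ramp0 (t : R) : R := \int[mu]_(x in `]-oo, t]) bump0 x.

Lemma integrable_bump0 : mu.-integrable setT (EFin \o bump0).
Proof.
have E : (EFin \o bump0) = (EFin \o bump0) \_ `[0, 1].
  apply/funext => x; rewrite !patchE !mem_setE !in_itv/=.
  case: (leP 0 x) => /= x0; last by rewrite bump0_out//; left; exact: ltW.
  by case: (leP x 1) => //= x1; rewrite bump0_out//; right; exact: ltW.
rewrite E; apply/(@integrable_mkcond _ _ _ mu _ (EFin \o bump0) (measurable_itv `[0, 1])).
apply: continuous_compact_integrable; first exact: segment_compact.
by apply: continuous_subspaceT; apply: smooth1_continuous; exact: smooth_bump0.
Qed.

Lemma is_derive_ramp0 (x : R) : is_derive x 1 ramp0 (bump0 x).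
Proof.
have ib : mu.-integrable `]-oo, (x + 1)] (EFin \o bump0).
  by apply: integrableS integrable_bump0.
have [] := @continuous_FTC1 R bump0 -oo%O x (x + 1) _ ib _ _.
- by rewrite ltrDl.
- by rewrite ltNyr.
- by apply: smooth1_continuous; exact: smooth_bump0.
by move=> h1 h2; apply: DeriveDef; [exact: h1|rewrite -h2 derive1E].
Qed.

Lemma ramp0_le0 x : x <= 0 -> ramp0 x = 0.
Proof.
move=> x0; rewrite /ramp0 /Rintegral (eq_integral (cst 0%E)) ?integral0//.
by move=> y; rewrite inE/= in_itv/= => yx; rewrite bump0_out//; left; exact: le_trans x0.
Qed.

Lemma ramp0_nd x y : x <= y -> ramp0 x <= ramp0 y.
Proof.
move=> xy; rewrite /ramp0 /Rintegral fine_le//.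
- by apply: integrable_fin_num => //; apply: integrableS integrable_bump0.
- by apply: integrable_fin_num => //; apply: integrableS integrable_bump0.
apply: ge0_subset_integral => //.
- have /measurable_int := integrable_bump0; exact: measurable_funS.
- by move=> z _; rewrite lee_fin bump0_ge0.
- by move=> z /=; rewrite !in_itv/= => /le_trans; exact.
Qed.

Lemma ramp0_ge1 x : 1 <= x -> ramp0 x = ramp0 1.
Proof.
move=> x1; rewrite /ramp0 /Rintegral; congr fine.
rewrite integral_mkcond [RHS]integral_mkcond; congr (integral _ _ _).
apply/funext => y; rewrite !patchE !mem_setE !in_itv/=.
case: (leP y x) => yx; case: (leP y 1) => // y1.
  by rewrite bump0_out//; right; exact: ltW.
by have := lt_le_trans yx y1; rewrite ltNge x1.
Qed.

(** Otherwise the monotone [ramp0] would vanish everywhere, and its derivative with it, whereas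
    [bump0] is positive at 1/2. *)
Lemma ramp0_1_gt0 : 0 < ramp0 1.
Proof.
rewrite lt_neqAle -{2}(ramp0_le0 (lexx 0)) ramp0_nd// andbT eq_sym.
apply/negP => /eqP r1.
have r0 x : ramp0 x = 0.
  apply/eqP; rewrite eq_le -{1}r1 -(ramp0_le0 (lexx 0)).
  have [x0|x0] := leP x 0.
    by rewrite (ramp0_le0 x0) (ramp0_le0 (lexx 0)) r1 lexx.
  rewrite (ramp0_nd (ltW x0)) andbT.
  by have [x1|x1] := leP x 1; [rewrite ramp0_nd|rewrite ramp0_ge1// ltW].
have : bump0 2^-1 = 0.
  have := is_derive_ramp0 2^-1.
  rewrite (_ : ramp0 = cst 0); last exact/funext.
  by move=> [_ <-]; rewrite derive_cst.
apply/eqP; rewrite /bump0 /expinv !ifT ?expr0 ?mul1r ?mulf_neq0 ?gt_eqF ?expR_gt0//.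
by rewrite subr_gt0 invf_lt1// ltr1n.
Qed.

(** Normalised to unit mass: [bumpR] is the mollifier, supported in [0, 1], and its primitive [ramp]
    rises smoothly from 0 to 1 there. *)
Definition bumpR x : R := bump0 x / ramp0 1.
Definition ramp x : R := ramp0 x / ramp0 1.

Lemma smooth_bump : smooth1 bumpR.
Proof. by move=> k; apply: diffnM; [exact: smooth_bump0|exact: diffn_cst]. Qed.

Lemma bump_ge0 x : 0 <= bumpR x.
Proof. by rewrite divr_ge0 ?bump0_ge0 ?ltW ?ramp0_1_gt0. Qed.

Lemma bump_out x : x <= 0 \/ 1 <= x -> bumpR x = 0.
Proof. by move=> h; rewrite /bumpR bump0_out ?mul0r. Qed.

Lemma is_derive_ramp (x : R) : is_derive x 1 ramp (bumpR x).
Proof.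
have := is_deriveM (is_derive_ramp0 x) (is_derive_cst (ramp0 1)^-1 x 1).
by rewrite scaler0 add0r /GRing.scale/= [X in is_derive _ _ _ X -> _]mulrC.
Qed.

Lemma ramp_le0 x : x <= 0 -> ramp x = 0.
Proof. by move=> h; rewrite /ramp ramp0_le0 ?mul0r. Qed.

Lemma ramp_ge1 x : 1 <= x -> ramp x = 1.
Proof. by move=> h; rewrite /ramp ramp0_ge1 ?divff ?gt_eqF ?ramp0_1_gt0. Qed.

Lemma smooth_ramp : smooth1 ramp.
Proof.
by case=> // k; exists bumpR; [exact: is_derive_ramp|exact: smooth_bump].
Qed.

Lemma ramp_itv x : 0 <= ramp x <= 1.
Proof.
have r1 := ltW ramp0_1_gt0.
apply/andP; split.
  apply: divr_ge0 => //; have [x0|/ltW x0] := leP x 0; first by rewrite ramp0_le0.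
  by rewrite -(ramp0_le0 (lexx 0)) ramp0_nd.
rewrite ler_pdivrMr ?ramp0_1_gt0// mul1r.
by have [x1|/ltW x1] := leP x 1; [rewrite ramp0_nd|rewrite ramp0_ge1].
Qed.

End smooth1.

(** * Integration against a measure given by a density *)

Section density.
Context d (T : measurableType d) (R : realType).
Variables (mu nu : {measure set T -> \bar R}) (p : T -> R).
Hypothesis mp : measurable_fun setT p.
Hypothesis p0 : forall x, 0 <= p x.
Hypothesis nuE : forall A, measurable A -> nu A = (\int[mu]_(x in A) (p x)%:E)%E.

Import HBNNSimple.

Let integral_density_nnsfun (f : {nnsfun T >-> R}) :
  (\int[nu]_x (f x)%:E = \int[mu]_x ((f x)%:E * (p x)%:E))%E.
Proof.
under eq_integral do rewrite fimfunE -fsumEFin//.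
have E x : ((f x)%:E * (p x)%:E =
    \sum_(r \in range f) ((r * \1_(f @^-1` [set r]) x)%:E * (p x)%:E))%E.
  rewrite fimfunE -fsumEFin// ge0_mule_fsuml// => r.
  by rewrite lee_fin; exact: nnfun_muleindic_ge0.
under [RHS]eq_integral do rewrite E.
rewrite ge0_integral_fsum//; last 2 first.
- by move=> r; exact/measurable_EFinP/measurableT_comp.
- by move=> r x _; rewrite lee_fin; exact: nnfun_muleindic_ge0.
rewrite ge0_integral_fsum//; last 2 first.
- move=> r; apply: emeasurable_funM; last exact/measurable_EFinP.
  exact/measurable_EFinP/measurableT_comp.
- by move=> r x _; rewrite mule_ge0 ?lee_fin//; exact: nnfun_muleindic_ge0.
apply: eq_fsbigr => r rf.
rewrite integralZl_indic_nnsfun// integral_indic// setIT nuE//.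
have [x _ fx] := set_mem rf.
under [RHS]eq_integral do rewrite EFinM -muleA.
rewrite ge0_integralZl//.
- congr (_ * _)%E.
  rewrite integral_mkcond; apply: eq_integral => z _.
  by rewrite patchE /indic; case: ifP => _; rewrite ?mul1e ?mul0e.
- by apply: emeasurable_funM; exact/measurable_EFinP.
- by move=> y _; rewrite mule_ge0 ?lee_fin.
- by rewrite lee_fin -fx.
Qed.

Lemma ge0_integral_density (f : T -> \bar R) :
  measurable_fun setT f -> (forall x, 0 <= f x)%E ->
  (\int[nu]_x f x = \int[mu]_x (f x * (p x)%:E))%E.
Proof.
move=> mf f0.
pose f_ := nnsfun_approx measurableT mf.
transitivity (lim (\int[nu]_x (f_ n x)%:E @[n --> \oo])%E).
  rewrite -monotone_convergence//=.
  - apply: eq_integral => ? /[!inE] xD; apply/esym/cvg_lim => //=.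
    exact: cvg_nnsfun_approx.
  - by move=> n; exact/measurable_EFinP/measurable_funTS.
  - by move=> n ? _; rewrite lee_fin.
  - by move=> ? _ ? ? mn; rewrite lee_fin; exact/lefP/nd_nnsfun_approx.
transitivity (lim (\int[mu]_x ((f_ n x)%:E * (p x)%:E) @[n --> \oo])%E).
  by apply: congr_lim; apply/funext => n /=; exact: integral_density_nnsfun.
rewrite -monotone_convergence//=.
- apply: eq_integral => x _; apply/cvg_lim => //.
  apply: cvgeZr => //; exact: cvg_nnsfun_approx.
- move=> n; apply: emeasurable_funM; last exact/measurable_EFinP.
  exact/measurable_EFinP/measurable_funTS.
- by move=> n x _; rewrite mule_ge0 ?lee_fin.
- move=> x _ a b ab; apply: lee_wpmul2r; rewrite lee_fin//.
  exact/lefP/nd_nnsfun_approx.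
Qed.

End density.

(** * Gaussian and Lebesgue measures *)

Section gaussian1.
Context {R : realType}.
Implicit Types (g : R -> \bar R) (s : R).
Local Notation mu := (@lebesgue_measure R).

Lemma ge0_integral_normal s g : measurable_fun setT g ->
  (forall a, 0 <= g a)%E ->
  (\int[normal_prob 0 s]_a g a = \int[mu]_a (g a * (normal_pdf 0 s a)%:E))%E.
Proof.
move=> mg g0; apply: ge0_integral_density => //.
- exact: measurable_normal_pdf.
- by move=> x; exact: normal_pdf_ge0.
Qed.

Lemma normal_peak1_le1 : @normal_peak R 1 <= 1.
Proof.
rewrite /normal_peak invf_le1; last by rewrite sqrtr_gt0 expr1n mul1r mulrn_wgt0 ?pi_gt0.
rewrite -{1}sqrtr1 ler_sqrt; last by rewrite expr1n mul1r mulrn_wge0 ?pi_ge0.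
by rewrite expr1n mul1r; have := @pi_ge2 R; lra.
Qed.

Lemma ge0_normal_le_lebesgue g : measurable_fun setT g ->
  (forall a, 0 <= g a)%E ->
  (\int[normal_prob 0 1]_a g a <= \int[mu]_a g a)%E.
Proof.
move=> mg g0; rewrite ge0_integral_normal//; apply: ge0_le_integral => //.
- by move=> x _; rewrite mule_ge0 ?lee_fin ?normal_pdf_ge0.
- apply: emeasurable_funM => //; apply/measurable_EFinP.
  exact: measurable_normal_pdf.
- move=> x _; rewrite -[leRHS]mule1; apply: lee_wpmul2l => //.
  rewrite lee_fin; apply: le_trans normal_peak1_le1.
  by apply: normal_pdf_ub; rewrite oner_eq0.
Qed.

Lemma ge0_lebesgue_le_normal (M : R) : exists2 C : R, 0 <= C &
  forall g, measurable_fun setT g -> (forall a, 0 <= g a)%E ->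
  (\int[mu]_a (g a * (\1_`[- M, M] a)%:E) <= C%:E * \int[normal_prob 0 1]_a g a)%E.
Proof.
(* A lower bound for the standard normal density on [-M, M], with a cruder exponent than - M^2 / 2;
   [C] is its inverse. *)
have p0 : 0 < @normal_peak R 1 * expR (- M ^+ 2).
  by rewrite mulr_gt0 ?expR_gt0// normal_peak_gt0// oner_eq0.
exists (@normal_peak R 1 * expR (- M ^+ 2))^-1; first by rewrite invr_ge0 ltW.
move=> g mg g0; rewrite ge0_integral_normal//.
have mgp : measurable_fun setT (fun a => (g a * (normal_pdf 0 1 a)%:E)%E).
  apply: emeasurable_funM => //; apply/measurable_EFinP.
  exact: measurable_normal_pdf.
have gp0 a : (0 <= g a * (normal_pdf 0 1 a)%:E)%E.
  by rewrite mule_ge0 ?lee_fin ?normal_pdf_ge0.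
rewrite -ge0_integralZl//; last by rewrite lee_fin invr_ge0 ltW.
apply: ge0_le_integral => //.
- by move=> x _; rewrite mule_ge0 ?lee_fin.
- by apply: emeasurable_funM => //; exact/measurable_EFinP/measurable_indic.
- exact: measurable_funeM.
move=> x _; rewrite muleCA; apply: lee_wpmul2l => //.
rewrite -EFinM lee_fin /indic mem_setE in_itv/=.
case: (boolP (- M <= x <= M)) => [/andP[x1 x2]|_] /=; last first.
  by rewrite mulr_ge0 ?invr_ge0 ?normal_pdf_ge0 ?(ltW p0).
rewrite ler_pdivlMl// mulr1 normal_pdfE ?oner_eq0//.
rewrite ler_pM2l ?normal_peak_gt0 ?oner_eq0// /normal_fun ler_expR subr0 expr1n.
have : x ^+ 2 <= M ^+ 2 by nra.
by have := sqr_ge0 x; lra.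
Qed.

(** The pushforward of Lebesgue measure under the affine map, multiplied by [s], agrees with
    Lebesgue measure on half-open intervals, hence equals it by uniqueness. *)
Lemma lebesgue_affine s (t : R) g : 0 < s -> measurable_fun setT g ->
  (forall a, 0 <= g a)%E ->
  (\int[mu]_a g (s * a + t)%R = s^-1%:E * \int[mu]_a g a)%E.
Proof.
move=> s0 mg g0.
pose phi (a : measurableTypeR R) : measurableTypeR R := s * a + t.
have mphi : measurable_fun setT phi.
  by apply: measurable_funD => //; exact: measurable_funM.
pose nu : {measure set _ -> \bar R} :=
  mscale (NngNum (ltW s0)) (pushforward mu phi).
have E : forall A, measurable A -> mu A = nu mphi A.
  apply: lebesgue_measure_unique => _ [[a b] _ <-].
  rewrite /nu /= /mscale/= /pushforward.
  rewrite (_ : _ @^-1` _ = `](a - t) / s, (b - t) / s]%classic); last first.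
    apply/seteqP; split => x /=; rewrite !in_itv/= /phi ltr_pdivrMr// ler_pdivlMr//;
    by rewrite ltrBlDr lerBrDr mulrC.
  rewrite !lebesgue_measure_itv/= !lte_fin ltr_pM2r ?invr_gt0// ltrD2r.
  case: ifP => _; last by rewrite mule0.
  by rewrite -!EFinD -EFinM; congr EFin; field; rewrite gt_eqF.
rewrite [in RHS](eq_measure_integral (nu mphi)); last by move=> A mA _; exact: E.
rewrite ge0_integral_mscale//= muleA -EFinM mulVf ?gt_eqF// mul1e.
by rewrite ge0_integral_pushforward.
Qed.

Lemma normal_pdf_scale s (b : R) : 0 < s ->
  s^-1 * normal_pdf 0 1 (s^-1 * b) = normal_pdf 0 s b.
Proof.
move=> s0; rewrite !normal_pdfE ?oner_eq0 ?gt_eqF// mulrA; congr (_ * _).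
  rewrite /normal_peak expr1n mul1r -mulrnAr sqrtrM ?sqr_ge0// sqrtr_sqr gtr0_norm//.
  by rewrite invfM.
rewrite /normal_fun !subr0; congr expR.
by rewrite exprMn expr1n exprVn; field; rewrite gt_eqF.
Qed.

Lemma normal_scale s g : 0 < s -> measurable_fun setT g ->
  (forall a, 0 <= g a)%E ->
  (\int[normal_prob 0 1]_a g (s * a)%R = \int[normal_prob 0 s]_a g a)%E.
Proof.
move=> s0 mg g0.
have mgs : measurable_fun setT (fun a => g (s * a)).
  by apply: measurableT_comp => //; exact: measurable_funM.
have E1 := ge0_integral_normal 1 mgs (fun a => g0 _).
have E2 := ge0_integral_normal s mg g0.
apply: (etrans E1); apply/esym; apply: (etrans E2); apply/esym.
pose G b := (g b * (normal_pdf 0 1 (s^-1 * b))%:E)%E.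
have mG : measurable_fun setT G.
  apply: emeasurable_funM => //; apply/measurable_EFinP.
  by apply: (measurableT_comp (measurable_normal_pdf 0 1)); exact: measurable_funM.
have G0 a : (0 <= G a)%E by rewrite mule_ge0 ?lee_fin ?normal_pdf_ge0.
transitivity (\int[mu]_a G (s * a + 0)%R)%E.
  by apply: eq_integral => a _; rewrite /G addr0 mulKf ?gt_eqF.
apply: (etrans (lebesgue_affine 0 s0 mG G0)).
have sV0 : (0 <= s^-1%:E)%E by rewrite lee_fin invr_ge0 ltW.
have E3 := @ge0_integralZl _ _ R mu setT measurableT G mG (s^-1)%:E (fun x _ => G0 x) sV0.
apply: (etrans (esym E3)).
by apply: eq_integral => b _; rewrite /G muleCA -EFinM normal_pdf_scale.
Qed.

Lemma normal_scaleV s g : 0 < s -> measurable_fun setT g ->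
  (forall a, 0 <= g a)%E ->
  (\int[normal_prob 0 s]_a g (s^-1 * a)%R = \int[normal_prob 0 1]_a g a)%E.
Proof.
move=> s0 mg g0.
rewrite -(@normal_scale s (fun a => g (s^-1 * a)))//; last first.
  by apply: measurableT_comp => //; exact: measurable_funM.
by apply: eq_integral => a _; rewrite mulKf ?gt_eqF.
Qed.

End gaussian1.

Section gaussian_row.
Context {R : realType} (n : nat).
Implicit Types (f : 'rV[R]_n -> \bar R) (s : R).

Lemma tensor1 (x : 'rV[R]_n) : tensor (fun=> cst (1 : R)) x = 1.
Proof. by rewrite /tensor big1. Qed.

Lemma row_map_id (x : 'rV[R]_n) : row_map (fun=> id) x = x.
Proof. by apply/rowP => i; rewrite mxE. Qed.

(** The one-dimensional density is bounded by 1, so the constant is 1 in every dimension. In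
    particular Lebesgue-null sets are Gaussian-null. *)
Lemma ge0_gaussian_le_lebesgue f : measurable_fun [set: 'rV[R]_n] f ->
  (forall x, 0 <= f x)%E ->
  (\int[gaussian n 1]_x f x <= \int[row_prod lebesgue_measure n]_x f x)%E.
Proof.
move=> mf f0.
have := @ge0_row_transfer R (normal_prob 0 1) lebesgue_measure n (fun=> id) (cst 1) 1 ler01.
move=> /(_ _ _ _ _ f mf f0).
rewrite expr1n mul1e => H.
under eq_integral => x _ do rewrite -[f x]mule1 -(tensor1 x) -{1}(row_map_id x).
apply: H => //.
move=> i g mg g0; rewrite mul1e.
by under eq_integral do rewrite mule1; exact: ge0_normal_le_lebesgue.
Qed.

(** The converse comparison, on a cube only. Together the two carry translation-invariant estimates,
    natural for Lebesgue measure, over to Gaussian L2 after a cutoff. *)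
Lemma ge0_lebesgue_le_gaussian (M : R) : exists2 C : R, 0 <= C &
  forall f, measurable_fun [set: 'rV[R]_n] f -> (forall x, 0 <= f x)%E ->
  (\int[row_prod lebesgue_measure n]_x (f x * (tensor (fun=> \1_`[- M, M]) x)%:E) <=
   C%:E * \int[gaussian n 1]_x f x)%E.
Proof.
have [C C0 H] := @ge0_lebesgue_le_normal R M.
exists (C ^+ n) => [|f mf f0]; first exact: exprn_ge0.
under eq_integral => x _ do rewrite -{1}(row_map_id x).
exact: (@ge0_row_transfer R lebesgue_measure (normal_prob 0 1)).
Qed.

Lemma gaussian_scale s f : 0 < s -> measurable_fun [set: 'rV[R]_n] f ->
  (forall x, 0 <= f x)%E ->
  (\int[gaussian n 1]_x f (s *: x) = \int[gaussian n s]_x f x)%E.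
Proof.
move=> s0 mf f0.
have scaleE (c : R) (x : 'rV[R]_n) : c *: x = row_map (fun=> ( *%R c)) x.
  by apply/rowP => i; rewrite !mxE.
have mT (c : R) : measurable_fun [set: 'rV[R]_n] (fun x => f (c *: x)).
  under eq_fun do rewrite scaleE.
  by apply: measurableT_comp => //; apply: measurable_row_map => _; exact: measurable_funM.
apply/eqP; rewrite eq_le; apply/andP; split.
- have := @ge0_row_transfer R (normal_prob 0 1) (normal_prob 0 s) n (fun=> ( *%R s)) (cst 1) 1 ler01.
  move=> /(_ _ _ _ _ f mf f0).
  rewrite expr1n mul1e => H.
  under eq_integral => x _ do rewrite -[f _]mule1 -(tensor1 x) scaleE.
  apply: H => // i g mg g0; rewrite mul1e.
  by under eq_integral do rewrite mule1; rewrite (@normal_scale R s g s0 mg g0).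
- have := @ge0_row_transfer R (normal_prob 0 s) (normal_prob 0 1) n (fun=> ( *%R s^-1)) (cst 1) 1 ler01.
  move=> /(_ _ _ _ _ _ (mT s)).
  rewrite expr1n mul1e => H.
  rewrite (eq_integral (fun x => f (s *: row_map (fun=> ( *%R s^-1)) x) * (tensor (fun=> cst (1 : R)) x)%:E)%E); last first.
    by move=> x _; rewrite tensor1 mule1 -scaleE scalerA mulfV ?gt_eqF// scale1r.
  apply: H => // i g mg g0; rewrite mul1e.
  by under eq_integral do rewrite mule1; rewrite (@normal_scaleV R s g s0 mg g0).
Qed.

Lemma lebesgue_row_affine s (t : 'rV[R]_n) f : 0 < s -> measurable_fun [set: 'rV[R]_n] f ->
  (forall x, 0 <= f x)%E ->
  (\int[row_prod lebesgue_measure n]_x f (t + s *: x)%R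
   = (s^-1 ^+ n)%:E * \int[row_prod lebesgue_measure n]_x f x)%E.
Proof.
move=> s0 mf f0.
have sV0 : 0 < s^-1 by rewrite invr_gt0.
pose T i a := s * a + t 0 i.
pose T' i a := s^-1 * a + (- s^-1 * t 0 i).
have mT i : measurable_fun setT (T i) by apply: measurable_funD => //; exact: measurable_funM.
have mT' i : measurable_fun setT (T' i) by apply: measurable_funD => //; exact: measurable_funM.
have TE x : t + s *: x = row_map T x.
  by apply/rowP => i; rewrite !mxE addrC.
have TT' x : row_map T (row_map T' x) = x.
  by apply/rowP => i; rewrite !mxE /T /T'; field; rewrite gt_eqF.
apply/eqP; rewrite eq_le; apply/andP; split.
- under eq_integral => x _ do rewrite -[f _]mule1 -(tensor1 x) TE.
  apply: ge0_row_transfer => //; first exact: ltW.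
  by move=> i g mg g0; under eq_integral do rewrite mule1; rewrite lebesgue_affine.
- have mfT : measurable_fun [set: 'rV[R]_n] (fun x => f (t + s *: x)).
    under eq_fun do rewrite TE.
    by apply: measurableT_comp => //; exact: measurable_row_map.
  have := @ge0_row_transfer R lebesgue_measure lebesgue_measure n T' (cst 1) s (ltW s0).
  move=> /(_ _ _ mT' _ _ mfT) H.
  rewrite exprVn lee_pdivrMl ?exprn_gt0//.
  rewrite [leLHS](eq_integral (fun x => f (t + s *: row_map T' x)%R * (tensor (fun=> cst (1 : R)) x)%:E)%E); last first.
    by move=> x _; rewrite tensor1 mule1 TE TT'.
  apply: H => // i g mg g0; under eq_integral do rewrite mule1.
  by rewrite lebesgue_affine// invrK.
Qed.

End gaussian_row.

(** * Test functions and mollification *)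

Section smooth_tensor.
Context {R : realType} (n : nat).
Implicit Types (phi : 'I_n -> R -> R).

Lemma is_derive_tensor phi (f' : R -> R) i (x : 'rV[R]_n) :
  (forall t : R, is_derive t 1 (phi i) (f' t)) ->
  is_derive x (delta_mx 0 i) (tensor phi)
    (tensor (fun j => if j == i then f' else phi j) x).
Proof.
move=> hf; pose c := \prod_(j | j != i) phi j (x 0 j).
have E (h : R) : tensor phi (h *: delta_mx 0 i + x) = phi i (h *: 1 + x 0 i) * c.
  rewrite /tensor (bigD1 i)//=; congr (_ * _).
    by rewrite !mxE !eqxx.
  by apply: eq_bigr => j /negbTE ji; rewrite !mxE ji andbF mulr0 add0r.
have E' : tensor (fun j => if j == i then f' else phi j) x = f' (x 0 i) * c.
  rewrite /tensor (bigD1 i)//= eqxx; congr (_ * _).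
  by apply: eq_bigr => j /negbTE ->.
have [df vf] := hf (x 0 i).
have H : h^-1 *: ((tensor phi \o shift x) (h *: delta_mx 0 i) - tensor phi x)
    @[h --> 0^'] --> f' (x 0 i) * c.
  have E0 : tensor phi x = phi i (x 0 i) * c.
    by rewrite /tensor (bigD1 i).
  rewrite (_ : (fun h => _) = fun h : R =>
    (h^-1 *: ((phi i \o shift (x 0 i)) (h *: 1) - phi i (x 0 i))) * c).
    by apply: cvgMl; rewrite -vf; exact: df.
  by apply/funext => h; rewrite /= E E0 -mulrBl scalerAl.
apply: DeriveDef; first by apply/cvg_ex; exists (f' (x 0 i) * c).
by rewrite E' /derive; exact/cvg_lim.
Qed.

Lemma partial_tensor phi i : (forall j, smooth1 (phi j)) ->
  partial i (tensor phi) =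
  tensor (fun j => if j == i then (phi j)^`()%classic else phi j).
Proof.
move=> sphi; apply/funext => x; rewrite /partial.
have [_ hd] := smooth1_derive (sphi i).
have [_ ->] := is_derive_tensor x hd.
by apply: eq_bigr => j _; case: eqP => // ->.
Qed.

Lemma continuous_tensor phi : (forall j, continuous (phi j)) ->
  continuous (tensor phi).
Proof.
move=> cphi; rewrite /tensor.
elim: (index_enum _) => [|i r IH] x.
  rewrite (_ : (fun _ => _) = cst 1); first exact: cst_continuous.
  by apply/funext => y; rewrite big_nil.
rewrite (_ : (fun _ => _) =
    (fun y : 'rV[R]_n => phi i (y 0 i) * \prod_(j <- r) phi j (y 0 j))); last first.
  by apply/funext => y; rewrite big_cons.
apply: continuousM; last exact: IH.
apply: (@continuous_comp _ _ _ (fun y : 'rV[R]_n => y 0 i) (phi i)); last exact: cphi.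
exact: coord_continuous.
Qed.

(** A partial derivative acts on a single factor, so every iterated partial derivative is again a
    tensor of smooth functions. *)
Lemma smooth_tensor phi : (forall j, smooth1 (phi j)) -> smooth (tensor phi).
Proof.
move=> sphi s.
have [psi spsi ->] : exists2 psi : 'I_n -> R -> R, (forall j, smooth1 (psi j)) &
    foldr (@partial R n) (tensor phi) s = tensor psi.
  elim: s => [|i s [psi spsi IH]]; first by exists phi.
  exists (fun j => if j == i then (psi j)^`()%classic else psi j).
    by move=> j; case: eqP => _ //; have [] := smooth1_derive (spsi j).
  by rewrite /= IH partial_tensor.
split; first by apply: continuous_tensor => j; exact: smooth1_continuous.
move=> i x; have [_ hd] := smooth1_derive (spsi i).
by have [] := is_derive_tensor x hd.
Qed.

Lemma compact_box (a b : 'I_n -> R) :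
  compact [set x : 'rV[R]_n | forall i, a i <= x 0 i <= b i].
Proof.
have := @rV_compact R n (fun i => `[a i, b i]%classic) (fun i => @segment_compact R (a i) (b i)).
congr compact; apply/seteqP; split => x /= h i; have := h i; rewrite in_itv//=.
Qed.

Lemma test_function_tensor phi (a b : 'I_n -> R) :
  (forall j, smooth1 (phi j)) ->
  (forall j t, ~~ (a j <= t <= b j) -> phi j t = 0) ->
  test_function (tensor phi).
Proof.
move=> sphi phi0; split; first exact: smooth_tensor.
apply: (@subclosed_compact _ _ [set x : 'rV[R]_n | forall i, a i <= x 0 i <= b i]).
- exact: closed_closure.
- exact: compact_box.
- rewrite closureE; apply: smallest_sub.
    have H : hausdorff_space 'rV[R]_n by exact: norm_hausdorff.
    have := compact_closed H (@compact_box a b).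
    by [].

  move=> x /= /eqP tx i; apply: contra_notP tx => /negP abx.
  by rewrite /tensor (bigD1 i)//= phi0 ?mul0r.
Qed.

End smooth_tensor.

(** * A one-sided mollifying kernel on the line *)

Section kernel1.
Context {R : realType}.
Implicit Types (e a t c : R).
Local Notation mu := (@lebesgue_measure R).

(** For [e > 0] this is, as a function of [t], a unit mass on [a, a + e]. [dker1] is its derivative
    in [t], the variable of integration; [step1 e c a] is its integral over the ray from [c], that
    is, the mollified indicator of the ray, evaluated at [a]. The argument is written as an affine
    map of [t] to match [is_derive_comp_affine]. *)
Definition ker1 e a t : R := e^-1 * bumpR (e^-1 * t + - (e^-1 * a)).
Definition dker1 e a t : R :=
  e^-1 * (e^-1 * bumpR^`()%classic (e^-1 * t + - (e^-1 * a))).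
Definition step1 e c a : R := 1 - ramp (e^-1 * c + - (e^-1 * a)).

Lemma smooth_ker1 e a : smooth1 (ker1 e a).
Proof.
move=> k; apply: diffnM; first exact: diffn_cst.
by apply: diffn_affine; exact: smooth_bump.
Qed.

Let is_derive_bump (x : R) : is_derive x 1 bumpR (bumpR^`()%classic x).
Proof. by have [] := smooth1_derive (@smooth_bump R). Qed.

Lemma is_derive_ker1 e a t : is_derive t 1 (ker1 e a) (dker1 e a t).
Proof.
have H := is_derive_comp_affine (is_derive_bump (e^-1 * t + - (e^-1 * a))).
exact: (is_deriveZ e^-1 H).
Qed.

Lemma derive_ker1 e a : (ker1 e a)^`()%classic = dker1 e a.
Proof.
by apply/funext => t; rewrite derive1E; have [_ ->] := is_derive_ker1 e a t.
Qed.

Lemma is_derive_ramp_ker1 e a t :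
  is_derive t 1 (fun t => ramp (e^-1 * t + - (e^-1 * a))) (ker1 e a t).
Proof. exact: (is_derive_comp_affine (is_derive_ramp _)). Qed.

Lemma is_derive_step1 e c a : is_derive a 1 (step1 e c) (ker1 e a c).
Proof.
have -> : step1 e c = fun a => 1 - ramp (- e^-1 * a + e^-1 * c).
  by apply/funext => x; rewrite /step1; congr (1 - ramp _); ring.
have E : - e^-1 * a + e^-1 * c = e^-1 * c + - (e^-1 * a) by rewrite addrC mulNr.
have H := is_derive_comp_affine (is_derive_ramp (- e^-1 * a + e^-1 * c)).
have := is_deriveB (is_derive_cst (1 : R) a (1 : R)) H.
by rewrite sub0r E mulNr opprK.
Qed.

Lemma ker1_ge0 e a t : 0 < e -> 0 <= ker1 e a t.
Proof. by move=> e0; rewrite mulr_ge0 ?bump_ge0 ?invr_ge0 ?(ltW e0). Qed.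

Let affineE e a t : e^-1 * t + - (e^-1 * a) = e^-1 * (t - a).
Proof. by rewrite mulrBr. Qed.

Lemma ker1_out e a t : 0 < e -> ~~ (a <= t <= a + e) -> ker1 e a t = 0.
Proof.
move=> e0 h; rewrite /ker1 affineE bump_out ?mulr0//.
rewrite ler_pdivlMl// mulr1 lerBrDl.
move: h; rewrite negb_and -!ltNge => /orP[h|h]; [left|right]; last exact: ltW.
by rewrite pmulr_rle0 ?invr_gt0// subr_le0 ltW.
Qed.

Lemma dbump_out (x : R) : x < 0 \/ 1 < x -> bumpR^`()%classic x = 0.
Proof.
move=> h; rewrite derive1E.
have H : \forall y \near x, cst (0 : R) y = bumpR y.
  case: h => h; near=> y; rewrite bump_out//; [left|right]; apply: ltW; near: y.
    exact: lt_nbhsl.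
  exact: lt_nbhsr.
by have [_ ->] := near_eq_is_derive H (is_derive_cst (0 : R) x (1 : R)).
Unshelve. all: by end_near. Qed.

Lemma dker1_out e a t : 0 < e -> ~~ (a <= t <= a + e) -> dker1 e a t = 0.
Proof.
move=> e0 h; rewrite /dker1 affineE dbump_out ?mulr0//.
move: h; rewrite negb_and -!ltNge => /orP[h|h]; [left|right].
  by rewrite pmulr_rlt0 ?invr_gt0// subr_lt0.
by rewrite ltr_pdivlMl// mulr1 ltrBrDl.
Qed.

Lemma continuous_dbump : continuous (bumpR^`()%classic : R -> R).
Proof.
by apply: smooth1_continuous; have [] := smooth1_derive (@smooth_bump R).
Qed.

Lemma dbump_bounded : exists M : R, forall t : R, `|bumpR^`()%classic t| <= M.
Proof.
have [||c _ hc] := @EVT_max R (fun t : R => `|bumpR^`()%classic t|) 0 1; first exact: ler01.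
  apply: continuous_subspaceT => x; apply: (@continuous_comp _ _ _ bumpR^`()%classic Num.norm).
    exact: continuous_dbump.
  exact: norm_continuous.
exists `|bumpR^`()%classic c| => t.
have [|h] := boolP (t \in `[0, 1]); first exact: hc.
rewrite dbump_out ?normr0//.
by move: h; rewrite in_itv/= negb_and -!ltNge => /orP[]; [left|right].
Qed.

Lemma continuous_dker1 e a : continuous (dker1 e a).
Proof.
have [sk _] := smooth1_derive (smooth_ker1 e a).
by rewrite -derive_ker1; exact: smooth1_continuous.
Qed.

Lemma step1_itv e c a : 0 <= step1 e c a <= 1.
Proof.
by rewrite /step1; have /andP[h1 h2] := ramp_itv (e^-1 * c + - (e^-1 * a)); apply/andP; split; lra.
Qed.

Lemma step1_ge e c a : 0 < e -> c <= a -> step1 e c a = 1.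
Proof.
move=> e0 ca; rewrite /step1 affineE ramp_le0 ?subr0//.
by rewrite pmulr_rle0 ?invr_gt0// subr_le0.
Qed.

Lemma step1_lt e c a : 0 < e -> e <= c - a -> step1 e c a = 0.
Proof.
move=> e0 ca; rewrite /step1 affineE ramp_ge1 ?subrr//.
by rewrite ler_pdivlMl// mulr1.
Qed.

Lemma integral_ker1 e a : 0 < e ->
  mu.-integrable setT (EFin \o ker1 e a) /\
  (\int[mu]_t (ker1 e a t)%:E = 1)%E.
Proof.
move=> e0; have := @FTC2_line R (ker1 e a)
  (fun t => ramp (e^-1 * t + - (e^-1 * a))) a (a + e).
rewrite !affineE subrr mulr0 (addrC a) addrK mulVf ?gt_eqF//.
rewrite ramp_ge1// ramp_le0// subr0; apply.
- by rewrite ltrDr.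
- by apply: smooth1_continuous; exact: smooth_ker1.
- by move=> x; exact: is_derive_ramp_ker1.
- move=> x h; rewrite /ker1 affineE bump_out ?mulr0//; right.
  by rewrite ler_pdivlMl// mulr1 lerBrDl addrC.
- move=> x h; rewrite /ker1 affineE bump_out ?mulr0//; left.
  by rewrite pmulr_rle0 ?invr_gt0// subr_le0.
Qed.

(** Mass one in the base point as well, which is the other half of Schur's test; the primitive in
    [a] is [step1 e t]. *)
Lemma integral_ker1l e t : 0 < e ->
  mu.-integrable setT (EFin \o (ker1 e ^~ t)) /\
  (\int[mu]_a (ker1 e a t)%:E = 1)%E.
Proof.
move=> e0; have := @FTC2_line R (ker1 e ^~ t) (step1 e t) (t - e) t.
rewrite (step1_ge e0 (lexx t)) (@step1_lt e t (t - e)) ?subr0//; last by rewrite opprB addrC subrK.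
apply.
- by rewrite gtrBl.
- have -> : ker1 e ^~ t = fun a => e^-1 * bumpR (- e^-1 * a + e^-1 * t).
    by apply/funext => x; rewrite /ker1; congr (_ * bumpR _); ring.
  apply: smooth1_continuous => k; apply: diffnM; first exact: diffn_cst.
  by apply: diffn_affine; exact: smooth_bump.
- by move=> x; exact: is_derive_step1.
- move=> x h; rewrite /ker1 affineE bump_out ?mulr0//; left.
  by rewrite pmulr_rle0 ?invr_gt0// subr_le0.
- move=> x h; rewrite /ker1 affineE bump_out ?mulr0//; right.
  by rewrite ler_pdivlMl// mulr1 lerBrDl -lerBrDr.
Qed.

Lemma integral_ray_ker1 e a c : 0 < e ->
  mu.-integrable setT (EFin \o (fun t => \1_`[c, +oo[ t * ker1 e a t)) /\
  (\int[mu]_t (\1_`[c, +oo[ t * ker1 e a t)%:E = (step1 e c a)%:E)%E.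
Proof.
(* Beyond both [c] and the support [a, a + e], so the integral over the ray stops at [d]. *)
move=> e0; pose d := Num.max c (a + e) + 1.
have cd : c < d by rewrite /d; have : c <= Num.max c (a + e); [rewrite le_max lexx|lra].
have ad : a + e <= d by rewrite /d; have : a + e <= Num.max c (a + e); [rewrite le_max lexx orbT|lra].
have := @FTC2_ray R (ker1 e a) (fun t => ramp (e^-1 * t + - (e^-1 * a))) c d cd.
rewrite (@ramp_ge1 R (e^-1 * d + - (e^-1 * a))); last first.
  by rewrite affineE ler_pdivlMl// mulr1 lerBrDl.
move=> [||x h|].
- by apply: smooth1_continuous; exact: smooth_ker1.
- by move=> x; exact: is_derive_ramp_ker1.
- rewrite /ker1 affineE bump_out ?mulr0//; right.
  by rewrite ler_pdivlMl// mulr1 lerBrDl (le_trans ad).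
move=> h1 h2.
have E : (EFin \o (fun t => \1_`[c, +oo[ t * ker1 e a t)) =
    (EFin \o ker1 e a) \_ `[c, +oo[.
  apply/funext => t; rewrite /= patchE /indic.
  by case: (t \in _); rewrite ?mul1r ?mul0r.
split; first by rewrite E; apply/(@integrable_mkcond _ _ _ mu _ _ (measurable_itv `[c, +oo[)).
by rewrite -h2 [RHS]integral_mkcond -E.
Qed.

Lemma integral_ray_dker1 e a c : 0 < e ->
  mu.-integrable setT (EFin \o (fun t => \1_`[c, +oo[ t * dker1 e a t)) /\
  (\int[mu]_t (\1_`[c, +oo[ t * dker1 e a t)%:E = (- ker1 e a c)%:E)%E.
Proof.
move=> e0; pose d := Num.max c (a + e) + 1.
have cd : c < d by rewrite /d; have : c <= Num.max c (a + e); [rewrite le_max lexx|lra].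
have ad : a + e < d by rewrite /d; have : a + e <= Num.max c (a + e); [rewrite le_max lexx orbT|lra].
have := @FTC2_ray R (dker1 e a) (ker1 e a) c d cd.
rewrite (@ker1_out e a d)//; last by rewrite negb_and -!ltNge ad orbT.
rewrite sub0r => -[||x h|].
- exact: continuous_dker1.
- by move=> x; exact: is_derive_ker1.
- by rewrite dker1_out// negb_and -!ltNge (lt_le_trans ad) ?orbT.
move=> h1 h2.
have E : (EFin \o (fun t => \1_`[c, +oo[ t * dker1 e a t)) =
    (EFin \o dker1 e a) \_ `[c, +oo[.
  apply/funext => t; rewrite /= patchE /indic.
  by case: (t \in _); rewrite ?mul1r ?mul0r.
split; first by rewrite E; apply/(@integrable_mkcond _ _ _ mu _ _ (measurable_itv `[c, +oo[)).
by rewrite -h2 [RHS]integral_mkcond -E.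
Qed.

(** A supremum bound times the length [e] of the support. The resulting constant is of order 1/e,
    which is harmless because the scale is fixed wherever it is used. *)
Lemma integral_abs_dker1 e : 0 < e -> exists C : R,
  (forall a, mu.-integrable setT (EFin \o (fun t => `|dker1 e a t|)) /\
    (\int[mu]_t `|dker1 e a t|%:E <= C%:E)%E) /\
  (forall t, mu.-integrable setT (EFin \o (fun a => `|dker1 e a t|)) /\
    (\int[mu]_a `|dker1 e a t|%:E <= C%:E)%E).
Proof.
move=> e0; have [M hM] := dbump_bounded.
have dM a t : `|dker1 e a t| <= e^-1 * (e^-1 * M).
  by rewrite !normrM gtr0_norm ?invr_gt0// !ler_wpM2l ?invr_ge0 ?(ltW e0).
pose K := e^-1 * (e^-1 * M).
have iI b : mu.-integrable setT (fun t => (\1_`[b, b + e] t)%:E).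
  exact: integrable_indic_itv.
have bnd (f : R -> R) (b : R) : measurable_fun setT f -> (forall t, `|f t| <= K * \1_`[b, b + e] t) ->
   mu.-integrable setT (EFin \o f) /\ (\int[mu]_t `|f t|%:E <= (K * e)%:E)%E.
  move=> mf hf.
  have iK : mu.-integrable setT (fun t => (K%:E * (\1_`[b, b + e] t)%:E)%E).
    by apply: integrableZl => //; exact: iI.
  have K0 : 0 <= K := le_trans (normr_ge0 _) (dM 0 0).
  split.
    apply: le_integrable iK => //; first exact/measurable_EFinP.
    by move=> t _; rewrite -EFinM /= lee_fin; exact: le_trans (hf t) (ler_norm _).
  apply: (@le_trans _ _ (\int[mu]_t (K%:E * (\1_`[b, b + e] t)%:E))%E).
    apply: ge0_le_integral => //.
    - by apply/measurable_EFinP; exact: measurableT_comp.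
    - by have /measurable_int := iK.
    - by move=> t _; rewrite -EFinM lee_fin.
  rewrite (integralZl measurableT (iI b)).
  have -> : (\int[mu]_t (\1_`[b, (b + e)] t)%:E = e%:E)%E; last by rewrite -EFinM.
  rewrite integral_indic// setIT; apply: (etrans (lebesgue_measure_itv _)) => /=.
  by rewrite lte_fin ltrDl e0 -EFinD addrAC subrr add0r.
have mc a : measurable_fun setT (dker1 e a).
  by apply: continuous_measurable; exact: continuous_dker1.
have mc' t : measurable_fun setT (dker1 e ^~ t).
  rewrite /dker1; do 2 (apply: measurable_funM => //).
  apply: (measurableT_comp (continuous_measurable continuous_dbump)).
  by apply: measurable_funD => //; apply: measurableT_comp => //; exact: measurable_funM.
exists (K * e); split=> [a|t].
- have [//|t|h1 h2] := bnd (fun t => `|dker1 e a t|) a.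
  + exact: measurableT_comp.
  + rewrite normr_id /indic mem_setE in_itv/=; case: (boolP (a <= t <= a + e)) => h.
      by rewrite mulr1.
    by rewrite dker1_out// normr0 mulr0.
  split=> //; apply: le_trans h2.
  by under [leRHS]eq_integral do rewrite normr_id.
- have [//|a|h1 h2] := bnd (fun a => `|dker1 e a t|) (t - e).
  + exact: measurableT_comp.
  + rewrite normr_id /indic mem_setE in_itv/= subrK; case: (boolP (t - e <= a <= t)) => h.
      by rewrite mulr1.
    rewrite dker1_out// ?normr0 ?mulr0//.
    by rewrite andbC lerBlDr in h *.
  split=> //; apply: le_trans h2.
  by under [leRHS]eq_integral do rewrite normr_id.
Qed.

End kernel1.

(** * Integral operators and Schur's test *)

Section kernel_bound.
Context d (T : measurableType d) (R : realType) (m : {measure set T -> \bar R}).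

Lemma ge0_integrable (f : T -> R) : measurable_fun setT f ->
  (forall x, 0 <= f x) -> (\int[m]_x (f x)%:E < +oo)%E ->
  m.-integrable setT (EFin \o f).
Proof.
move=> mf f0 foo; apply/integrableP; split; first exact/measurable_EFinP.
rewrite (eq_integral (fun x => (f x)%:E))// => x _ /=.
by rewrite ger0_norm.
Qed.

(* optimize [2 c u k - c^2 |k| <= u^2 |k|] over c *)
Lemma sqr_Rintegral_le (k u : T -> R) (A : R) : 0 < A ->
  measurable_fun setT u -> m.-integrable setT (EFin \o k) ->
  (\int[m]_x `|k x|%:E <= A%:E)%E ->
  (((\int[m]_x (u x * k x))%R ^+ 2)%:E <=
    A%:E * \int[m]_x (u x ^+ 2 * `|k x|)%:E)%E.
Proof.
move=> A0 mu ik kA.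
have mk : measurable_fun setT k by have /measurable_int /measurable_EFinP := ik.
have mJ : measurable_fun setT (fun x => (u x ^+ 2 * `|k x|)%:E).
  apply/measurable_EFinP; apply: measurable_funM; first exact: measurable_funX.
  exact: measurableT_comp.
have [Joo|] := boolP (\int[m]_x (u x ^+ 2 * `|k x|)%:E < +oo)%E; last first.
  by rewrite -leNgt leye_eq => /eqP ->; rewrite gt0_muley ?lte_fin// leey.
have iJ : m.-integrable setT (EFin \o (fun x => u x ^+ 2 * `|k x|)).
  apply: ge0_integrable => //; first exact/measurable_EFinP.
  by move=> x; rewrite mulr_ge0 ?sqr_ge0.
have iak : m.-integrable setT (EFin \o (fun x => `|k x|)) by exact: integrable_norm.
have iuk : m.-integrable setT (EFin \o (fun x => u x * k x)).
  apply: (le_integrable measurableT _ _ (integrableD measurableT iJ iak)).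
    by apply/measurable_EFinP; exact: measurable_funM.
  move=> x _ /=; rewrite lee_fin normrM [leRHS]ger0_norm; last first.
    by apply: addr_ge0 => //; apply: mulr_ge0 => //; exact: sqr_ge0.
  have := sqr_ge0 (`|u x| - 1); rewrite -[in u x ^+ 2](real_normK (num_real (u x))).
  by have := normr_ge0 (k x); nra.
set J := (\int[m]_x (u x ^+ 2 * `|k x|))%R.
have JE : (\int[m]_x (u x ^+ 2 * `|k x|)%:E)%E = J%:E.
  by rewrite /J /Rintegral fineK//; exact: (integrable_fin_num measurableT iJ).
rewrite JE -EFinM lee_fin.
set I := (\int[m]_x (u x * k x))%R.
have kA' : (\int[m]_x `|k x|)%R <= A.
  rewrite /Rintegral -lee_fin fineK//; exact: (integrable_fin_num measurableT iak).
have H c : 2 * c * I - c ^+ 2 * A <= J.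
  apply: (@le_trans _ _ (\int[m]_x (2 * c * (u x * k x) - c ^+ 2 * `|k x|))%R).
    rewrite RintegralB//; last 2 first.
    - by have := integrableZl measurableT (2 * c) iuk; apply: eq_integrable.
    - by have := integrableZl measurableT (c ^+ 2) iak; apply: eq_integrable.
    rewrite !RintegralZl// lerD2l lerN2 ler_wpM2l ?sqr_ge0//.
  apply: le_Rintegral => //.
    have := integrableB measurableT (integrableZl measurableT (2 * c) iuk)
      (integrableZl measurableT (c ^+ 2) iak).
    by apply: eq_integrable => // x _ /=; rewrite EFinB !EFinM.
  move=> x _.
  have : u x * k x * c <= `|u x| * `|k x| * `|c|.
    by rewrite -!normrM ler_norm.
  rewrite -(real_normK (num_real (u x))) -(real_normK (num_real c)).
  have := sqr_ge0 (`|u x| - `|c|); have := normr_ge0 (k x); nra.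
(* The maximiser of 2 c I - c^2 A over c; the maximum is I^2 / A. *)
have := H (I / A).
have -> : 2 * (I / A) * I - (I / A) ^+ 2 * A = I ^+ 2 / A by field; rewrite gt_eqF.
by rewrite ler_pdivrMr// mulrC.
Qed.

End kernel_bound.

Section measurable_integral.
Context d1 d2 (T1 : measurableType d1) (T2 : measurableType d2) (R : realType).
Variable m2 : {sigma_finite_measure set T2 -> \bar R}.

Lemma measurable_fun_integral_snd (f : T1 * T2 -> \bar R) :
  measurable_fun setT f -> measurable_fun setT (fun x => \int[m2]_y f (x, y))%E.
Proof.
move=> mf.
have -> : (fun x => \int[m2]_y f (x, y))%E =
  (fun x => \int[m2]_y f^\+ (x, y) - \int[m2]_y f^\- (x, y))%E.
  apply/funext => x; rewrite [LHS]integralE.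
  under eq_integral do rewrite funepos_comp/=.
  by under [X in (_ - X = _)%E]eq_integral do rewrite funeneg_comp/=.
apply: emeasurable_funB.
- by apply: measurable_fun_fubini_tonelli_F => //; exact: measurable_funepos.
- by apply: measurable_fun_fubini_tonelli_F => //; exact: measurable_funeneg.
Qed.

Lemma measurable_fun_Rintegral_snd (f : T1 * T2 -> R) :
  measurable_fun setT f -> measurable_fun setT (fun x => \int[m2]_y f (x, y))%R.
Proof.
move=> mf; apply: measurableT_comp; first exact: fine_measurable.
apply: (measurable_fun_integral_snd (f := EFin \o f)).
exact/measurable_EFinP.
Qed.

End measurable_integral.

Section kernel_row.
Context {R : realType} (n : nat).
Local Notation leb := (row_prod (@lebesgue_measure R) n).
Implicit Types (x w : 'rV[R]_n) (u : 'rV[R]_n -> R) (e : R) (K : 'rV[R]_n -> 'rV[R]_n -> R).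

Definition kern e x : 'rV[R]_n -> R := tensor (fun i => ker1 e (x 0 i)).
(** Differentiated in the integration variable rather than in [x], so that it is a partial
    derivative of the test function [kern e x]. *)
Definition dkern (j : 'I_n) e x : 'rV[R]_n -> R :=
  tensor (fun i => (if i == j then dker1 e else ker1 e) (x 0 i)).
Definition convk K u x : R := \int[leb]_w (u w * K x w).
Definition box (M : R) : 'rV[R]_n -> R := tensor (fun=> \1_`[- M, M]).

Lemma box_itv M x : 0 <= box M x <= 1.
Proof.
rewrite /box /tensor; apply/andP; split; first by apply: prodr_ge0.
by apply: prodr_ile1 => i _; rewrite /indic ler0n lern1 leq_b1.
Qed.

Lemma box1 M x : (forall i, `|x 0 i| <= M) -> box M x = 1.
Proof.
move=> h; rewrite /box /tensor big1// => i _.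
by rewrite /indic mem_set//= in_itv/= -ler_norml.
Qed.

Lemma box_neq0 M x : box M x != 0 -> forall i, `|x 0 i| <= M.
Proof.
move=> /prodf_neq0 h i; have := h i isT; rewrite /indic mem_setE in_itv/=.
by rewrite ler_norml; case: (_ <= _ <= _); rewrite ?eqxx.
Qed.

Lemma measurable_box M : measurable_fun setT (box M).
Proof. by apply: measurable_tensor => i; exact: measurable_indic. Qed.

Lemma measurable_ker1 e : measurable_fun setT (fun p : R * R => ker1 e p.1 p.2).
Proof.
apply: measurable_funM => //.
apply: (measurableT_comp (continuous_measurable (smooth1_continuous (@smooth_bump R)))).
apply: measurable_funD; first by apply: measurable_funM => //; exact: measurable_snd.
by apply: measurableT_comp => //; apply: measurable_funM => //; exact: measurable_fst.
Qed.

Lemma measurable_dker1 e : measurable_fun setT (fun p : R * R => dker1 e p.1 p.2).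
Proof.
do 2 apply: measurable_funM => //.
apply: (measurableT_comp (continuous_measurable (@continuous_dbump R))).
apply: measurable_funD; first by apply: measurable_funM => //; exact: measurable_snd.
by apply: measurableT_comp => //; apply: measurable_funM => //; exact: measurable_fst.
Qed.

Let measurable_coord_pair (k : 'I_n -> R -> R -> R) :
  (forall i, measurable_fun setT (fun p : R * R => k i p.1 p.2)) ->
  measurable_fun setT (fun p : 'rV[R]_n * 'rV[R]_n => tensor (fun i => k i (p.1 0 i)) p.2).
Proof.
move=> mk; apply: measurable_prod => i _.
apply: (measurableT_comp (mk i) (g := fun p : 'rV[R]_n * 'rV[R]_n => (p.1 0 i, p.2 0 i))).
apply/measurable_fun_pairP; split => /=.
  by apply: (measurableT_comp (measurable_coord i)); exact: measurable_fst.
by apply: (measurableT_comp (measurable_coord i)); exact: measurable_snd.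
Qed.

Lemma measurable_conv K u : measurable_fun setT (fun p : 'rV[R]_n * 'rV[R]_n => K p.1 p.2) ->
  measurable_fun [set: 'rV[R]_n] u -> measurable_fun [set: 'rV[R]_n] (convk K u).
Proof.
move=> mK mu.
apply: (measurable_fun_Rintegral_snd leb (f := fun p : 'rV[R]_n * 'rV[R]_n => u p.2 * K p.1 p.2)).
by apply: measurable_funM => //; apply: (measurableT_comp mu); exact: measurable_snd.
Qed.

(* the hypotheses of Schur's test, for a kernel of range 1 *)
Definition schur_kernel K (A : R) :=
  [/\ measurable_fun setT (fun p : 'rV[R]_n * 'rV[R]_n => K p.1 p.2),
      forall x, leb.-integrable setT (EFin \o K x) /\ (\int[leb]_w `|K x w|%:E <= A%:E)%E,
      forall w, (\int[leb]_x `|K x w|%:E <= A%:E)%E &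
      forall x w, K x w != 0 -> forall i, `|x 0 i - w 0 i| <= 1].

(** Schur's test is carried out for Lebesgue measure. It passes to the Gaussian because the kernel
    has range 1: for [x] in the cube of size [M] only the values of [u] on the cube of size [M + 1]
    matter, and there Lebesgue measure is dominated by the Gaussian one. The constant does not
    depend on the kernel beyond [A], so it is uniform over the scale of a mollifier. *)
Lemma schur_box A M : 0 < A -> exists2 C : R, 0 <= C &
  forall K u, schur_kernel K A -> measurable_fun [set: 'rV[R]_n] u ->
  (sqnorm (gaussian n 1) (fun x => box M x * convk K u x)%R <=
    C%:E * sqnorm (gaussian n 1) u)%E.
Proof.
move=> A0; have [C C0 HC] := @ge0_lebesgue_le_gaussian R n (M + 1).
exists (A * A * C); first by rewrite !mulr_ge0// ltW.
move=> K u [mK K1 K2 K3] mu; set f := fun x => box M x * convk K u x.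
have mf : measurable_fun [set: 'rV[R]_n] f.
  by apply: measurable_funM; [exact: measurable_box|exact: measurable_conv].
have mKx x : measurable_fun setT (K x) by have [/measurable_int /measurable_EFinP] := K1 x.
apply: (@le_trans _ _ (\int[leb]_x ((f x) ^+ 2)%:E)%E).
  apply: ge0_gaussian_le_lebesgue; first exact: measurable_sqr.
  by move=> x; rewrite lee_fin sqr_ge0.
(* The factor [box (M + 1)] equals 1 wherever [box M] and the kernel are both nonzero; it keeps the
   last comparison on a cube. *)
pose F (p : 'rV[R]_n * 'rV[R]_n) := ((u p.2 ^+ 2 * box (M + 1) p.2) * `|K p.1 p.2|)%:E.
have F0 p : (0 <= F p)%E.
  rewrite lee_fin mulr_ge0// mulr_ge0 ?sqr_ge0//.
  by have /andP[] := box_itv (M + 1) p.2.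
have mF : measurable_fun setT F.
  apply/measurable_EFinP; apply: measurable_funM; last exact: measurableT_comp.
  apply: (measurableT_comp (f := fun w => u w ^+ 2 * box (M + 1) w)); last exact: measurable_snd.
  by apply: measurable_funM; [exact: measurable_funX|exact: measurable_box].
have mFx x : measurable_fun setT (fun w => F (x, w)).
  by apply: (measurableT_comp mF); exact: measurable_pair1.
have mFw w : measurable_fun setT (fun x => F (x, w)).
  by apply: (measurableT_comp mF); exact: measurable_pair2.
apply: (@le_trans _ _ (A%:E * \int[leb]_x \int[leb]_w F (x, w))%E).
  rewrite -ge0_integralZl//; last 3 first.
  - exact: measurable_fun_fubini_tonelli_F.
  - by move=> x _; exact: integral_ge0.
  - by rewrite lee_fin ltW.
  apply: ge0_le_integral => //.
  - by move=> x _; rewrite lee_fin sqr_ge0.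
  - exact: measurable_sqr.
  - by apply: measurable_funeM; exact: measurable_fun_fubini_tonelli_F.
  move=> x _.
  have [b0|bN0] := eqVneq (box M x) 0.
    rewrite /f b0 mul0r expr0n/= mule_ge0 ?lee_fin ?(ltW A0)//.
    exact: integral_ge0.
  have xM := box_neq0 bN0.
  have [ik kA] := K1 x.
  apply: (@le_trans _ _ ((convk K u x) ^+ 2)%:E).
    rewrite lee_fin /f exprMn ler_piMl ?sqr_ge0//.
    by have /andP[h0 h1] := box_itv M x; rewrite expr_le1.
  apply: (le_trans (sqr_Rintegral_le A0 mu ik kA)).
  apply: lee_wpmul2l; first by rewrite lee_fin ltW.
  apply: ge0_le_integral => //.
  - by move=> w _; rewrite lee_fin mulr_ge0 ?sqr_ge0.
  - apply/measurable_EFinP; apply: measurable_funM; first exact: measurable_funX.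
    exact: measurableT_comp.
  move=> w _; rewrite /F lee_fin /=.
  have [->|kN0] := eqVneq (K x w) 0; first by rewrite normr0 !mulr0.
  rewrite box1 ?mulr1// => i.
  have := K3 _ _ kN0 i; have := xM i; rewrite !ler_norml => /andP[? ?] /andP[? ?].
  by apply/andP; split; lra.
rewrite -fubini_tonelli1// fubini_tonelli2//.
have -> : ((A * A * C)%:E * sqnorm (gaussian n 1) u =
  A%:E * (A%:E * (C%:E * sqnorm (gaussian n 1) u)))%E by rewrite !muleA -!EFinM.
apply: lee_wpmul2l; first by rewrite lee_fin ltW.
pose G w := ((u w ^+ 2)%:E * (box (M + 1) w)%:E)%E.
have G0 w : (0 <= G w)%E.
  by rewrite mule_ge0 ?lee_fin ?sqr_ge0//; have /andP[] := box_itv (M + 1) w.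
have mG : measurable_fun setT G.
  apply: emeasurable_funM; first exact: measurable_sqr.
  by apply/measurable_EFinP; exact: measurable_box.
apply: (@le_trans _ _ (A%:E * \int[leb]_w G w)%E); last first.
  apply: lee_wpmul2l; first by rewrite lee_fin ltW.
  apply: HC; first exact: measurable_sqr.
  by move=> x; rewrite lee_fin sqr_ge0.
rewrite -ge0_integralZl//; last by rewrite lee_fin ltW.
apply: ge0_le_integral => //.
- by move=> w _; exact: integral_ge0.
- exact: measurable_fun_fubini_tonelli_G.
- exact: measurable_funeM.
move=> w _; rewrite /fubini_G /F /=.
under eq_integral do rewrite EFinM.
rewrite ge0_integralZl//; last 2 first.
- do 2 apply: measurableT_comp => //.
  exact: (measurableT_comp mK (measurable_pair2 w)).
- by rewrite EFinM; exact: G0.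
rewrite muleC EFinM; apply: lee_pmul => //; first exact: integral_ge0.
  exact: G0.
exact: K2.
Qed.

Lemma normr_tensor (phi : 'I_n -> R -> R) x :
  `|tensor phi x| = tensor (fun i t => `|phi i t|) x.
Proof. by rewrite /tensor normr_prod. Qed.

Lemma schur_tensor (k : 'I_n -> R -> R -> R) (B : R) :
  (forall i, measurable_fun setT (fun p : R * R => k i p.1 p.2)) ->
  (forall i a, lebesgue_measure.-integrable setT (EFin \o k i a) /\
    (\int[lebesgue_measure]_t `|k i a t|%:E <= B%:E)%E) ->
  (forall i t, lebesgue_measure.-integrable setT (EFin \o (k i ^~ t)) /\
    (\int[lebesgue_measure]_a `|k i a t|%:E <= B%:E)%E) ->
  (forall i a t, k i a t != 0 -> `|a - t| <= 1) ->
  schur_kernel (fun x => tensor (fun i => k i (x 0 i))) (B ^+ n).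
Proof.
move=> mk k1 k2 k3.
have bnd (f : 'I_n -> R -> R) : (forall i, lebesgue_measure.-integrable setT (EFin \o f i) /\
    (\int[lebesgue_measure]_t `|f i t|%:E <= B%:E)%E) ->
    (\int[leb]_x `|tensor f x|%:E <= (B ^+ n)%:E)%E.
  move=> hf.
  have ia i : lebesgue_measure.-integrable setT (EFin \o (fun t => `|f i t|)).
    by apply: integrable_norm; have [] := hf i.
  have [it Et] := integrable_tensor ia.
  under eq_integral do rewrite normr_tensor.
  rewrite -[leLHS]fineK; last exact: (integrable_fin_num measurableT it).
  rewrite lee_fin [leLHS]Et -[X in B ^+ X]card_ord -prodr_const; apply: ler_prod => i _.
  rewrite Rintegral_ge0//= /Rintegral -lee_fin fineK; first by have [] := hf i.
  exact: (integrable_fin_num measurableT (ia i)).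
split.
- exact: measurable_coord_pair.
- move=> x; split; last by apply: bnd => i; exact: k1.
  by apply: (integrable_tensor _).1 => i; have [] := k1 i (x 0 i).
- move=> w; have := bnd (fun i => k i ^~ (w 0 i)) (fun i => k2 i (w 0 i)).
  by apply: le_trans; rewrite le_eqVlt eqxx.
- by move=> x w /prodf_neq0 h i; apply: (k3 i); exact: h.
Qed.

Lemma schur_kern e : 0 < e <= 1 -> schur_kernel (kern e) 1.
Proof.
move=> /andP[e0 e1]; rewrite -(expr1n R n).
apply: (@schur_tensor (fun=> ker1 e)).
- by move=> _; exact: measurable_ker1.
- move=> _ a; have [h1 h2] := integral_ker1 a e0; split=> //.
  by under eq_integral do rewrite ger0_norm ?ker1_ge0//; rewrite h2.
- move=> _ t; have [h1 h2] := integral_ker1l t e0; split=> //.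
  by under eq_integral do rewrite ger0_norm ?ker1_ge0//; rewrite h2.
- move=> _ a t h; have /andP[h1 h2] : a <= t <= a + e.
    by apply: contraNT h => /(ker1_out e0) ->.
  by rewrite ler_norml; apply/andP; split; lra.
Qed.

Lemma schur_dkern j e : 0 < e <= 1 -> exists2 A : R, 0 < A & schur_kernel (dkern j e) A.
Proof.
move=> /andP[e0 e1]; have [C [C1 C2]] := integral_abs_dker1 e0.
(* One bound for all factors: mass 1 for [ker1], at most [C] for the differentiated one. *)
pose B := Num.max C 1.
have B0 : 0 < B by rewrite lt_max ltr01 orbT.
exists (B ^+ n); first exact: exprn_gt0.
have mdk a : measurable_fun setT (dker1 e a).
  by apply: continuous_measurable; exact: continuous_dker1.
have mdk' t : measurable_fun setT (dker1 e ^~ t).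
  have := measurableT_comp (@measurable_dker1 e) (measurable_pair2 t).
  exact.
have intn (f : R -> R) : measurable_fun setT f ->
    lebesgue_measure.-integrable setT (EFin \o (fun t => `|f t|)) ->
    lebesgue_measure.-integrable setT (EFin \o f).
  move=> mf; apply: le_integrable => //; first exact/measurable_EFinP.
  by move=> t _ /=; rewrite normr_id.
apply: (@schur_tensor (fun i => if i == j then dker1 e else ker1 e)).
- by move=> i; case: ifP => _; [exact: measurable_dker1|exact: measurable_ker1].
- move=> i a; case: ifP => _.
    have [h1 h2] := C1 a; split; first exact: intn.
    by apply: (le_trans h2); rewrite lee_fin le_max lexx.
  have [h1 h2] := integral_ker1 a e0; split=> //.
  under eq_integral do rewrite ger0_norm ?ker1_ge0//.
  by rewrite h2 lee_fin le_max lexx orbT.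
- move=> i t; case: ifP => _.
    have [h1 h2] := C2 t; split; first exact: intn.
    by apply: (le_trans h2); rewrite lee_fin le_max lexx.
  have [h1 h2] := integral_ker1l t e0; split=> //.
  under eq_integral do rewrite ger0_norm ?ker1_ge0//.
  by rewrite h2 lee_fin le_max lexx orbT.
- move=> i a t h; have /andP[h1 h2] : a <= t <= a + e.
    by apply: contraNT h; case: ifP => _ h; rewrite ?(dker1_out e0 h) ?(ker1_out e0 h).
  by rewrite ler_norml; apply/andP; split; lra.
Qed.

End kernel_row.

(** * Convolution and mollification of step functions *)

Section convolution.
Context {R : realType} (n : nat).
Local Notation leb := (row_prod (@lebesgue_measure R) n).
Local Notation gam := (gaussian n (1 : R)).
Implicit Types (x w : 'rV[R]_n) (u : 'rV[R]_n -> R) (e : R) (K : 'rV[R]_n -> 'rV[R]_n -> R).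

Definition test1 (f : R -> R) := smooth1 f /\ exists M : R, forall t, M < `|t| -> f t = 0.

Definition dtensor (phi : 'I_n -> R -> R) (j : 'I_n) : 'rV[R]_n -> R :=
  tensor (fun i => if i == j then (phi i)^`()%classic else phi i).

(** Local integrability tested on cubes and expressed by a product with [box], a form that is easy
    to carry through sums and affine changes of variables. *)
Definition box_integrable u := measurable_fun [set: 'rV[R]_n] u /\
  forall M, leb.-integrable setT (EFin \o (fun x => box M x * u x)).

(* weak_partial tested only on products of functions of one variable, which is
   stable under affine changes of variables and all that the proof needs *)
Definition tensor_weak_partial (j : 'I_n) (g h : 'rV[R]_n -> R) :=
  [/\ box_integrable g, box_integrable h &
      forall phi, (forall i, test1 (phi i)) ->
        (\int[leb]_x (g x * dtensor phi j x)%:E =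
         - \int[leb]_x (h x * tensor phi x)%:E)%E].

Lemma loc_integrable_box u : loc_integrable u -> box_integrable u.
Proof.
move=> [mu lu]; split=> // M.
pose Q := [set w : 'rV[R]_n | forall i, - M <= w 0 i <= M].
have cQ : compact Q by exact: (@compact_box R n (fun=> - M) (fun=> M)).
have mQ : measurable Q.
  rewrite (_ : Q = \bigcap_(i in [set: 'I_n])
      ((fun w : 'rV[R]_n => w 0 i) @^-1` `[- M, M])); last first.
    by apply/seteqP; split => w h i; [move=> _|]; have := h i; rewrite /= in_itv/=; [|apply].
  apply: fin_bigcap_measurable; first exact: finite_finset.
  move=> i _; rewrite -[X in measurable X]setTI.
  by apply: measurable_coord => //; exact: measurable_itv.
have iQ : leb.-integrable Q (EFin \o u).
  apply/integrableP; split; last exact: lu.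
  by apply/measurable_EFinP; apply: measurable_funTS.
have := iQ; rewrite (@integrable_mkcond _ _ _ leb Q (EFin \o u) mQ).
congr (leb.-integrable _ _); apply/funext => w; rewrite patchE.
case: (boolP (w \in Q)) => Qw.
  rewrite /= box1 ?mul1r// => i.
  by move: Qw; rewrite inE => /(_ i); rewrite ler_norml.
have [b0|/box_neq0 bw] := eqVneq (box M w) 0; first by rewrite /= b0 mul0r.
case/negP: Qw; rewrite inE => i.
by have := bw i; rewrite ler_norml.
Qed.

Lemma weak_partial_tensor j g h : weak_partial j g h -> tensor_weak_partial j g h.
Proof.
move=> [lg lh gh]; split; [exact: loc_integrable_box|exact: loc_integrable_box|].
move=> phi nphi; have [M hM] := choice (fun i => proj2 (nphi i)).
rewrite -gh; last first.
  apply: (@test_function_tensor _ _ _ (fun i => - M i) M).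
    by move=> i; have [] := nphi i.
  by move=> i t; rewrite -ler_norml -ltNge; exact: hM.
by rewrite partial_tensor// => i; have [] := nphi i.
Qed.

Lemma integrable_conv u (k : 'rV[R]_n -> R) (M B : R) : box_integrable u ->
  measurable_fun [set: 'rV[R]_n] k -> (forall w, `|k w| <= B) ->
  (forall w, k w != 0 -> forall i, `|w 0 i| <= M) ->
  leb.-integrable setT (EFin \o (fun w => u w * k w)).
Proof.
move=> [mu bu] mk kB k0.
have iB := integrableZl measurableT B (bu M).
apply: (le_integrable measurableT _ _ iB).
  by apply/measurable_EFinP; exact: measurable_funM.
move=> w _; rewrite /= lee_fin.
have [->|kN0] := eqVneq (k w) 0; first by rewrite mulr0 normr0.
rewrite box1; last exact: k0.
rewrite mul1r !normrM mulrC ler_wpM2r//; exact: le_trans (kB w) (ler_norm _).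
Qed.

Let near_row x : exists M : R, forall w, (forall i, `|x 0 i - w 0 i| <= 1) ->
  forall i, `|w 0 i| <= M.
Proof.
have [K hK] := row_bound x; exists (K%:R + 1) => w h i.
have -> : w 0 i = x 0 i - (x 0 i - w 0 i) by ring.
by apply: (le_trans (ler_normB _ _)); apply: lerD.
Qed.

Lemma ker1_bounded e : 0 < e -> exists B : R, forall a t : R,
  `|ker1 e a t| <= B /\ `|dker1 e a t| <= B.
Proof.
move=> e0; have [M hM] := @dbump_bounded R.
have [||c _ hc] := @EVT_max R (fun t : R => `|bumpR t|) 0 1; first exact: ler01.
  apply: continuous_subspaceT => x; apply: (@continuous_comp _ _ _ bumpR Num.norm).
    exact: (smooth1_continuous (@smooth_bump R)).
  exact: norm_continuous.
pose C := `|bumpR c|.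
have hC t : `|bumpR t| <= C.
  have [|h] := boolP (t \in `[0, 1]); first exact: hc.
  rewrite bump_out ?normr0 ?normr_ge0//.
  by move: h; rewrite in_itv/= negb_and -!ltNge => /orP[/ltW|/ltW]; [left|right].
have eV0 : 0 <= e^-1 by rewrite invr_ge0 ltW.
exists (Num.max (e^-1 * C) (e^-1 * (e^-1 * M))) => a t; rewrite !le_max; split.
  by rewrite normrM (ger0_norm eV0) ler_wpM2l.
by apply/orP; right; rewrite !normrM (ger0_norm eV0) !ler_wpM2l.
Qed.

Lemma tensor_bounded (phi : 'I_n -> R -> R) (B : R) x :
  (forall i t, `|phi i t| <= B) -> `|tensor phi x| <= B ^+ n.
Proof.
move=> h; rewrite /tensor normr_prod -[X in B ^+ X]card_ord -prodr_const.
by apply: ler_prod => i _; rewrite normr_ge0 h.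
Qed.

Lemma integrable_conv_kern u e x : box_integrable u -> 0 < e <= 1 ->
  leb.-integrable setT (EFin \o (fun w => u w * kern e x w)).
Proof.
move=> lu e01; have /andP[e0 _] := e01; have [B hB] := ker1_bounded e0.
have [mK K1 _ K3] := schur_kern n e01.
have [M hM] := near_row x.
apply: (@integrable_conv u (kern e x) M (B ^+ n)) => //.
- by have [/measurable_int /measurable_EFinP] := K1 x.
- by move=> w; apply: tensor_bounded => i t; have [] := hB (x 0 i) t.
- by move=> w k0; apply: hM; exact: K3.
Qed.

Lemma integrable_conv_dkern u j e x : box_integrable u -> 0 < e <= 1 ->
  leb.-integrable setT (EFin \o (fun w => u w * dkern j e x w)).
Proof.
move=> lu e01; have /andP[e0 _] := e01; have [B hB] := ker1_bounded e0.
have [A _ [mK K1 _ K3]] := schur_dkern j e01.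
have [M hM] := near_row x.
apply: (@integrable_conv u (dkern j e x) M (B ^+ n)) => //.
- by have [/measurable_int /measurable_EFinP] := K1 x.
- move=> w; apply: tensor_bounded => i t; have [h1 h2] := hB (x 0 i) t.
  by case: ifP.
- by move=> w k0; apply: hM; exact: K3.
Qed.

Lemma test1_ker1 e a : 0 < e -> test1 (ker1 e a).
Proof.
move=> e0; split; first exact: smooth_ker1.
exists (`|a| + e) => t ta; apply: ker1_out => //; apply/negP => /andP[h1 h2].
move: ta; rewrite ltNge => /negP; apply; rewrite ler_norml.
have := ler_norm a; have := ler_norm (- a); rewrite normrN => *.
by apply/andP; split; lra.
Qed.

(** The kernel based at [x] is itself a product of test functions of the integration variable, so
    the definition of the weak derivative applies directly, with its minus sign. *)
Lemma conv_weak_partial j (g h : 'rV[R]_n -> R) e x : 0 < e ->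
  tensor_weak_partial j g h -> convk (dkern j e) g x = - convk (kern e) h x.
Proof.
move=> e0 [_ _ /(_ (fun i => ker1 e (x 0 i)) (fun i => test1_ker1 (x 0 i) e0)) E].
have dE : dtensor (fun i => ker1 e (x 0 i)) j = dkern j e x.
  apply/funext => w; apply: eq_bigr => i _.
  by case: ifP => _ //; rewrite derive_ker1.
by move: E; rewrite dE /convk /Rintegral -fineN => ->.
Qed.

Lemma indic_upper_tensor c x :
  \1_(upper c) x = tensor (fun i => \1_`[c i, +oo[) x :> R.
Proof.
rewrite /tensor /indic; case: (boolP (x \in upper c)) => h.
  rewrite big1// => i _; rewrite mem_set//= in_itv/= andbT.
  by move: h; rewrite inE => /(_ i).
have /existsP[i hi] : [exists i, ~~ (c i <= x 0 i)].
  rewrite -negb_forall; apply: contra h => /forallP h; rewrite inE => i.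
  exact: h.
by rewrite (bigD1 i)//= mem_setE in_itv/= andbT (negbTE hi) mul0r.
Qed.

(** The integral factors over the coordinates: a mollified orthant is an explicit product of smooth
    functions, which can be differentiated without touching an integral. *)
Lemma conv_kern_upper e c x : 0 < e ->
  convk (kern e) (\1_(upper c)) x = tensor (fun i => step1 e (c i)) x.
Proof.
move=> e0; rewrite /convk.
have hi i := integral_ray_ker1 (x 0 i) (c i) e0.
have [_ E] := integrable_tensor (fun i => (hi i).1).
rewrite (eq_Rintegral _ (g := tensor (fun i t => \1_`[c i, +oo[ t * ker1 e (x 0 i) t))).
  by rewrite E; apply: eq_bigr => i _; rewrite /Rintegral (hi i).2.
by move=> w _; rewrite indic_upper_tensor /tensor -big_split.
Qed.

Lemma conv_dkern_upper j e c x : 0 < e ->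
  convk (dkern j e) (\1_(upper c)) x =
  tensor (fun i a => if i == j then - ker1 e a (c i) else step1 e (c i) a) x.
Proof.
move=> e0; rewrite /convk.
have hi i : lebesgue_measure.-integrable setT (EFin \o (fun t => \1_`[c i, +oo[ t *
      (if i == j then dker1 e else ker1 e) (x 0 i) t)) /\
    (\int[lebesgue_measure]_t (\1_`[c i, +oo[ t *
      (if i == j then dker1 e else ker1 e) (x 0 i) t)%:E =
     (if i == j then - ker1 e (x 0 i) (c i) else step1 e (c i) (x 0 i))%:E)%E.
  case: ifP => _; first exact: integral_ray_dker1.
  exact: integral_ray_ker1.
have [_ E] := integrable_tensor (fun i => (hi i).1).
rewrite (eq_Rintegral _ (g := tensor (fun i t => \1_`[c i, +oo[ t *
    (if i == j then dker1 e else ker1 e) (x 0 i) t))).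
  by rewrite E; apply: eq_bigr => i _; rewrite /Rintegral (hi i).2.
by move=> w _; rewrite indic_upper_tensor /tensor -big_split.
Qed.


Lemma convkB K u v x :
  leb.-integrable setT (EFin \o (fun w => u w * K x w)) ->
  leb.-integrable setT (EFin \o (fun w => v w * K x w)) ->
  convk K (fun w => u w - v w) x = convk K u x - convk K v x.
Proof.
move=> iu iv; rewrite /convk -RintegralB//.
by apply: eq_Rintegral => w _; rewrite mulrBl.
Qed.

Lemma convk_stepf K s x :
  (forall c, leb.-integrable setT (EFin \o (fun w => \1_(upper c) w * K x w))) ->
  leb.-integrable setT (EFin \o (fun w => stepf s w * K x w)) /\
  convk K (stepf s) x = \sum_(p <- s) p.1 * convk K \1_(upper p.2) x.
Proof.
move=> iK; elim: s => [|p s [IH1 IH2]].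
  have E : (fun w : 'rV[R]_n => stepf [::] w * K x w) = cst 0.
    by apply/funext => w; rewrite /stepf big_nil mul0r.
  by rewrite /convk E big_nil Rintegral_cst// mul0r; split=> //; exact: integrable0.
have E : (fun w : 'rV[R]_n => stepf (p :: s) w * K x w) =
    (fun w => p.1 * (\1_(upper p.2) w * K x w) + stepf s w * K x w).
  by apply/funext => w; rewrite /stepf big_cons mulrDl mulrA.
have ip : leb.-integrable setT (EFin \o (fun w => p.1 * (\1_(upper p.2) w * K x w))).
  by have := integrableZl measurableT p.1 (iK p.2).
rewrite /convk E big_cons; split.
  by have := integrableD measurableT ip IH1.
rewrite (RintegralD measurableT ip IH1) (RintegralZl p.1 measurableT (iK p.2)).
by congr (_ + _); exact: IH2.
Qed.

Lemma integrable_upper_kern e c x : 0 < e ->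
  leb.-integrable setT (EFin \o (fun w => \1_(upper c) w * kern e x w)).
Proof.
move=> e0; have [it _] := integrable_tensor (fun i => (integral_ray_ker1 (x 0 i) (c i) e0).1).
apply: eq_integrable it => // w _ /=.
by rewrite indic_upper_tensor /tensor -big_split.
Qed.

Lemma integrable_upper_dkern j e c x : 0 < e ->
  leb.-integrable setT (EFin \o (fun w => \1_(upper c) w * dkern j e x w)).
Proof.
move=> e0.
have hi i : lebesgue_measure.-integrable setT (EFin \o (fun t => \1_`[c i, +oo[ t *
      (if i == j then dker1 e else ker1 e) (x 0 i) t)).
  case: ifP => _; first by have [] := integral_ray_dker1 (x 0 i) (c i) e0.
  by have [] := integral_ray_ker1 (x 0 i) (c i) e0.
have [it _] := integrable_tensor hi.
apply: eq_integrable it => // w _ /=.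
by rewrite indic_upper_tensor /tensor -big_split.
Qed.

Lemma convk_kern_stepf e s x : 0 < e ->
  convk (kern e) (stepf s) x =
  \sum_(p <- s) p.1 * tensor (fun i => step1 e (p.2 i)) x.
Proof.
move=> e0; have [_ ->] := convk_stepf s (fun c => integrable_upper_kern c x e0).
by apply: eq_bigr => p _; rewrite conv_kern_upper.
Qed.

Lemma convk_dkern_stepf j e s x : 0 < e ->
  convk (dkern j e) (stepf s) x = \sum_(p <- s) p.1 *
    tensor (fun i a => if i == j then - ker1 e a (p.2 i) else step1 e (p.2 i) a) x.
Proof.
move=> e0; have [_ ->] := convk_stepf s (fun c => integrable_upper_dkern j c x e0).
by apply: eq_bigr => p _; rewrite conv_dkern_upper.
Qed.

Lemma gaussian_setT (s : R) : gaussian n s setT = 1%E.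
Proof.
have i1 : (normal_prob 0 s).-integrable setT (EFin \o cst (1 : R)).
  exact: finite_measure_integrable_cst.
have [it Et] := integrable_tensor (fun _ : 'I_n => i1).
have : (\int[gaussian n s]_x (tensor (fun _ => cst (1 : R)) x)%:E = 1)%E.
  rewrite -[LHS]fineK; last exact: (integrable_fin_num measurableT it).
  have -> : fine (\int[gaussian n s]_x (tensor (fun=> cst 1) x)%:E) = \int[gaussian n s]_x (tensor (fun=> cst 1) x) by [].
  rewrite Et big1// => i _; rewrite Rintegral_cst// mul1r.
  exact: (congr1 fine (@probability_setT _ _ _ (normal_prob 0 s))).
under eq_integral do rewrite tensor1.
by rewrite integral_cst// mul1e.
Qed.

Lemma sqnorm_cst (c : R) : (sqnorm gam (cst c) < +oo)%E.
Proof.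
rewrite /sqnorm (eq_integral (cst (c ^+ 2)%:E))// integral_cst//.
by rewrite [X in (_ * X)%E](_ : _ = 1%E) ?mule1 ?ltry//; exact: gaussian_setT.
Qed.

(** Equality rather than mere convergence: the kernel looks to the right and the ray is closed on
    the left, so a point [a] with [c <= a] sees only the ray, and a point with [a < c] does not see
    it at all once the scale is below [c - a]. *)
Lemma step1_near (c a : R) : \forall k \near \oo, step1 k.+1%:R^-1 c a = \1_`[c, +oo[ a.
Proof.
have [ca|ac] := leP c a.
  by near=> k; rewrite step1_ge ?invr_gt0// /indic mem_setE in_itv/= andbT ca.
near=> k; rewrite step1_lt ?invr_gt0//.
  by rewrite /indic mem_setE in_itv/= andbT leNgt ac.
apply: ltW; near: k.
have ca0 : 0 < c - a by rewrite subr_gt0.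
exact: (near_infty_natSinv_lt (PosNum ca0)).
Unshelve. all: by end_near. Qed.

Lemma convk_stepf_near s x :
  \forall k \near \oo, convk (kern k.+1%:R^-1) (stepf s) x = stepf s x.
Proof.
suff H : \forall k \near \oo, \sum_(p <- s) p.1 * tensor (fun i => step1 k.+1%:R^-1 (p.2 i)) x = stepf s x.
  by near=> k; rewrite convk_kern_stepf ?invr_gt0//; near: k.
elim: s => [|p s IH]; first by near=> k; rewrite /stepf !big_nil.
have H : \forall k \near \oo, forall i, step1 k.+1%:R^-1 (p.2 i) (x 0 i) = \1_`[p.2 i, +oo[ (x 0 i).
  by apply: filter_forall => i; exact: step1_near.
near=> k; rewrite /stepf !big_cons indic_upper_tensor; congr (_ * _ + _).
  have Hk : forall i, step1 k.+1%:R^-1 (p.2 i) (x 0 i) = \1_`[p.2 i, +oo[ (x 0 i) by near: k.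
  by apply: eq_bigr => i _; exact: Hk.
by near: k.
Unshelve. all: by end_near. Qed.

Lemma convk_stepf_le e s x : 0 < e ->
  `|convk (kern e) (stepf s) x| <= \sum_(p <- s) `|p.1|.
Proof.
move=> e0; rewrite convk_kern_stepf//; apply: (le_trans (ler_norm_sum _ _ _)).
apply: ler_sum => p _; rewrite normrM ler_piMr//.
rewrite -(expr1n R n); apply: tensor_bounded => i t.
by have /andP[h1 h2] := step1_itv e (p.2 i) t; rewrite ger0_norm.
Qed.

Lemma stepf_le s x : `|stepf s x| <= \sum_(p <- s) `|p.1|.
Proof.
apply: (le_trans (ler_norm_sum _ _ _)).
apply: ler_sum => p _; rewrite normrM ler_piMr//.
by rewrite /indic; case: (_ \in _); rewrite ?normr1 ?normr0.
Qed.

(** Approximate [u] by a step function, whose mollification converges by dominated convergence, and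
    bound the mollified remainder by Schur's test uniformly in the scale. *)
Lemma convk_near u (M eta : R) : box_integrable u -> (sqnorm gam u < +oo)%E ->
  0 < eta -> \forall k \near \oo,
  (sqnorm gam (fun x => box M x * (convk (kern k.+1%:R^-1) u x - u x))%R <= eta%:E)%E.
Proof.
move=> lu uoo eta0; have [mu _] := lu.
have [C C0 HC] := @schur_box R n 1 M ltr01.
(* Chosen so that 2 (C + 2) d = eta / 2; the other half of [eta] is spent on the step function,
   whose bound eta / 8 is counted four times. *)
pose d := eta / (4 * (C + 2)).
have C2 : 0 < C + 2 by lra.
have d0 : 0 < d by rewrite divr_gt0// mulr_gt0.
have goo : (gam setT < +oo)%E by rewrite gaussian_setT ltry.
have [s hs] := stepf_dense goo mu uoo d0.
have mv := measurable_stepf s.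
have mk k : schur_kernel (kern (k.+1%:R^-1 : R)) 1 (n := n).
  by apply: schur_kern; rewrite invr_gt0 ltr0n/= invf_le1// ler1n.
have mcu k (f : 'rV[R]_n -> R) : measurable_fun [set: 'rV[R]_n] f ->
    measurable_fun [set: 'rV[R]_n] (convk (kern k.+1%:R^-1) f).
  by move=> mf; apply: measurable_conv => //; have [] := mk k.
have mb := @measurable_box R n M.
have h2 : sqnorm gam (fun x => box M x * (convk (kern k.+1%:R^-1) (stepf s) x - stepf s x)) @[k --> \oo] --> 0%E.
  apply: (@sqnorm_cvg0 _ _ _ _ _ (cst (2 * \sum_(p <- s) `|p.1|))).
  - by move=> k; apply: measurable_funM => //; apply: measurable_funB => //; exact: mcu.
  - by [].
  - exact: sqnorm_cst.
  - move=> k x; rewrite normrM.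
    have /andP[b0 b1] := box_itv M x; rewrite (ger0_norm b0).
    apply: (@le_trans _ _ (`|convk (kern k.+1%:R^-1) (stepf s) x - stepf s x|)).
      by rewrite ler_piMl.
    apply: le_trans (ler_norm _); apply: (le_trans (ler_normB _ _)).
    by rewrite mulr2n mulrDl mul1r lerD ?stepf_le// convk_stepf_le// invr_gt0.
  - move=> x; apply: cvg_near_cst; near=> k; apply/eqP.
    rewrite (_ : convk _ _ x = stepf s x) ?subrr ?mulr0//.
    by near: k; exact: convk_stepf_near.
have e8 : 0 < eta / 8 by rewrite divr_gt0.
near=> k.
pose r x := u x - stepf s x.
have mr : measurable_fun [set: 'rV[R]_n] r by exact: measurable_funB.
have e01 : 0 < (k.+1%:R^-1 : R) <= 1 by rewrite invr_gt0 ltr0n/= invf_le1// ler1n.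
have e0 : 0 < k.+1%:R^-1 :> R by rewrite invr_gt0.
have E : (fun x => box M x * (convk (kern k.+1%:R^-1) u x - u x)) =
  (fun x => box M x * convk (kern k.+1%:R^-1) r x +
    (box M x * (convk (kern k.+1%:R^-1) (stepf s) x - stepf s x) +
     (- box M x * r x))).
  apply/funext => x; rewrite /r convkB; last 2 first.
  - exact: integrable_conv_kern.
  - by have [] := convk_stepf s (fun c => integrable_upper_kern c x e0).
  ring.
rewrite E.
have m1 : measurable_fun [set: 'rV[R]_n] (fun x => box M x * convk (kern k.+1%:R^-1) r x).
  by apply: measurable_funM => //; exact: mcu.
have m2 : measurable_fun [set: 'rV[R]_n] (fun x => box M x * (convk (kern k.+1%:R^-1) (stepf s) x - stepf s x)).
  by apply: measurable_funM => //; apply: measurable_funB => //; exact: mcu.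
have m3 : measurable_fun [set: 'rV[R]_n] (fun x => - box M x * r x).
  by apply: measurable_funM => //; exact: measurableT_comp.
apply: (le_trans (sqnormD _ m1 (measurable_funD m2 m3))).
have n1 : (sqnorm gam (fun x => box M x * convk (kern k.+1%:R^-1) r x)%R <= (C * d)%:E)%E.
  apply: (le_trans (HC _ _ (mk k) mr)); rewrite EFinM; apply: lee_wpmul2l => //.
have n2 : (sqnorm gam (fun x => box M x * (convk (kern k.+1%:R^-1) (stepf s) x - stepf s x))%R <= (eta / 8)%:E)%E.
  by apply: ltW; near: k; exact: cvge0_near_lt.
have n3 : (sqnorm gam (fun x => - box M x * r x)%R <= d%:E)%E.
  apply: (@le_trans _ _ (sqnorm gam r)) => //; apply: le_sqnorm => // x.
  have /andP[b0 b1] := box_itv M x.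
  by rewrite mulNr normrN normrM (ger0_norm b0) ler_piMl.
apply: (@le_trans _ _ (2%:E * ((C * d)%:E + 2%:E * ((eta / 8)%:E + d%:E)))%E).
  apply: lee_wpmul2l => //; apply: leeD => //.
  apply: (le_trans (sqnormD _ m2 m3)); apply: lee_wpmul2l => //; exact: leeD.
rewrite -!(EFinD, EFinM) lee_fin.
have -> : 2 * (C * d + 2 * (eta / 8 + d)) = 2 * (C + 2) * d + eta / 2 by field.
rewrite /d; have -> : 2 * (C + 2) * (eta / (4 * (C + 2))) = eta / 2.
  by field; rewrite gt_eqF.
by rewrite -splitr.
Unshelve. all: by end_near. Qed.

End convolution.

(** * Density of test functions in Gaussian Sobolev spaces *)

Section cutoff.
Context {R : realType}.
Implicit Types (M t : R).

Definition cutR M t : R := ramp (t + (M + 1)) * ramp (- t + (M + 1)).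
Definition dcut M t : R :=
  bumpR (t + (M + 1)) * ramp (- t + (M + 1)) - ramp (t + (M + 1)) * bumpR (- t + (M + 1)).

Lemma is_derive_cut M t : is_derive t 1 (cutR M) (dcut M t).
Proof.
have h1 := is_derive_comp_affine (a := 1) (b := M + 1) (x := t) (is_derive_ramp _).
have h2 := is_derive_comp_affine (a := -1) (b := M + 1) (x := t) (is_derive_ramp _).
have H := is_deriveM h1 h2.
have E : cutR M = (fun y : R => ramp (1 * y + (M + 1))) * (fun y => ramp (-1 * y + (M + 1))).
  apply/funext => y; transitivity (ramp (1 * y + (M + 1)) * ramp (-1 * y + (M + 1))) => //.
  by rewrite mul1r mulN1r.
rewrite E; apply: is_derive_eq H _.
by rewrite /GRing.scale/= /dcut !mul1r !mulN1r; ring.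
Qed.

Lemma smooth_cut M : smooth1 (cutR M).
Proof.
move=> k; apply: diffnM.
  apply: (@diffn_ext _ _ (fun y => ramp (1 * y + (M + 1)))).
    by move=> x; rewrite mul1r.
  by apply: diffn_affine; exact: smooth_ramp.
apply: (@diffn_ext _ _ (fun y => ramp (-1 * y + (M + 1)))).
  by move=> x; rewrite mulN1r.
by apply: diffn_affine; exact: smooth_ramp.
Qed.

Lemma cut_itv M t : 0 <= cutR M t <= 1.
Proof.
have /andP[h1 h2] := ramp_itv (t + (M + 1)).
have /andP[h3 h4] := ramp_itv (- t + (M + 1)).
by rewrite mulr_ge0//= mulr_ile1.
Qed.

Lemma cut1 M t : `|t| <= M -> cutR M t = 1.
Proof.
rewrite ler_norml => /andP[h1 h2]; rewrite /cutR !ramp_ge1 ?mulr1//; lra.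
Qed.

Lemma dcut0 M t : `|t| <= M -> dcut M t = 0.
Proof.
rewrite ler_norml => /andP[h1 h2].
by rewrite /dcut !bump_out ?mul0r ?mulr0 ?subrr//; right; lra.
Qed.

Lemma cut_out M t : M + 1 < `|t| -> cutR M t = 0.
Proof.
rewrite lter_normr orbC => /orP[h|h]; rewrite /cutR.
  by rewrite (@ramp_le0 _ (t + _)) ?mul0r//; lra.
by rewrite (@ramp_le0 _ (- t + _)) ?mulr0//; lra.
Qed.

Lemma dcut_out M t : M + 1 < `|t| -> dcut M t = 0.
Proof.
rewrite lter_normr orbC => /orP[h|h]; rewrite /dcut.
  by rewrite (@ramp_le0 _ (t + _)) ?(@bump_out _ (t + _)) ?mul0r ?subrr//; [left|]; lra.
by rewrite (@ramp_le0 _ (- t + _)) ?(@bump_out _ (- t + _)) ?mulr0 ?subrr//; [left|]; lra.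
Qed.

(** The transition zones of [cutR M] have width 1 whatever [M], hence a bound independent of [M].
    The normalisation [1 <= L] ensures that dividing a tolerance by [L ^+ 2] does not increase
    it. *)
Lemma dcut_bounded : exists2 L : R, 1 <= L & forall M t, `|dcut M t| <= L.
Proof.
have [C hC] := ker1_bounded (@ltr01 R).
exists (Num.max 1 (C + C)); first by rewrite le_max lexx.
have bC t : `|bumpR t| <= C.
  (* At scale 1 and base point 0 the kernel is [bumpR] itself. *)
  have [+ _] := hC 0 t.
  by rewrite /ker1 invr1 !mul1r subr0.
move=> M t; rewrite le_max; apply/orP; right.
apply: (le_trans (ler_normB _ _)); apply: lerD; rewrite normrM.
  have /andP[h3 h4] := ramp_itv (- t + (M + 1)).
  by rewrite -[leRHS]mulr1; apply: ler_pM => //; rewrite ger0_norm.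
have /andP[h3 h4] := ramp_itv (t + (M + 1)).
by rewrite -[leRHS]mul1r; apply: ler_pM => //; rewrite ger0_norm.
Qed.

Lemma measurable_cutR M : measurable_fun setT (cutR M).
Proof.
by apply: continuous_measurable; apply: smooth1_continuous; exact: smooth_cut.
Qed.

Lemma measurable_dcut M : measurable_fun setT (dcut M).
Proof.
have -> : dcut M = (cutR M)^`()%classic.
  by apply/funext => t; rewrite derive1E; have [_ ->] := is_derive_cut M t.
have [sc _] := smooth1_derive (smooth_cut M).
by apply: continuous_measurable; exact: smooth1_continuous.
Qed.

End cutoff.

Section cutoff_row.
Context {R : realType} (n : nat).
Implicit Types (M : R) (x : 'rV[R]_n).

Definition chi M : 'rV[R]_n -> R := tensor (fun=> cutR M).
Definition dchi (j : 'I_n) M : 'rV[R]_n -> R :=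
  tensor (fun i => if i == j then dcut M else cutR M).

Lemma measurable_chi M : measurable_fun [set: 'rV[R]_n] (chi M).
Proof. by apply: measurable_tensor => _; exact: measurable_cutR. Qed.

Lemma measurable_dchi j M : measurable_fun [set: 'rV[R]_n] (dchi j M).
Proof.
by apply: measurable_tensor => i; case: ifP => _; [exact: measurable_dcut|exact: measurable_cutR].
Qed.

Lemma chi1 M x : (forall i, `|x 0 i| <= M) -> chi M x = 1.
Proof. by move=> h; rewrite /chi /tensor big1// => i _; exact: cut1. Qed.

Lemma dchi0 j M x : (forall i, `|x 0 i| <= M) -> dchi j M x = 0.
Proof. by move=> h; rewrite /dchi /tensor (bigD1 j)//= eqxx dcut0 ?mul0r. Qed.

Lemma chi_itv M x : 0 <= chi M x <= 1.
Proof.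
rewrite /chi /tensor prodr_ge0/=; last by move=> i _; have /andP[] := cut_itv M (x 0 i).
by apply: prodr_ile1 => i _; exact: cut_itv.
Qed.

Lemma box_case M x : (box M x = 1) + {i | M < `|x 0 i|}.
Proof.
case: (pickP [pred i | M < `|x 0 i|]) => [i hi|h]; [right; exists i => //|left].
by apply: box1 => i; have /negbT := h i; rewrite /= -leNgt.
Qed.

Lemma chi_box M x : `|chi M x| <= box (M + 1) x.
Proof.
have /andP[c0 c1] := chi_itv M x; rewrite ger0_norm//.
have [->//|[i hi]] := box_case (M + 1) x.
have /andP[b0 _] := box_itv (M + 1) x; apply: le_trans b0.
by rewrite /chi /tensor (bigD1 i)//= cut_out ?mul0r.
Qed.

Lemma dchi_box (L : R) j M x : 1 <= L -> (forall M t, `|dcut M t| <= L) ->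
  `|dchi j M x| <= L * box (M + 1) x.
Proof.
move=> L1 hL.
have [->|[i hi]] := box_case (M + 1) x; last first.
  have /andP[b0 _] := box_itv (M + 1) x.
  rewrite /dchi /tensor (bigD1 i)//= (_ : (if i == j then _ else _) _ = 0).
    by rewrite mul0r normr0 mulr_ge0// (le_trans _ L1).
  by case: ifP => _; [exact: dcut_out|exact: cut_out].
rewrite mulr1 /dchi /tensor (bigD1 j)//= eqxx normrM -[leRHS]mulr1; apply: ler_pM => //.
rewrite normr_prod; apply: prodr_ile1 => i /negbTE ->.
by rewrite normr_ge0/=; have /andP[c0 c1] := cut_itv M (x 0 i); rewrite ger0_norm.
Qed.

End cutoff_row.

(** * Simultaneous approximation of a function and its weak gradient *)

Section approximation.
Context {R : realType} (n : nat).
Local Notation gam := (gaussian n (1 : R)).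
Implicit Types (x : 'rV[R]_n).

(* DF is the gradient of F *)
Inductive test_pair : ('rV[R]_n -> R) -> ('I_n -> 'rV[R]_n -> R) -> Prop :=
| test_pair0 : test_pair (fun=> 0) (fun _ _ => 0)
| test_pairD c phi F DF : (forall i, test1 (phi i)) -> test_pair F DF ->
    test_pair (fun x => c * tensor phi x + F x)
          (fun j x => c * dtensor phi j x + DF j x).

(** A mollified orthant times the cutoff is a product of test functions of one variable. The minus
    sign arises because the kernel depends on the difference of its two variables: the gradient in
    [x] of the convolution is minus the convolution with [dkern]. *)
Lemma test_pair_mollify M e s : 0 < e ->
  test_pair (fun x => chi M x * convk (kern e) (stepf s) x)
    (fun j x => dchi j M x * convk (kern e) (stepf s) x
                - chi M x * convk (dkern j e) (stepf s) x).
Proof.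
move=> e0; elim: s => [|p s IH].
  have := test_pair0; congr test_pair.
    by apply/funext => x; rewrite convk_kern_stepf// big_nil mulr0.
  apply/funext => j; apply/funext => x.
  by rewrite convk_kern_stepf// convk_dkern_stepf// !big_nil !mulr0 subrr.
pose phi i t := cutR M t * step1 e (p.2 i) t.
have smooth_step c : smooth1 (step1 e c).
  case=> // k; exists (fun a => ker1 e a c); first by move=> a; exact: is_derive_step1.
  apply: (@diffn_ext _ _ (fun a => e^-1 * bumpR (- e^-1 * a + e^-1 * c))).
    by move=> a; rewrite /ker1; congr (_ * bumpR _); ring.
  by apply: diffnM; [exact: diffn_cst|apply: diffn_affine; exact: smooth_bump].
have nphi i : test1 (phi i).
  split; last by exists (M + 1) => t h; rewrite /phi cut_out ?mul0r.
  by move=> k; apply: diffnM; [exact: smooth_cut|exact: smooth_step].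
have dphi i : (phi i)^`()%classic =
    (fun t => dcut M t * step1 e (p.2 i) t + cutR M t * ker1 e t (p.2 i)).
  apply/funext => t; rewrite derive1E.
  have [_ ->] := is_deriveM (is_derive_cut M t) (is_derive_step1 e (p.2 i) t).
  by rewrite /GRing.scale/= addrC [step1 _ _ _ * _]mulrC.
have tphi x : tensor phi x = chi M x * tensor (fun i => step1 e (p.2 i)) x.
  by rewrite /tensor -big_split.
have := test_pairD p.1 nphi IH.
congr test_pair.
  apply/funext => x; rewrite !convk_kern_stepf// big_cons tphi; ring.
apply/funext => j; apply/funext => x.
rewrite !convk_kern_stepf// !convk_dkern_stepf// !big_cons.
have -> : dtensor phi j x = dchi j M x * tensor (fun i => step1 e (p.2 i)) x
   - chi M x * tensor (fun i a => if i == j then - ker1 e a (p.2 i) else step1 e (p.2 i) a) x.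
  (* Isolate the factor [j], the only one to which the product rule applies. *)
  have rest (f : 'I_n -> R -> R) : tensor f x = f j (x 0 j) * \prod_(i | i != j) f i (x 0 i).
    by rewrite /tensor (bigD1 j).
  rewrite /dtensor /dchi /chi !rest !eqxx dphi.
  set A := \prod_(i | i != j) (if i == j then _ else _) (x 0 i).
  set B := \prod_(i | i != j) (if i == j then dcut M else _) (x 0 i).
  set D := \prod_(i | i != j) step1 _ _ _.
  set C := \prod_(i | i != j) cutR _ _.
  set G := \prod_(i | i != j) (if i == j then _ else _).
  have -> : B = C by apply: eq_bigr => i /negbTE ->.
  have -> : G = D by apply: eq_bigr => i /negbTE ->.
  have -> : A = C * D by rewrite -big_split; apply: eq_bigr => i /negbTE ->.
  ring.
ring.
Qed.

Lemma sqnorm3 d (T : measurableType d) (m : {measure set T -> \bar R}) (u v w : T -> R) (a b c : R) :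
  measurable_fun setT u -> measurable_fun setT v -> measurable_fun setT w ->
  (sqnorm m u <= a%:E)%E -> (sqnorm m v <= b%:E)%E -> (sqnorm m w <= c%:E)%E ->
  (sqnorm m (fun t => u t + v t + w t)%R <= (4 * (a + b + c))%:E)%E.
Proof.
move=> mu mv mw ua vb wc.
have c0 : 0 <= c by rewrite -lee_fin (le_trans _ wc) ?sqnorm_ge0.
apply: (le_trans (sqnormD _ (measurable_funD mu mv) mw)).
apply: (@le_trans _ _ (2%:E * (2%:E * (a%:E + b%:E) + c%:E))%E).
  apply: lee_wpmul2l => //; apply: leeD => //.
  apply: (le_trans (sqnormD _ mu mv)); apply: lee_wpmul2l => //; exact: leeD.
by rewrite -!(EFinD, EFinM) lee_fin; lra.
Qed.

(* F is a cutoff times the mollification of a step function that is close to g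
   in L2; the derivative of the mollified g is moved to h, while that of the
   small error g - step function falls on the kernel and is controlled by
   Schur's test, the scale of the kernel being fixed before the step function *)
Theorem W12_approx (g : 'rV[R]_n -> R) (h : 'I_n -> 'rV[R]_n -> R) (eta : R) :
  box_integrable g -> (forall j, tensor_weak_partial j g (h j)) ->
  (sqnorm gam g < +oo)%E -> (forall j, (sqnorm gam (h j) < +oo)%E) -> 0 < eta ->
  exists F DF, [/\ test_pair F DF,
    measurable_fun [set: 'rV[R]_n] F /\ forall j, measurable_fun [set: 'rV[R]_n] (DF j),
    (sqnorm gam (fun x => g x - F x)%R <= eta%:E)%E &
    forall j, (sqnorm gam (fun x => h j x - DF j x)%R <= eta%:E)%E].
Proof.
move=> lg wgh goo hoo eta0.
have mg : measurable_fun [set: 'rV[R]_n] g by have [] := lg.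
have lh j : box_integrable (h j) by have [] := wgh j.
have mh j : measurable_fun [set: 'rV[R]_n] (h j) by have [] := lh j.
have [L L1 hL] := @dcut_bounded R.
have L0 : 0 < L by lra.
(* The gradient error splits into six terms and is bounded by 2 (12 th + 12 th) = 48 th. The smaller
   [th'] absorbs the factor [L ^+ 2] that comes with the derivative of the cutoff. *)
pose th := eta / 48.
have th0 : 0 < th by rewrite divr_gt0.
pose th' := th / L ^+ 2.
have L20 : 0 < L ^+ 2 by rewrite exprn_gt0.
have th'0 : 0 < th' by rewrite divr_gt0.
have th'th : th' <= th by rewrite ler_pdivrMr// ler_peMr ?(ltW th0)// exprn_ege1.
have bigM x : \forall k \near \oo, forall i, `|x 0 i| <= k%:R.
  have [K hK] := row_bound x; exists K => // k /= Kk i.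
  by apply: (le_trans (hK i)); rewrite ler_nat.
have trunc (u : 'rV[R]_n -> R) : measurable_fun [set: 'rV[R]_n] u -> (sqnorm gam u < +oo)%E ->
    \forall k \near \oo, (sqnorm gam (fun x => (1 - chi k%:R x) * u x)%R < th%:E)%E.
  move=> mu uoo.
  suff /cvge0_near_lt : sqnorm gam (fun x => (1 - chi k%:R x) * u x) @[k --> \oo] --> 0%E by apply.
  apply: (sqnorm_cvg0 (g := u)) => //.
  - by move=> k; apply: measurable_funM => //; apply: measurable_funB => //; exact: measurable_chi.
  - move=> k x; rewrite normrM ler_piMl//; have /andP[c0 c1] := chi_itv k%:R x.
    by rewrite ger0_norm; lra.
  - move=> x; apply: cvg_near_cst; near=> k; rewrite chi1 ?subrr ?mul0r//.
    by near: k; exact: bigM.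
have truncd j : \forall k \near \oo, (sqnorm gam (fun x => dchi j k%:R x * g x)%R < th%:E)%E.
  suff /cvge0_near_lt : sqnorm gam (fun x => dchi j k%:R x * g x) @[k --> \oo] --> 0%E by apply.
  apply: (sqnorm_cvg0 (g := fun x => L * g x)) => //.
  - by move=> k; apply: measurable_funM => //; exact: measurable_dchi.
  - exact: measurable_funM.
  - by rewrite sqnormZ//; apply: lte_mul_pinfty; rewrite ?lee_fin ?sqr_ge0.
  - move=> k x; rewrite !normrM; apply: ler_wpM2r => //.
    apply: (le_trans (dchi_box j k%:R x L1 hL)).
    have /andP[b0 b1] := box_itv (k%:R + 1) x.
    by apply: le_trans (ler_norm _); rewrite ler_piMr// ltW.
  - move=> x; apply: cvg_near_cst; near=> k; rewrite dchi0 ?mul0r//.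
    by near: k; exact: bigM.
have [k [tg th_ td]] : exists k : nat,
    [/\ (sqnorm gam (fun x => (1 - chi k%:R x) * g x)%R < th%:E)%E,
        forall j, (sqnorm gam (fun x => (1 - chi k%:R x) * h j x)%R < th%:E)%E &
        forall j, (sqnorm gam (fun x => dchi j k%:R x * g x)%R < th%:E)%E].
  have Hh : \forall k \near \oo, forall j, (sqnorm gam (fun x => (1 - chi k%:R x) * h j x)%R < th%:E)%E.
    by apply: filter_forall => j; exact: trunc.
  have Hd : \forall k \near \oo, forall j, (sqnorm gam (fun x => dchi j k%:R x * g x)%R < th%:E)%E.
    by apply: filter_forall => j; exact: truncd.
  near \oo => k; exists k; split.
  - by near: k; exact: trunc.
  - by near: k; exact: Hh.
  - by near: k; exact: Hd.
pose M : R := k%:R.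
have [k' [cg ch]] : exists k' : nat,
   (sqnorm gam (fun x => box (M + 1) x * (convk (kern k'.+1%:R^-1) g x - g x))%R <= th'%:E)%E /\
   forall j, (sqnorm gam (fun x => box (M + 1) x * (convk (kern k'.+1%:R^-1) (h j) x - h j x))%R <= th'%:E)%E.
  have Hh : \forall k' \near \oo, forall j, (sqnorm gam (fun x => box (M + 1) x * (convk (kern k'.+1%:R^-1) (h j) x - h j x))%R <= th'%:E)%E.
    by apply: filter_forall => j; exact: convk_near.
  near \oo => k'; exists k'; split.
  - by near: k'; exact: convk_near.
  - by near: k'; exact: Hh.
pose e : R := k'.+1%:R^-1.
have e0 : 0 < e by rewrite invr_gt0.
have e01 : 0 < e <= 1 by rewrite e0/= invf_le1// ler1n.
have [C0 C00 HC0] := @schur_box R n 1 (M + 1) ltr01.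
have Hj j : exists C : R, 0 <= C /\ forall u, measurable_fun [set: 'rV[R]_n] u ->
   (sqnorm gam (fun x => box (M + 1) x * convk (dkern j e) u x)%R <= C%:E * sqnorm gam u)%E.
  have [A A0 hA] := schur_dkern j e01.
  have [C C1 HC] := @schur_box R n A (M + 1) A0.
  by exists C; split => // u mu; exact: HC.
have [Cj hCj] := choice Hj.
(* Dominates every Schur constant at the scale [e]; the last summand makes it positive. *)
pose C := C0 + \sum_j Cj j + 1.
have Cs0 : 0 <= \sum_j Cj j by apply: sumr_ge0 => j _; have [] := hCj j.
have C_gt0 : 0 < C by rewrite /C; lra.
have CC0 : C0 <= C by rewrite /C; lra.
have CCj j : Cj j <= C.
  rewrite /C (bigD1 j)//=.
  have : 0 <= \sum_(i < n | i != j) Cj i by apply: sumr_ge0 => i _; have [] := hCj i.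
  lra.
have d0 : 0 < th' / C by rewrite divr_gt0.
have goo1 : (gam setT < +oo)%E by rewrite gaussian_setT ltry.
have [s hs] := stepf_dense goo1 mg goo d0.
pose r x := g x - stepf s x.
have mr : measurable_fun [set: 'rV[R]_n] r by apply: measurable_funB => //; exact: measurable_stepf.
have scl (c : R) (S : \bar R) : 0 <= c <= C -> (0 <= S)%E -> (S <= (th' / C)%:E)%E -> (c%:E * S <= th'%:E)%E.
  move=> /andP[c0 cC] S0 Sle; apply: (@le_trans _ _ (C%:E * (th' / C)%:E)%E).
    by apply: lee_pmul.
  by rewrite -EFinM lee_fin mulrC divfK ?gt_eqF.
have k1 : (sqnorm gam (fun x => box (M + 1) x * convk (kern e) r x)%R <= th'%:E)%E.
  apply: (le_trans (HC0 _ _ (schur_kern n e01) mr)); apply: scl => //; first by rewrite C00.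
  exact: sqnorm_ge0.
have k2 j : (sqnorm gam (fun x => box (M + 1) x * convk (dkern j e) r x)%R <= th'%:E)%E.
  have [c0 Hc] := hCj j.
  by apply: (le_trans (Hc _ mr)); apply: scl => //; [rewrite c0 CCj|exact: sqnorm_ge0].
exists (fun x => chi M x * convk (kern e) (stepf s) x).
exists (fun j x => dchi j M x * convk (kern e) (stepf s) x
                - chi M x * convk (dkern j e) (stepf s) x).
have [mKk _ _ _] := schur_kern n e01.
have mKd j : measurable_fun setT (fun p : 'rV[R]_n * 'rV[R]_n => dkern j e p.1 p.2).
  by have [A _ []] := schur_dkern j e01.
have mck u : measurable_fun [set: 'rV[R]_n] u -> measurable_fun [set: 'rV[R]_n] (convk (kern e) u).
  by move=> mu; exact: measurable_conv.
have mcd j u : measurable_fun [set: 'rV[R]_n] u -> measurable_fun [set: 'rV[R]_n] (convk (dkern j e) u).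
  by move=> mu; exact: measurable_conv.
have mchi := @measurable_chi R n M.
have mdchi j := @measurable_dchi R n j M.
have mbox := @measurable_box R n (M + 1).
have ms := @measurable_stepf R n s.
have ikg u x : box_integrable u -> (row_prod lebesgue_measure n).-integrable setT (EFin \o (fun w => u w * kern e x w)).
  by move=> lu; exact: integrable_conv_kern.
have iks x : (row_prod lebesgue_measure n).-integrable setT (EFin \o (fun w => stepf s w * kern e x w)).
  by have [] := convk_stepf s (fun c => integrable_upper_kern c x e0).
have ids j x : (row_prod lebesgue_measure n).-integrable setT (EFin \o (fun w => stepf s w * dkern j e x w)).
  by have [] := convk_stepf s (fun c => integrable_upper_dkern j c x e0).
have kE x : convk (kern e) (stepf s) x = convk (kern e) g x - convk (kern e) r x.
  by rewrite /r convkB//; [ring|exact: ikg].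
have dE j x : convk (dkern j e) (stepf s) x = - convk (kern e) (h j) x - convk (dkern j e) r x.
  rewrite /r convkB//; last exact: integrable_conv_dkern.
  by rewrite (conv_weak_partial x e0 (wgh j)); ring.
have bchi u : measurable_fun [set: 'rV[R]_n] u ->
    (sqnorm gam (fun x => box (M + 1) x * u x)%R <= th'%:E)%E ->
    (sqnorm gam (fun x => chi M x * u x)%R <= th%:E)%E.
  move=> mu ub; apply: (@le_trans _ _ th'%:E) => //; apply: le_trans ub.
  apply: le_sqnorm; [exact: measurable_funM|exact: measurable_funM|move=> x].
  rewrite !normrM; apply: ler_wpM2r => //; apply: (le_trans (chi_box _ _)); exact: ler_norm.
have bdchi j u : measurable_fun [set: 'rV[R]_n] u ->
    (sqnorm gam (fun x => box (M + 1) x * u x)%R <= th'%:E)%E ->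
    (sqnorm gam (fun x => dchi j M x * u x)%R <= th%:E)%E.
  move=> mu ub; apply: (@le_trans _ _ (sqnorm gam (fun x => L * (box (M + 1) x * u x))%R)).
    apply: le_sqnorm; [exact: measurable_funM| |move=> x].
      by do 2 apply: measurable_funM => //.
    rewrite mulrA normrM [leRHS]normrM; apply: ler_wpM2r => //.
    by apply: (le_trans (dchi_box _ _ _ L1 hL)); exact: ler_norm.
  rewrite sqnormZ; last exact: measurable_funM.
  apply: (@le_trans _ _ ((L ^+ 2)%:E * th'%:E)%E).
    by apply: lee_wpmul2l => //; rewrite lee_fin sqr_ge0.
  by rewrite -EFinM lee_fin mulrC divfK ?gt_eqF.
have bN u : (sqnorm gam (fun x => - u x)%R = sqnorm gam u)%E.
  by rewrite /sqnorm; apply: eq_integral => x _; rewrite sqrrN.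
have m1chi u : measurable_fun [set: 'rV[R]_n] u -> measurable_fun [set: 'rV[R]_n] (fun x => (1 - chi M x) * u x).
  by move=> mu; apply: measurable_funM => //; exact: measurable_funB.
split.
- exact: test_pair_mollify.
- split; first by apply: measurable_funM => //; exact: mck.
  move=> j; apply: measurable_funB; apply: measurable_funM => //; [exact: mck|exact: mcd].
- have -> : (fun x => g x - chi M x * convk (kern e) (stepf s) x) =
    (fun x => (1 - chi M x) * g x + - (chi M x * (convk (kern e) g x - g x))
       + chi M x * convk (kern e) r x).
    by apply/funext => x; rewrite kE; ring.
  apply: (le_trans (sqnorm3 (a := th) (b := th) (c := th) _ _ _ _ _ _)).
  + exact: m1chi.
  + apply: measurableT_comp => //; apply: measurable_funM => //.
    by apply: measurable_funB => //; exact: mck.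
  + by apply: measurable_funM => //; exact: mck.
  + exact: ltW.
  + by rewrite bN; apply: bchi => //; apply: measurable_funB => //; exact: mck.
  + by apply: bchi => //; exact: mck.
  + by rewrite lee_fin /th; lra.
- move=> j.
  (* Truncation, mollification and step-function errors of [chi M * h j], then three terms from the
     derivative of the cutoff. The term [dchi j M * g] is small by itself, as [dchi j M] vanishes on
     the cube of size [M]. *)
  have -> : (fun x => h j x - (dchi j M x * convk (kern e) (stepf s) x
                - chi M x * convk (dkern j e) (stepf s) x)) =
    (fun x => ((1 - chi M x) * h j x + - (chi M x * (convk (kern e) (h j) x - h j x))
       + - (chi M x * convk (dkern j e) r x)) +
       (- (dchi j M x * g x) + - (dchi j M x * (convk (kern e) g x - g x))
        + dchi j M x * convk (kern e) r x)).
    by apply/funext => x; rewrite kE dE; ring.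
  have mchh : measurable_fun [set: 'rV[R]_n] (fun x => - (chi M x * (convk (kern e) (h j) x - h j x))).
    apply: measurableT_comp => //; apply: measurable_funM => //.
    by apply: measurable_funB => //; exact: mck.
  have mchd : measurable_fun [set: 'rV[R]_n] (fun x => - (chi M x * convk (dkern j e) r x)).
    apply: measurableT_comp => //; apply: measurable_funM => //; exact: mcd.
  have mdg : measurable_fun [set: 'rV[R]_n] (fun x => - (dchi j M x * g x)).
    by apply: measurableT_comp => //; apply: measurable_funM.
  have mdgg : measurable_fun [set: 'rV[R]_n] (fun x => - (dchi j M x * (convk (kern e) g x - g x))).
    apply: measurableT_comp => //; apply: measurable_funM => //.
    by apply: measurable_funB => //; exact: mck.
  have mdr : measurable_fun [set: 'rV[R]_n] (fun x => dchi j M x * convk (kern e) r x).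
    by apply: measurable_funM => //; exact: mck.
  apply: (le_trans (sqnormD _ _ _)).
  + by apply: measurable_funD => //; apply: measurable_funD => //; exact: m1chi.
  + by apply: measurable_funD => //; exact: measurable_funD.
  apply: (@le_trans _ _ (2%:E * ((4 * (th + th + th))%:E + (4 * (th + th + th))%:E))%E); last first.
    by rewrite -!(EFinD, EFinM) lee_fin /th; lra.
  apply: lee_wpmul2l => //; apply: leeD; apply: sqnorm3 => //.
  + exact: m1chi.
  + exact: ltW.
  + by rewrite bN; apply: bchi => //; apply: measurable_funB => //; exact: mck.
  + by rewrite bN; apply: bchi; [exact: mcd|exact: k2].
  + by rewrite bN; apply: ltW; exact: td.
  + by rewrite bN; apply: bdchi => //; apply: measurable_funB => //; exact: mck.
  + by apply: bdchi => //; exact: mck.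
Unshelve. all: by end_near. Qed.

End approximation.

(** * Stein's identities of first and second order *)

Section stein1.
Context {R : realType}.
Local Notation mu := (@lebesgue_measure R).
Local Notation N01 := (normal_prob (0 : R) 1).
Implicit Types (phi : R -> R).

Lemma integrable_normal phi : measurable_fun setT phi ->
  N01.-integrable setT (EFin \o phi) ->
  mu.-integrable setT (EFin \o (fun t => phi t * normal_pdf 0 1 t)) /\
  (\int[N01]_t (phi t)%:E = \int[mu]_t (phi t * normal_pdf 0 1 t)%:E)%E.
Proof.
move=> mphi iphi.
have mp := @measurable_normal_pdf R 0 1.
have p0 t := @normal_pdf_ge0 R 0 1 t.
have mphip : measurable_fun setT (fun t => phi t * normal_pdf 0 1 t) by exact: measurable_funM.
split.
  apply/integrableP; split; first exact/measurable_EFinP.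
  have /integrableP[_] := iphi.
  rewrite ge0_integral_normal//; last by do 2 apply: measurableT_comp => //.
  apply: le_lt_trans; rewrite le_eqVlt; apply/orP; left; apply/eqP.
  by apply: eq_integral => t _; rewrite /= normrM (ger0_norm (p0 t)) EFinM.
rewrite integralE [RHS]integralE.
have mpe : measurable_fun setT (EFin \o phi) by exact/measurable_EFinP.
rewrite !ge0_integral_normal//; last 2 first.
- exact: measurable_funeneg.
- exact: measurable_funepos.
congr (_ - _)%E; apply: eq_integral => t _.
  rewrite !funeposE/= -!EFin_max -EFinM; congr EFin.
  by rewrite maxr_pMl// mul0r.
rewrite !funenegE/= -!EFin_max -EFinM; congr EFin.
by rewrite maxr_pMl// mul0r mulNr.
Qed.

Lemma is_derive_normal_pdf (t : R) :
  is_derive t 1 (normal_pdf 0 1) (- t * normal_pdf 0 1 t).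
Proof.
have E : normal_pdf 0 1 = (fun t : R => normal_peak 1 * expR (- (t * t / 2))).
  apply/funext => s; rewrite normal_pdfE ?oner_eq0// /normal_fun; congr (_ * expR _).
  by rewrite subr0 expr1n expr2 mulNr.
rewrite E.
have h1 : is_derive t 1 (fun s : R => - (s * s / 2)) (- t).
  have h0 := is_deriveM (is_derive_id t (1 : R)) (is_derive_id t (1 : R)).
  have := is_deriveN (is_deriveM h0 (is_derive_cst (2^-1 : R) t (1 : R))).
  move=> h; apply: is_derive_eq h _.
  by rewrite /GRing.scale/=; field.
have h2 := @is_derive1_comp R expR (fun s : R => - (s * s / 2)) t _ _ (is_derive_expR (- (t * t / 2))) h1.
have := is_deriveZ (normal_peak 1) h2.
move=> h; apply: is_derive_eq h _.
by rewrite /GRing.scale/=; ring.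
Qed.

(** The integrand is the derivative of [- phi * normal_pdf 0 1], which vanishes far out. *)
Let stein_compact phi phi' (M : R) : 0 < M -> (forall t : R, is_derive t 1 phi (phi' t)) ->
  continuous phi' -> (forall t, M <= `|t| -> phi t = 0 /\ phi' t = 0) ->
  (\int[mu]_t ((t * phi t - phi' t) * normal_pdf 0 1 t)%:E = 0)%E.
Proof.
move=> M0 dphi cphi' out.
have cp : continuous (normal_pdf (0 : R) 1) by apply: continuous_normal_pdf; rewrite oner_eq0.
have cphi := is_derive_continuous dphi.
pose F t := - (phi t * normal_pdf 0 1 t).
have dF (t : R) : is_derive t 1 F ((t * phi t - phi' t) * normal_pdf 0 1 t).
  have := is_deriveN (is_deriveM (dphi t) (is_derive_normal_pdf t)).
  move=> h; apply: is_derive_eq h _.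
  by rewrite /GRing.scale/=; ring.
have [||||_ ->] := @FTC2_line R (fun t => (t * phi t - phi' t) * normal_pdf 0 1 t) F (- M) M.
- by lra.
- move=> t; apply: cvgM; last exact: cp.
  apply: cvgB; last exact: cphi'.
  by apply: cvgM; [exact: cvg_id|exact: cphi].
- by move=> t Mt; have [|-> ->] := out t; rewrite ?(le_trans Mt) ?ler_norm// mulr0 subrr mul0r.
- move=> t Mt; have [|-> ->] := out t; rewrite ?mulr0 ?subrr ?mul0r//.
  by rewrite -normrN (le_trans _ (ler_norm _))// lerNr.
have [|e1 _] := out M; first by rewrite ger0_norm// ltW.
have [|e2 _] := out (- M); first by rewrite normrN ger0_norm// ltW.
by rewrite /F e1 e2 !mul0r subrr.
Qed.

(** Apply the compactly supported case to the product of [phi] and the cutoff of size [k]. The extra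
    term containing [dcut] is dominated, since [dcut] is bounded uniformly in [k], and at each point
    it is 0 for large [k]. *)
Lemma stein phi (phi' : R -> R) : (forall t : R, is_derive t 1 phi (phi' t)) -> continuous phi' ->
  N01.-integrable setT (EFin \o phi) -> N01.-integrable setT (EFin \o phi') ->
  N01.-integrable setT (EFin \o (fun t : R => t * phi t)) ->
  (\int[N01]_t (t * phi t))%R = (\int[N01]_t phi' t)%R.
Proof.
move=> dphi cphi' i1 i2 i3.
have cphi := is_derive_continuous dphi.
have mphi := continuous_measurable cphi; have mphi' := continuous_measurable cphi'.
have i4 : N01.-integrable setT (EFin \o (fun t : R => t * phi t - phi' t)).
  by have := integrableB measurableT i3 i2.
have mtphi : measurable_fun [set: R] (fun t : R => t * phi t) by exact: measurable_funM.
suff H : (\int[N01]_t (t * phi t - phi' t)%:E = 0)%E.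
  apply/eqP; rewrite -subr_eq0 -RintegralB//; apply/eqP.
  by rewrite /Rintegral H.
have [L L1 hL] := @dcut_bounded R.
have L0 : 0 <= L by lra.
have md M := @measurable_dcut R M; have mc M := @measurable_cutR R M.
pose u (k : nat) (t : R) := (t * phi t - phi' t) * cutR k%:R t - phi t * dcut k%:R t.
have mu_ k : measurable_fun [set: R] (u k).
  apply: measurable_funB; apply: measurable_funM => //.
  exact: measurable_funB.
have bu k t : `|u k t| <= `|t * phi t - phi' t| + L * `|phi t|.
  apply: (le_trans (ler_normB _ _)).
  rewrite (normrM (t * phi t - phi' t)) (normrM (phi t)); apply: lerD.
    by have /andP[c0 c1] := cut_itv k%:R t; rewrite ler_piMr// ger0_norm.
  by rewrite mulrC ler_wpM2r.
have ib : N01.-integrable setT (EFin \o (fun t : R => `|t * phi t - phi' t| + L * `|phi t|)).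
  have h1 : N01.-integrable setT (EFin \o (fun t : R => `|t * phi t - phi' t|)) by exact: integrable_norm.
  have h2 : N01.-integrable setT (EFin \o (fun t : R => `|phi t|)) by exact: integrable_norm.
  by have := integrableD measurableT h1 (integrableZl measurableT L h2).
have iu k : N01.-integrable setT (EFin \o u k).
  apply: (le_integrable measurableT _ _ ib); first by apply/measurable_EFinP; exact: mu_.
  by move=> t _ /=; rewrite lee_fin (le_trans (bu k t))// ler_norm.
have uk0 k : (\int[N01]_t (u k t)%:E = 0)%E.
  have [_ ->] := integrable_normal (mu_ k) (iu k).
  pose psi (t : R) := phi t * cutR k%:R t.
  pose psi' (t : R) := phi' t * cutR k%:R t + phi t * dcut k%:R t.
  have dpsi (t : R) : is_derive t 1 psi (psi' t).
    have h := is_deriveM (dphi t) (is_derive_cut k%:R t).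
    by apply: is_derive_eq h _; rewrite /psi' /GRing.scale/=; ring.
  have cpsi' : continuous psi'.
    have cc := smooth1_continuous (@smooth_cut R k%:R).
    have cdc : continuous (dcut (k%:R : R)).
      have -> : dcut (k%:R : R) = (cutR k%:R)^`()%classic.
        by apply/funext => t; rewrite derive1E; have [_ ->] := is_derive_cut k%:R t.
      have [sc _] := smooth1_derive (@smooth_cut R k%:R).
      exact: smooth1_continuous.
    by move=> t; apply: cvgD; apply: cvgM; [exact: cphi'|exact: cc|exact: cphi|exact: cdc].
  have k0 : 0 < k%:R + 2 :> R by rewrite ltr_wpDl.
  have out (t : R) : k%:R + 2 <= `|t| -> psi t = 0 /\ psi' t = 0.
    move=> kt; have kt' : k%:R + 1 < `|t| by lra.
    by rewrite /psi /psi' cut_out// dcut_out// !mulr0 addr0.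
  rewrite -[RHS](stein_compact k0 dpsi cpsi' out).
  by apply: eq_integral => t _; congr EFin; rewrite /u /psi /psi'; ring.
have [| | | |_ _ H] := @dominated_convergence _ _ _ N01 setT measurableT
    (fun k (t : R) => (u k t)%:E) (fun t => (t * phi t - phi' t)%:E)
    (EFin \o (fun t : R => `|t * phi t - phi' t| + L * `|phi t|)) _ _ _ ib _.
- by move=> k; apply/measurable_EFinP; exact: mu_.
- by apply/measurable_EFinP; exact: measurable_funB.
- apply: aeW => t _; apply: cvg_near_cst; near=> k.
  have kt : `|t| <= k%:R.
    near: k; exists (Num.truncn `|t|).+1 => // k /= kt.
    by apply: (le_trans (ltW (truncnS_gt _))); rewrite ler_nat.
  by rewrite /u cut1// dcut0// mulr1 mulr0 subr0.
- by apply: aeW => t k _ /=; rewrite lee_fin.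
have : (fun k => \int[N01]_t (u k t)%:E)%E @ \oo --> (\int[N01]_t (t * phi t - phi' t)%:E)%E by exact: H.
under eq_fun do rewrite uk0.
by move=> /cvg_lim <-//; rewrite lim_cst.
Unshelve. all: by end_near. Qed.

End stein1.

(** * Integrable and square-integrable functions *)

Section square_integrable.
Context d (T : measurableType d) (R : realType) (m : {measure set T -> \bar R}).
Implicit Types (u v : T -> R) (c : R).

Definition intg u := m.-integrable setT (EFin \o u).
Definition L2 u := measurable_fun setT u /\ (sqnorm m u < +oo)%E.

Lemma intgD u v : intg u -> intg v -> intg (fun x => u x + v x).
Proof. by move=> iu iv; have := integrableD measurableT iu iv. Qed.

Lemma intgZ c u : intg u -> intg (fun x => c * u x).
Proof. by move=> iu; have := integrableZl measurableT c iu. Qed.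

Lemma intgB u v : intg u -> intg v -> intg (fun x => u x - v x).
Proof. by move=> iu iv; have := integrableB measurableT iu iv. Qed.

Lemma intg_norm u : intg u -> intg (fun x => `|u x|).
Proof. exact: integrable_norm. Qed.

Lemma intg0 : intg (fun=> 0).
Proof.
by apply: ge0_integrable => //; rewrite integral0 ltry.
Qed.

Lemma intg_sum I (s : seq I) (F : I -> T -> R) : (forall i, intg (F i)) ->
  intg (fun x => \sum_(i <- s) F i x).
Proof.
move=> iF; elim: s => [|i s IH].
  by under eq_fun do rewrite big_nil; exact: intg0.
by under eq_fun do rewrite big_cons; exact: intgD.
Qed.

Lemma le_intg u v : measurable_fun setT u -> intg v -> (forall x, `|u x| <= v x) -> intg u.
Proof.
move=> mu iv uv; apply: (le_integrable measurableT _ _ iv); first by apply/measurable_EFinP.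
by move=> x _ /=; rewrite lee_fin (le_trans (uv x))// ler_norm.
Qed.

Lemma Rintegral_sum I (s : seq I) (F : I -> T -> R) : (forall i, intg (F i)) ->
  (\int[m]_x \sum_(i <- s) F i x = \sum_(i <- s) \int[m]_x F i x)%R.
Proof.
move=> iF; elim: s => [|i s IH].
  rewrite big_nil; under [X in Rintegral _ _ X]eq_fun do rewrite big_nil.
  by rewrite /Rintegral integral0.
under [X in Rintegral _ _ X]eq_fun do rewrite big_cons.
rewrite big_cons RintegralD ?IH//; [exact: iF|exact: intg_sum].
Qed.

Lemma intg_measurable u : intg u -> measurable_fun setT u.
Proof. by move=> /integrableP[/measurable_EFinP]. Qed.

Lemma L2_sqr u : L2 u -> intg (fun x => u x ^+ 2).
Proof.
move=> [mu uoo]; apply: ge0_integrable => //; first exact: measurable_funX.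
by move=> x; rewrite sqr_ge0.
Qed.

Lemma L2_sqnorm u : L2 u -> sqnorm m u = (\int[m]_x (u x ^+ 2))%R%:E.
Proof.
by move=> hu; rewrite /Rintegral fineK//; apply: integrable_fin_num => //; exact: L2_sqr.
Qed.

Lemma L2M u v : L2 u -> L2 v -> intg (fun x => u x * v x).
Proof.
move=> hu hv; have [mu _] := hu; have [mv _] := hv.
apply: (le_intg _ (intgD (L2_sqr hu) (L2_sqr hv))); first exact: measurable_funM.
move=> x; rewrite normrM -(real_normK (num_real (u x))) -(real_normK (num_real (v x))).
have := sqr_ge0 (`|u x| - `|v x|); have := sqr_ge0 (`|u x| + `|v x|).
set a := `|u x|; set b := `|v x|; nra.
Qed.

Lemma L2D u v : L2 u -> L2 v -> L2 (fun x => u x + v x).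
Proof.
move=> [mu hu] [mv hv]; split; first exact: measurable_funD.
apply: (le_lt_trans (sqnormD _ mu mv)); apply: lte_mul_pinfty => //.
by rewrite lte_add_pinfty.
Qed.

Lemma L2Z c u : L2 u -> L2 (fun x => c * u x).
Proof.
move=> [mu hu]; split; first exact: measurable_funM.
by rewrite sqnormZ//; apply: lte_mul_pinfty; rewrite ?lee_fin ?sqr_ge0.
Qed.

Lemma L2B u v : L2 u -> L2 v -> L2 (fun x => u x - v x).
Proof.
move=> hu hv; have := L2D hu (L2Z (-1) hv).
by under eq_fun do rewrite mulN1r.
Qed.

End square_integrable.

(** * Differentiation and its adjoint for the standard normal law *)

Section test1.
Context {R : realType}.
Local Notation N01 := (normal_prob (0 : R) 1).
Implicit Types (f g phi psi : R -> R).
Local Notation der f := (f^`()%classic).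

Lemma test1M f g : test1 f -> smooth1 g -> test1 (fun t => f t * g t).
Proof.
move=> [sf [M hM]] sg; split; first by move=> k; exact: diffnM.
by exists M => t /hM ->; rewrite mul0r.
Qed.

Lemma test1B f g : test1 f -> test1 g -> test1 (fun t => f t - g t).
Proof.
move=> [sf [M hM]] [sg [N hN]]; split.
  move=> k; apply: (@diffn_ext _ _ (fun t => f t + (-1) * g t)).
    by move=> t; rewrite mulN1r.
  by apply: diffnD => //; apply: diffnM => //; exact: diffn_cst.
by exists (Num.max M N) => t; rewrite gt_max => /andP[/hM -> /hN ->]; rewrite subrr.
Qed.

Lemma smooth_id : smooth1 (@idfun R).
Proof.
case=> // k; exists (fun=> 1); first by move=> x; exact: is_derive_id.
exact: diffn_cst.
Qed.

Lemma is_derive_test1 f : test1 f -> forall t : R, is_derive t 1 f ((der f) t).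
Proof. by move=> [/smooth1_derive[_ h] _]. Qed.

Lemma test1_derive f : test1 f -> test1 (der f).
Proof.
move=> nf; have [sf [M hM]] := nf; split; first by have [] := smooth1_derive sf.
exists M => t Mt; have hd := is_derive_test1 nf t.
have h0 : is_derive t 1 f 0.
  apply: (near_eq_is_derive _ (is_derive_cst 0 t 1)).
  have : \forall s \near t, M < `|s|.
    have ct : `|s| @[s --> t] --> `|t| by apply: cvg_norm; exact: cvg_id.
    by have /cvgr_gt := ct; apply.
  by apply: filterS => s /hM.
by have [_ <-] := hd; have [_ ->] := h0.
Qed.

Lemma test1_bounded f : test1 f -> exists B : R, forall t, `|f t| <= B.
Proof.
move=> [sf [M hM]]; have cf := smooth1_continuous sf.
have ck : compact (f @` `[- M, M]).
  apply: continuous_compact; last exact: segment_compact.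
  by apply: continuous_subspaceT.
have [B [Br hB]] := compact_bounded ck.
exists (Num.max 0 (B + 1)) => t; rewrite le_max; apply/orP.
case: (leP `|t| M) => tM; [right|left].
  by apply: hB; [rewrite ltrDl|exists t => //=; rewrite in_itv/= -ler_norml].
by rewrite hM// normr0.
Qed.

Lemma measurable_test1 f : test1 f -> measurable_fun [set: R] f.
Proof. by move=> [sf _]; apply: continuous_measurable; exact: smooth1_continuous. Qed.

Lemma intg_test1 f : test1 f -> intg N01 f.
Proof.
move=> nf; have [B hB] := test1_bounded nf.
apply: (@le_intg _ _ _ N01 f (fun=> B)) => //; first exact: measurable_test1.
exact: finite_measure_integrable_cst.
Qed.

(** The adjoint of differentiation in L2 of the standard normal law, the operator that raises
    Hermite polynomials by one degree. *)
Definition adj f (t : R) : R := t * f t - (der f) t.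

Lemma test1_adj f : test1 f -> test1 (adj f).
Proof.
move=> nf; apply: test1B; last exact: test1_derive.
have := test1M nf smooth_id; congr test1.
by apply/funext => t; rewrite /= mulrC.
Qed.

Lemma stein_test1 f : test1 f -> (\int[N01]_t (t * f t))%R = (\int[N01]_t (der f) t)%R.
Proof.
move=> nf; apply: stein.
- by move=> t; exact: is_derive_test1.
- by have [s _] := test1_derive nf; exact: smooth1_continuous.
- exact: intg_test1.
- exact/intg_test1/test1_derive.
- apply: intg_test1; have := test1M nf smooth_id; congr test1.
  by apply/funext => t; rewrite /= mulrC.
Qed.

Lemma test1_deriveM f g : test1 f -> test1 g ->
  der (fun t => f t * g t) = (fun t => (der f) t * g t + f t * (der g) t).
Proof.
move=> nf ng; apply/funext => t; rewrite derive1E.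
have [_ ->] := is_deriveM (is_derive_test1 nf t) (is_derive_test1 ng t).
by rewrite /GRing.scale/= addrC [g t * _]mulrC.
Qed.

(** Stein's identity for the product of [f] and [g]. *)
Lemma adj_duality f g : test1 f -> test1 g ->
  (\int[N01]_t (adj f t * g t) = \int[N01]_t (f t * (der g) t))%R.
Proof.
move=> nf ng; have [sg _] := ng; have ng' := test1_derive ng; have nf' := test1_derive nf.
have [sg' _] := ng'.
have nfg := test1M nf sg.
have nidf : test1 (fun t => t * (f t * g t)).
  by have := test1M nfg smooth_id; congr test1; apply/funext => t; rewrite /= mulrC.
have := stein_test1 nfg; rewrite test1_deriveM// => E.
transitivity ((\int[N01]_t (t * (f t * g t)))%R - (\int[N01]_t ((der f) t * g t)))%R.
  rewrite -RintegralB//; [|exact: intg_test1|exact/intg_test1/test1M].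
  by apply: eq_Rintegral => t _; rewrite /adj; ring.
rewrite E RintegralD//; [by ring|exact/intg_test1/test1M|exact/intg_test1/test1M].
Qed.

(** Move one adjoint across by duality, use the commutation relation that the derivative of [adj g]
    is [g] plus the adjoint of its derivative, and apply duality once more. *)
Lemma adj_adj f g : test1 f -> test1 g ->
  (\int[N01]_t (adj f t * adj g t) = \int[N01]_t (f t * g t) + \int[N01]_t ((der f) t * (der g) t))%R.
Proof.
move=> nf ng; have [sg _] := ng; have ng' := test1_derive ng; have nf' := test1_derive nf.
have [sg' _] := ng'.
rewrite adj_duality//; last exact: test1_adj.
have E : der (adj g) = (fun t => g t + adj (der g) t).
  apply/funext => t; rewrite derive1E.
  have [_ ->] := is_deriveB (is_deriveM (is_derive_id t (1 : R)) (is_derive_test1 ng t)) (is_derive_test1 ng' t).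
  by rewrite /adj /GRing.scale/=; ring.
rewrite E; transitivity (\int[N01]_t (f t * g t) + \int[N01]_t (adj (der g) t * f t))%R.
  rewrite -RintegralD//; [|exact/intg_test1/test1M|apply/intg_test1/test1M].
  - by apply: eq_Rintegral => t _; ring.
  - exact: test1_adj.
  - by have [] := nf.
congr (_ + _); apply: (etrans (adj_duality ng' nf)).
by apply: eq_Rintegral => t _; rewrite mulrC.
Qed.

End test1.

(** * The second-order identity for products *)

Section stein_row.
Context {R : realType} (n : nat).
Local Notation N01 := (normal_prob (0 : R) 1).
Local Notation gam := (gaussian n (1 : R)).
Local Notation der f := (f^`()%classic).
Implicit Types (i j k : 'I_n) (x : 'rV[R]_n) (phi psi : 'I_n -> R -> R).

Definition bounded_mfun (u : 'rV[R]_n -> R) :=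
  measurable_fun [set: 'rV[R]_n] u /\ exists B : R, forall x, `|u x| <= B.

Lemma bounded_mfunD (c : R) u v : bounded_mfun u -> bounded_mfun v ->
  bounded_mfun (fun x => c * u x + v x).
Proof.
move=> [mu [B hB]] [mv [C hC]]; split.
  by apply: measurable_funD => //; exact: measurable_funM.
exists (`|c| * B + C) => x; apply: (le_trans (ler_normD _ _)).
by apply: lerD => //; rewrite normrM ler_wpM2l.
Qed.

Lemma bounded_mfunM u v : bounded_mfun u -> bounded_mfun v ->
  bounded_mfun (fun x => u x * v x).
Proof.
move=> [mu [B hB]] [mv [C hC]]; split; first exact: measurable_funM.
by exists (B * C) => x; rewrite normrM ler_pM.
Qed.

Lemma bounded_mfun0 : bounded_mfun (fun=> 0).
Proof. by split => //; exists 0 => x; rewrite normr0. Qed.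

Lemma bounded_mfun_tensor phi : (forall i, test1 (phi i)) -> bounded_mfun (tensor phi).
Proof.
move=> nphi; split; first by apply: measurable_tensor => i; exact: measurable_test1.
have [B hB] := choice (fun i => test1_bounded (nphi i)).
exists (\prod_i B i) => x; rewrite /tensor normr_prod.
by apply: ler_prod => i _; rewrite normr_ge0/=.
Qed.

Lemma intg_bounded u : bounded_mfun u -> intg gam u.
Proof.
move=> [mu [B hB]]; apply: (@le_intg _ _ _ gam u (fun=> B)) => //.
apply/integrableP; split; first exact/measurable_EFinP.
rewrite (_ : (fun x => _) = cst `|B|%:E)//.
by rewrite integral_cst// [X in (_ * X)%E](_ : _ = 1%E) ?mule1 ?ltry//; exact: gaussian_setT.
Qed.

Definition adjt phi i k : R -> R := if k == i then adj (phi k) else phi k.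

(** The adjoint of the partial derivative acts on the factor [i] alone and yields a product again,
    unbounded coordinate included; this is what makes the integrals below factor. *)
Lemma adjtE phi i x : tensor (adjt phi i) x = x 0 i * tensor phi x - dtensor phi i x.
Proof.
rewrite /tensor /dtensor /tensor (bigD1 i)//= [in RHS](bigD1 i)//= [X in _ - X](bigD1 i)//=.
rewrite /adjt eqxx /adj.
rewrite [X in _ * X](eq_bigr (fun k => phi k (x 0 k))); last by move=> k /negbTE ->.
rewrite [X in _ - _ * X](eq_bigr (fun k => phi k (x 0 k))); last by move=> k /negbTE ->.
by ring.
Qed.

Lemma test1_adjt phi i k : (forall i, test1 (phi i)) -> test1 (adjt phi i k).
Proof. by move=> nphi; rewrite /adjt; case: ifP => _ //; exact: test1_adj. Qed.

Lemma tensorM phi psi x : tensor phi x * tensor psi x = tensor (fun k t => phi k t * psi k t) x.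
Proof. by rewrite /tensor -big_split. Qed.

(** The polarised second-order identity, entry by entry. Being bilinear in the two functions, it
    extends from products to their combinations; for components [i] and [j] of one field, summation
    over both indices gives E |f|^2 + E tr (Df)^2. *)
Definition stein2_identity F DF G DG := forall i j,
  (\int[gam]_x ((x 0 i * F x - DF i x) * (x 0 j * G x - DG j x)) =
   \int[gam]_x (DF j x * DG i x) + (i == j)%:R * \int[gam]_x (F x * G x))%R.

Lemma integral_tensorM phi psi : (forall i, test1 (phi i)) -> (forall i, test1 (psi i)) ->
  (\int[gam]_x (tensor phi x * tensor psi x) =
   \prod_k (\int[N01]_t (phi k t * psi k t)))%R.
Proof.
move=> nphi npsi.
have [_ <-] := @integrable_tensor R N01 n (fun k t => phi k t * psi k t)
  (fun k => intg_test1 (test1M (nphi k) (proj1 (npsi k)))).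
by apply: eq_Rintegral => x _; rewrite tensorM.
Qed.

(** Both sides factor over the coordinates. For [i = j] the factor [i] is given by [adj_adj], whose
    two terms are the two integrals on the right; for distinct indices, [adj_duality] in the factors
    [i] and [j] turns each adjoint into a derivative of the other function. *)
Lemma stein2_tensor phi psi : (forall i, test1 (phi i)) -> (forall i, test1 (psi i)) ->
  stein2_identity (tensor phi) (dtensor phi) (tensor psi) (dtensor psi).
Proof.
move=> nphi npsi i j.
under eq_Rintegral do rewrite -!adjtE.
have nd (f : 'I_n -> R -> R) l k : (forall i, test1 (f i)) ->
    test1 ((fun k => if k == l then der (f k) else f k) k).
  by move=> nf /=; case: ifP => _; [exact: test1_derive|].
rewrite /dtensor.
rewrite (integral_tensorM (fun k => test1_adjt i k nphi) (fun k => test1_adjt j k npsi)).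
rewrite (integral_tensorM (fun k => nd phi j k nphi) (fun k => nd psi i k npsi)).
rewrite (integral_tensorM nphi npsi) /adjt.
have [<-|ij] := eqVneq i j.
  rewrite mul1r (bigD1 i)//= [X in _ = X + _](bigD1 i)//= [X in _ = _ + X](bigD1 i)//=.
  rewrite eqxx (adj_adj (nphi i) (npsi i)) addrC mulrDl.
  by congr (_ * _ + _ * _); apply: eq_bigr => k /negbTE ->.
rewrite mul0r addr0; apply: eq_bigr => k _.
have [->|ki] := eqVneq k i.
  by rewrite (negbTE ij) adj_duality.
case: ifP => _ //.
rewrite [RHS](_ : _ = (\int[N01]_t (psi k t * der (phi k) t))%R); last first.
  by apply: eq_Rintegral => t _; rewrite mulrC.
rewrite -adj_duality//.
by apply: eq_Rintegral => t _; rewrite mulrC.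
Qed.

End stein_row.

Section stein_test_pair.
Context {R : realType} (n : nat).
Local Notation gam := (gaussian n (1 : R)).
Implicit Types (i j k : 'I_n) (x : 'rV[R]_n) (phi psi : 'I_n -> R -> R)
  (F G : 'rV[R]_n -> R) (DF DG : 'I_n -> 'rV[R]_n -> R).

Lemma test1_dtensor phi j k : (forall i, test1 (phi i)) ->
  test1 (if k == j then (phi k)^`()%classic else phi k).
Proof. by move=> nphi; case: ifP => _; [exact: test1_derive|]. Qed.

(** The third clause does not follow from the first two, the coordinate being unbounded; with it
    every integrand of the second-order identity is bounded. *)
Definition regular_pair F (DF : 'I_n -> 'rV[R]_n -> R) := [/\ bounded_mfun F,
  forall i, bounded_mfun (DF i) & forall i, bounded_mfun (fun x => x 0 i * F x - DF i x)].

Lemma regular_tensor phi : (forall i, test1 (phi i)) ->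
  regular_pair (tensor phi) (dtensor phi).
Proof.
move=> nphi; split; first exact: bounded_mfun_tensor.
  by move=> i; apply: bounded_mfun_tensor => k; exact: test1_dtensor.
move=> i; under eq_fun do rewrite -adjtE.
by apply: bounded_mfun_tensor => k; exact: test1_adjt.
Qed.

Lemma regular_pairD c F DF G DG : regular_pair F DF -> regular_pair G DG ->
  regular_pair (fun x => c * F x + G x) (fun j x => c * DF j x + DG j x).
Proof.
move=> [f1 f2 f3] [g1 g2 g3]; split; first exact: bounded_mfunD.
  by move=> i; exact: bounded_mfunD.
move=> i; have := bounded_mfunD c (f3 i) (g3 i); congr bounded_mfun.
by apply/funext => x; ring.
Qed.

Lemma regular_pair0 : regular_pair (fun=> 0) (fun _ _ => 0).
Proof.
split=> [|_|i]; try exact: bounded_mfun0.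
by under eq_fun do rewrite mulr0 subr0; exact: bounded_mfun0.
Qed.

Lemma regular_test_pair F DF : test_pair F DF -> regular_pair F DF.
Proof.
elim=> [|c phi G DG nphi _ IH]; first exact: regular_pair0.
by apply: regular_pairD => //; exact: regular_tensor.
Qed.

Lemma RintegralZD (c : R) u v : bounded_mfun u -> bounded_mfun v ->
  (\int[gam]_x (c * u x + v x) = c * \int[gam]_x u x + \int[gam]_x v x)%R.
Proof.
move=> bu bv; rewrite RintegralD//; last 2 first.
- by apply: intgZ; exact: intg_bounded.
- exact: intg_bounded.
by rewrite RintegralZl//; exact: intg_bounded.
Qed.

Lemma stein2_identityD c F DF F' DF' G DG :
  regular_pair F DF -> regular_pair F' DF' -> regular_pair G DG ->
  stein2_identity F DF G DG -> stein2_identity F' DF' G DG ->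
  stein2_identity (fun x => c * F x + F' x) (fun j x => c * DF j x + DF' j x) G DG.
Proof.
move=> [f1 f2 f3] [f1' f2' f3'] [g1 g2 g3] H H' i j.
transitivity (\int[gam]_x (c * ((x 0 i * F x - DF i x) * (x 0 j * G x - DG j x)) +
    (x 0 i * F' x - DF' i x) * (x 0 j * G x - DG j x)))%R.
  by apply: eq_Rintegral => x _; ring.
rewrite RintegralZD; [|exact: bounded_mfunM|exact: bounded_mfunM].
rewrite H H'.
have -> : (\int[gam]_x ((c * DF j x + DF' j x) * DG i x) =
    c * \int[gam]_x (DF j x * DG i x) + \int[gam]_x (DF' j x * DG i x))%R.
  rewrite -RintegralZD; [|exact: bounded_mfunM|exact: bounded_mfunM].
  by apply: eq_Rintegral => x _; ring.
have -> : (\int[gam]_x ((c * F x + F' x) * G x) =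
    c * \int[gam]_x (F x * G x) + \int[gam]_x (F' x * G x))%R.
  rewrite -RintegralZD; [|exact: bounded_mfunM|exact: bounded_mfunM].
  by apply: eq_Rintegral => x _; ring.
ring.
Qed.

Lemma stein2_identityC F DF G DG : stein2_identity F DF G DG -> stein2_identity G DG F DF.
Proof.
move=> H i j; have := H j i; rewrite eq_sym => E.
transitivity (\int[gam]_x ((x 0 j * F x - DF j x) * (x 0 i * G x - DG i x)))%R.
  by apply: eq_Rintegral => x _; rewrite mulrC.
rewrite E; congr (_ + _ * _); apply: eq_Rintegral => x _; rewrite mulrC//.
Qed.

Lemma stein2_identity0 G DG : stein2_identity (fun=> 0) (fun _ _ => 0) G DG.
Proof.
move=> i j.
have z (u : 'rV[R]_n -> R) : u =1 (fun=> 0) -> (\int[gam]_x u x = 0)%R.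
  by move=> u0; rewrite /Rintegral integral0_eq// => x _; rewrite u0.
rewrite !z ?mulr0 ?addr0// => x; rewrite ?mul0r//.
by rewrite mulr0 subr0 mul0r.
Qed.

(** Induction on each argument in turn, the symmetry of the identity reducing the second to the
    first. *)
Lemma stein2_test_pair F DF G DG : test_pair F DF -> test_pair G DG -> stein2_identity F DF G DG.
Proof.
move=> nF nG; have rG := regular_test_pair nG.
elim: nF => [|c phi F' DF' nphi nF' IH]; first exact: stein2_identity0.
apply: stein2_identityD => //; [exact: regular_tensor|exact: regular_test_pair|].
apply: stein2_identityC; elim: nG {rG} => [|c' psi G' DG' npsi nG' IHG]; first exact: stein2_identity0.
apply: stein2_identityD => //; [exact: regular_tensor|exact: regular_test_pair|exact: regular_tensor|].
exact: stein2_tensor.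
Qed.

Lemma L2_bounded u : bounded_mfun u -> L2 gam u.
Proof.
move=> [mu [B hB]]; split => //; apply: le_lt_trans (@sqnorm_cst R n B).
by apply: le_sqnorm => // x; apply: le_trans (hB x) (ler_norm _).
Qed.

End stein_test_pair.

(** * Moments of the standard normal law *)

Section normal_moments.
Context {R : realType}.
Local Notation mu := (@lebesgue_measure R).
Local Notation N01 := (normal_prob (0 : R) 1).

(** Domination by a wider normal density. Let a = 3/8 t^2 be the difference of the two exponents;
    then exp(a) >= a^2 / 2 = 9/128 t^4, and 15 is the least integer above 128/9. *)
Let pow4_pdf (t : R) : t ^+ 4 * normal_pdf 0 1 t <=
  15 * @normal_peak R 1 / normal_peak 2 * normal_pdf 0 2 t.
Proof.
have p1 := @normal_peak_ge0 R 1.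
have p2 : 0 < @normal_peak R 2 by rewrite normal_peak_gt0.
rewrite !normal_pdfE ?oner_eq0//.
have -> : 15 * @normal_peak R 1 / normal_peak 2 * (normal_peak 2 * normal_fun 0 2 t) =
  normal_peak 1 * (15 * normal_fun 0 2 t) by field; rewrite gt_eqF.
rewrite mulrCA ler_wpM2l//.
pose a := 3 / 8 * t ^+ 2.
have a0 : 0 <= a by rewrite mulr_ge0 ?sqr_ge0.
have -> : normal_fun 0 2 t = expR a * normal_fun 0 1 t.
  rewrite /normal_fun -expRD; congr expR; rewrite /a subr0 expr1n.
  by field.
rewrite mulrA ler_wpM2r ?normal_fun_ge0//.
have := @expR_ge1Dxn R a 1 a0.
have -> : a ^+ 2 / 2`!%:R = 9 / 128 * t ^+ 4 by rewrite /a (_ : 2`!%:R = 2 :> R)//; field.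
have : 0 <= t ^+ 4 by rewrite -[4%N]/(2 * 2)%N exprM sqr_ge0.
lra.
Qed.

Lemma intg_pow4 : intg N01 (fun t => t ^+ 4).
Proof.
apply: ge0_integrable; first exact: measurable_funX.
  by move=> t; rewrite -[4%N]/(2 * 2)%N exprM sqr_ge0.
rewrite ge0_integral_normal//; last 2 first.
- by apply/measurable_EFinP; exact: measurable_funX.
- by move=> t; rewrite lee_fin -[4%N]/(2 * 2)%N exprM sqr_ge0.
pose K := 15 * @normal_peak R 1 / normal_peak 2.
have iK : mu.-integrable setT (fun t => (K%:E * (normal_pdf 0 2 t)%:E)%E).
  by apply: integrableZl => //; apply: integrable_normal_pdf.
apply: (@le_lt_trans _ _ (\int[mu]_t (K%:E * (normal_pdf 0 2 t)%:E))%E).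
  apply: ge0_le_integral => //.
  - by move=> t _; rewrite lee_fin mulr_ge0 ?normal_pdf_ge0// -[4%N]/(2 * 2)%N exprM sqr_ge0.
  - apply/measurable_EFinP; apply: measurable_funM; last exact: measurable_normal_pdf.
    exact: measurable_funX.
  - by have /integrableP[] := iK.
  - by move=> t _; rewrite -!EFinM lee_fin; exact: pow4_pdf.
by rewrite -ge0_fin_numE; [exact: integrable_fin_num iK|apply: integral_ge0 => t _; rewrite -EFinM lee_fin;
  rewrite mulr_ge0 ?normal_pdf_ge0// divr_ge0 ?mulr_ge0 ?normal_peak_ge0].
Qed.

Lemma intg_pow k : (k <= 4)%N -> intg N01 (fun t => t ^+ k).
Proof.
move=> k4.
have h : intg N01 (fun t : R => 1 + t ^+ 4).
  by apply: intgD; [exact: finite_measure_integrable_cst|exact: intg_pow4].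
apply: (le_intg _ h); first exact: measurable_funX.
move=> t; rewrite normrX -[t ^+ 4]ger0_norm; last by rewrite -[4%N]/(2 * 2)%N exprM sqr_ge0.
have a0 : 0 <= `|t : R| by exact: normr_ge0.
rewrite normrX; set a : R := `|t|; rewrite -/a in a0.
case: (lerP a 1) => a1.
  by rewrite -[leLHS]addr0 lerD ?exprn_ile1 ?exprn_ge0.
by rewrite -[leLHS]add0r lerD// ler_weXn2l// ltW.
Qed.

Lemma normal_pow2 : (\int[N01]_t (t ^+ 2))%R = 1.
Proof.
transitivity (\int[N01]_t (t * t))%R; first by apply: eq_Rintegral => t _; rewrite expr2.
rewrite (@stein R idfun (fun=> 1)).
- rewrite Rintegral_cst// mul1r.
  exact: (congr1 fine (@probability_setT _ _ _ N01)).
- by move=> t; exact: cvg_cst.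
- exact: (@intg_pow 1).
- exact: finite_measure_integrable_cst.
- exact: (@intg_pow 2).
Qed.

Lemma normal_pow4 : (\int[N01]_t (t ^+ 4))%R = 3.
Proof.
transitivity (\int[N01]_t (t * t ^+ 3))%R; first by apply: eq_Rintegral => t _; rewrite -exprS.
have d3 (t : R) : is_derive t 1 (fun t : R => t ^+ 3) (3 * t ^+ 2).
  have h : is_derive t 1 (fun t : R => t ^+ 3) _ := is_deriveX 3 (is_derive_id t (1 : R)).
  by apply: is_derive_eq h _; rewrite /GRing.scale/= mulr1.
transitivity (\int[N01]_t (3 * t ^+ 2))%R; last first.
  by rewrite RintegralZl ?normal_pow2 ?mulr1//; exact: intg_pow.
apply: (stein d3).
- by move=> t; apply: cvgM; [exact: cvg_cst|exact: exprn_continuous].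
- exact: intg_pow.
- by apply: intgZ; exact: intg_pow.
- by have := @intg_pow 4 isT; congr intg; apply/funext => t; rewrite exprS.
Qed.

End normal_moments.

Section gaussian_moments.
Context {R : realType} (n : nat).
Local Notation gam := (gaussian n (1 : R)).
Local Notation N01 := (normal_prob (0 : R) 1).
Implicit Types (i j k : 'I_n).

Lemma L2_coord i : L2 gam (fun x => x 0 i).
Proof.
split; first exact: measurable_coord.
pose phi k (t : R) := if k == i then t ^+ 2 else 1.
have iphi k : N01.-integrable setT (EFin \o phi k).
  by rewrite /phi; case: eqP => _; [exact: intg_pow|exact: finite_measure_integrable_cst].
have [it _] := integrable_tensor iphi.
rewrite /sqnorm.
have -> : (fun x : 'rV[R]_n => (x 0 i ^+ 2)%:E) = EFin \o tensor phi.
  apply/funext => x; rewrite /= /tensor (bigD1 i)//= /phi eqxx big1 ?mulr1//.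
  by move=> k /negbTE ->.
have : (\int[gam]_x (tensor phi x)%:E)%E \is a fin_num by apply: integrable_fin_num it.
by rewrite fin_numElt => /andP[].
Qed.

End gaussian_moments.

(** * Stability of product integrals under small L2 errors *)

Section perturbation.
Context d (T : measurableType d) (R : realType) (m : {measure set T -> \bar R}).
Implicit Types (u v g h : T -> R) (t : R).

Lemma measure_le_Rintegral (A : set T) u : measurable A -> intg m u ->
  (forall x, \1_A x <= u x) -> (m A <= (\int[m]_x u x)%R%:E)%E.
Proof.
move=> mA iu Au.
rewrite /Rintegral fineK; last exact: integrable_fin_num.
rewrite -(setIT A) -integral_indic//; apply: ge0_le_integral => //.
- by apply/measurable_EFinP; exact: measurable_indic.
- by have /integrableP[] := iu.
- by move=> x _; rewrite lee_fin.
Qed.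

Lemma sqnorm_Rintegral_le u t : L2 m u -> (sqnorm m u <= t%:E)%E -> (\int[m]_x (u x ^+ 2) <= t)%R.
Proof. by move=> hu; rewrite L2_sqnorm// lee_fin. Qed.

(** Young's inequality with weights t and 1/t on the cross terms, in place of Cauchy-Schwarz. One
    direction is enough, since the energy of the approximants has to be bounded from above only. *)
Lemma Rintegral_product_le g h u v t : 0 < t <= 1 ->
  L2 m g -> L2 m h -> L2 m u -> L2 m v ->
  (sqnorm m (fun x => g x - u x)%R <= (t ^+ 2)%:E)%E ->
  (sqnorm m (fun x => h x - v x)%R <= (t ^+ 2)%:E)%E ->
  (\int[m]_x (u x * v x) <= \int[m]_x (g x * h x) +
    t * ((\int[m]_x (g x ^+ 2) + \int[m]_x (h x ^+ 2)) / 2 + 2))%R.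
Proof.
move=> /andP[t0 t1] Lg Lh Lu Lv gu hv.
have Lgu := L2B Lg Lu; have Lhv := L2B Lh Lv.
have Egu := sqnorm_Rintegral_le Lgu gu; have Ehv := sqnorm_Rintegral_le Lhv hv.
(* The first summand serves the two cross terms, the second the product of the two errors; against
   squared errors of size t^2 the total is t + t^2, at most 2 t. *)
pose c := t^-1 / 2 + 2^-1.
have ti : 0 < t^-1 by rewrite invr_gt0.
have i1 := L2M Lg Lh; have i2 := intgD (L2_sqr Lg) (L2_sqr Lh).
have i3 := intgD (L2_sqr Lgu) (L2_sqr Lhv).
have i4 := intgD (intgD i1 (intgZ (t / 2) i2)) (intgZ c i3).
apply: (@le_trans _ _ (\int[m]_x (g x * h x + t / 2 * (g x ^+ 2 + h x ^+ 2) +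
   c * ((g x - u x) ^+ 2 + (h x - v x) ^+ 2)))%R).
  apply: le_Rintegral => //; first exact: L2M.
  move=> x _; set G := g x; set H := h x; set a := G - u x; set b := H - v x.
  have -> : u x = G - a by rewrite /a; ring.
  have -> : v x = H - b by rewrite /b; ring.
  have key (X Y : R) : - (X * Y) <= t / 2 * X ^+ 2 + t^-1 / 2 * Y ^+ 2.
    rewrite -subr_ge0.
    have -> : t / 2 * X ^+ 2 + t^-1 / 2 * Y ^+ 2 - - (X * Y) = t^-1 / 2 * (t * X + Y) ^+ 2.
      by field; rewrite gt_eqF.
    by rewrite mulr_ge0 ?sqr_ge0// divr_ge0 ?ltW.
  have := key G b; have := key H a; rewrite /c.
  have : a * b <= 2^-1 * (a ^+ 2 + b ^+ 2) by have := sqr_ge0 (a - b); lra.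
  lra.
rewrite RintegralD//; last 2 first.
- exact: (intgD i1 (intgZ (t / 2) i2)).
- exact: (intgZ c i3).
rewrite RintegralD//; last exact: (intgZ (t / 2) i2).
rewrite RintegralZl// RintegralZl//.
rewrite RintegralD//; [|exact: L2_sqr|exact: L2_sqr].
rewrite RintegralD//; [|exact: L2_sqr|exact: L2_sqr].
have c0 : 0 <= c by rewrite /c; lra.
have h1 : c * (\int[m]_x ((g x - u x) ^+ 2) + \int[m]_x ((h x - v x) ^+ 2))%R <= c * (t ^+ 2 + t ^+ 2).
  by apply: ler_wpM2l => //; apply: lerD.
have h2 : c * (t ^+ 2 + t ^+ 2) = t + t ^+ 2 by rewrite /c; field; rewrite gt_eqF.
have h3 : t ^+ 2 <= t by rewrite expr2 -[leRHS]mulr1 ler_wpM2l// ltW.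
lra.
Qed.

Lemma Rintegral_norm_product_le u v t : 0 < t -> L2 m u -> L2 m v ->
  (sqnorm m v <= (t ^+ 2)%:E)%E ->
  (\int[m]_x `|u x * v x| <= t * ((\int[m]_x (u x ^+ 2) + 1) / 2))%R.
Proof.
move=> t0 Lu Lv vt; have Ev := sqnorm_Rintegral_le Lv vt.
have ti : 0 < t^-1 by rewrite invr_gt0.
have i1 := L2_sqr Lu; have i2 := L2_sqr Lv.
apply: (@le_trans _ _ (\int[m]_x (t / 2 * u x ^+ 2 + t^-1 / 2 * v x ^+ 2))%R).
  apply: le_Rintegral => //.
  - by apply: intg_norm; exact: L2M.
  - exact: (intgD (intgZ _ i1) (intgZ _ i2)).
  move=> x _; rewrite normrM -(real_normK (num_real (u x))) -(real_normK (num_real (v x))).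
  rewrite -subr_ge0; set X := `|u x|; set Y := `|v x|.
  have -> : t / 2 * X ^+ 2 + t^-1 / 2 * Y ^+ 2 - X * Y = t^-1 / 2 * (t * X - Y) ^+ 2.
    by field; rewrite gt_eqF.
  by rewrite mulr_ge0 ?sqr_ge0// divr_ge0 ?ltW.
rewrite RintegralD//; [|exact: (intgZ (t / 2) i1)|exact: (intgZ (t^-1 / 2) i2)].
rewrite RintegralZl// RintegralZl//.
have h1 : t^-1 / 2 * \int[m]_x (v x ^+ 2) <= t^-1 / 2 * t ^+ 2.
  by rewrite ler_wpM2l// divr_ge0 ?ltW.
have h2 : t^-1 / 2 * t ^+ 2 = t / 2 by field; rewrite gt_eqF.
lra.
Qed.

End perturbation.

Section measurable_level.
Context d (T : measurableType d) (R : realType).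
Implicit Types (g : T -> R) (c : R).

Lemma measurable_gt_set g c : measurable_fun setT g -> measurable [set x | c < g x].
Proof.
move=> mg; have := mg measurableT _ (measurable_itv `]c, +oo[).
by rewrite setTI; congr measurable; apply/seteqP; split => x /=; rewrite in_itv/= andbT.
Qed.

Lemma measurable_le_set g c : measurable_fun setT g -> measurable [set x | g x <= c].
Proof.
move=> mg; have := mg measurableT _ (measurable_itv `]-oo, c]).
by rewrite setTI; congr measurable; apply/seteqP; split => x /=; rewrite in_itv/=.
Qed.

End measurable_level.

(** * Tail bound for the Gaussian divergence *)

Section second_order_stein.
Context {R : realType} (n : nat).
Local Notation gam := (gaussian n (1 : R)).
Implicit Types (i j k : 'I_n) (x : 'rV[R]_n) (t eta : R).

(* SURE minus the loss is sigma^2 (ssq x - n - 2 divg x) *)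
Definition divg (f : 'I_n -> 'rV[R]_n -> R) (h : 'I_n -> 'I_n -> 'rV[R]_n -> R) x : R :=
  \sum_i (x 0 i * f i x - h i i x).

(** E |f|^2 + E tr (Df)^2, where [h i j] stands for the derivative of component [i] in direction
    [j]. The trace has no sign, so its terms stay products and are not replaced by squares. *)
Definition energy (f : 'I_n -> 'rV[R]_n -> R) (h : 'I_n -> 'I_n -> 'rV[R]_n -> R) : R :=
  \sum_i (\int[gam]_x (f i x * f i x))%R +
  \sum_i \sum_j (\int[gam]_x (h i j x * h j i x))%R.

Variables (f : 'I_n -> 'rV[R]_n -> R) (h : 'I_n -> 'I_n -> 'rV[R]_n -> R).
Hypothesis lf : forall i, box_integrable (f i).
Hypothesis wf : forall i j, tensor_weak_partial j (f i) (h i j).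
Hypothesis Lf : forall i, L2 gam (f i).
Hypothesis Lh : forall i j, L2 gam (h i j).

Let L2_cst (c : R) : L2 gam (fun=> c).
Proof. by split => //; exact: sqnorm_cst. Qed.

(* for a test_pair the second moment of divg is exactly the energy *)
Lemma divg_approx : exists2 C : R, 0 <= C & forall t, 0 < t <= 1 ->
  exists u, [/\ L2 gam u, intg gam (fun x => divg f h x - u x),
    (\int[gam]_x (u x * u x) <= energy f h + C * t)%R &
    (\int[gam]_x `|divg f h x - u x| <= C * t)%R].
Proof.
(* [c] and [b] are the factors of [t] in [Rintegral_product_le] and [Rintegral_norm_product_le];
   they will be evaluated at [f], [h], the coordinates and constants, never at the approximants. *)
pose c (u v : 'rV[R]_n -> R) := (\int[gam]_x (u x ^+ 2) + \int[gam]_x (v x ^+ 2))%R / 2 + 2.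
pose b (u : 'rV[R]_n -> R) := (\int[gam]_x (u x ^+ 2) + 1)%R / 2.
have I0 (u : 'rV[R]_n -> R) : 0 <= (\int[gam]_x (u x ^+ 2))%R.
  by apply: Rintegral_ge0 => x _; exact: sqr_ge0.
have c0 u v : 0 <= c u v by rewrite /c; have := I0 u; have := I0 v; lra.
have b0 u : 0 <= b u by rewrite /b; have := I0 u; lra.
pose C1 := \sum_i c (f i) (f i) + \sum_i \sum_j c (h i j) (h j i).
pose C2 := \sum_i (b (fun x => x 0 i) + b (fun=> 1)).
have C10 : 0 <= C1.
  apply: addr_ge0; apply: sumr_ge0 => i _; first exact: c0.
  by apply: sumr_ge0 => j _; exact: c0.
have C20 : 0 <= C2 by apply: sumr_ge0 => i _; rewrite addr_ge0.
exists (C1 + C2); first by rewrite addr_ge0.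
move=> t /andP[t0 t1].
have t20 : 0 < t ^+ 2 by rewrite exprn_gt0.
have hF i : exists p : ('rV[R]_n -> R) * ('I_n -> 'rV[R]_n -> R), [/\ test_pair p.1 p.2,
    (sqnorm gam (fun x => f i x - p.1 x)%R <= (t ^+ 2)%:E)%E &
    forall j, (sqnorm gam (fun x => h i j x - p.2 j x)%R <= (t ^+ 2)%:E)%E].
  have [F [DF [nF _ a1 a2]]] := W12_approx (lf i) (wf i) (proj2 (Lf i)) (fun j => proj2 (Lh i j)) t20.
  by exists (F, DF).
have [p hp] := choice hF.
pose F i := (p i).1; pose DF i j := (p i).2 j.
have nF i : test_pair (F i) (DF i) by have [] := hp i.
have aF i : (sqnorm gam (fun x => f i x - F i x)%R <= (t ^+ 2)%:E)%E by have [] := hp i.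
have aDF i j : (sqnorm gam (fun x => h i j x - DF i j x)%R <= (t ^+ 2)%:E)%E by have [] := hp i.
have bF i : bounded_mfun (F i) by have [] := regular_test_pair (nF i).
have bDF i j : bounded_mfun (DF i j) by have [] := regular_test_pair (nF i).
pose T i x := x 0 i * F i x - DF i i x.
have bT i : bounded_mfun (T i) by have [_ _ bT] := regular_test_pair (nF i); exact: bT.
pose u x := \sum_i T i x.
have bu : bounded_mfun u.
  rewrite /u; elim: (index_enum _) => [|i s IH].
    by under eq_fun do rewrite big_nil; exact: bounded_mfun0.
  have := bounded_mfunD 1 (bT i) IH; congr bounded_mfun.
  by apply/funext => x; rewrite big_cons mul1r.
have E x : divg f h x - u x =
    \sum_i (x 0 i * (f i x - F i x) + - 1 * (h i i x - DF i i x)).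
  by rewrite /divg /u -sumrB; apply: eq_bigr => i _; rewrite /T; ring.
have LfF i : L2 gam (fun x => f i x - F i x) by apply: L2B => //; exact: L2_bounded.
have LhD i j : L2 gam (fun x => h i j x - DF i j x) by apply: L2B => //; exact: L2_bounded.
have ih i : intg gam (fun x => h i i x - DF i i x).
  have := L2M (L2_cst 1) (LhD i i); congr intg.
  by apply/funext => x; rewrite mul1r.
have ie i : intg gam (fun x => x 0 i * (f i x - F i x) + - 1 * (h i i x - DF i i x)).
  by apply: intgD; [exact: L2M (L2_coord i) (LfF i)|exact: intgZ].
exists u; split.
- exact: L2_bounded.
- by under eq_fun do rewrite E; exact: intg_sum.
- have -> : (\int[gam]_x (u x * u x))%R =
      \sum_i (\int[gam]_x (F i x * F i x))%R + \sum_i \sum_j (\int[gam]_x (DF i j x * DF j i x))%R.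
    transitivity (\int[gam]_x (\sum_i \sum_j (T i x * T j x)))%R.
      apply: eq_Rintegral => x _; rewrite /u big_distrl/=.
      by apply: eq_bigr => i _; rewrite big_distrr.
    have iT i j : intg gam (fun x => T i x * T j x).
      by apply: intg_bounded; exact: bounded_mfunM.
    rewrite Rintegral_sum; last by move=> i; exact: intg_sum.
    rewrite -big_split; apply: eq_bigr => i _ /=.
    rewrite Rintegral_sum//.
    (* Every [j] contributes to the trace; only [j = i] contributes the square of [F i]. *)
    rewrite (eq_bigr _ (fun j _ => stein2_test_pair (nF i) (nF j) i j)).
    rewrite big_split/= addrC; congr (_ + _).
    rewrite (bigD1 i)//= eqxx mul1r big1 ?addr0// => j /negbTE.
    by rewrite eq_sym => ->; rewrite mul0r.
  apply: (@le_trans _ _ (energy f h + t * C1)); last first.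
    by rewrite lerD2l mulrC ler_wpM2r ?lerDl// ltW.
  rewrite /energy /C1 mulrDr addrACA !mulr_sumr -!big_split/=.
  have t01 : 0 < t <= 1 by rewrite t0.
  apply: ler_sum => i _; apply: lerD.
    by apply: Rintegral_product_le => //; exact: L2_bounded.
  rewrite mulr_sumr -big_split/=; apply: ler_sum => j _.
  by apply: Rintegral_product_le => //; exact: L2_bounded.
- apply: (@le_trans _ _ (t * C2)); last by rewrite mulrC ler_wpM2r ?lerDr// ltW.
  apply: (@le_trans _ _ (\int[gam]_x (\sum_i (`|x 0 i * (f i x - F i x)| + `|1 * (h i i x - DF i i x)|)))%R).
    have ie' i : intg gam (fun x => `|x 0 i * (f i x - F i x)| + `|1 * (h i i x - DF i i x)|).
      apply: intgD; apply: intg_norm; first exact: L2M (L2_coord i) (LfF i).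
      exact: L2M (L2_cst 1) (LhD i i).
    apply: le_Rintegral => //.
    - by apply: intg_norm; under eq_fun do rewrite E; exact: intg_sum.
    - exact: intg_sum.
    move=> x _; rewrite E; apply: (le_trans (ler_norm_sum _ _ _)).
    apply: ler_sum => i _; apply: (le_trans (ler_normD _ _)).
    by rewrite mulN1r normrN mul1r.
  rewrite Rintegral_sum; last first.
    move=> i; apply: intgD; apply: intg_norm; first exact: L2M (L2_coord i) (LfF i).
    exact: L2M (L2_cst 1) (LhD i i).
  rewrite /C2 mulr_sumr; apply: ler_sum => i _.
  have i1 : intg gam (fun x => `|x 0 i * (f i x - F i x)|).
    by apply: intg_norm; exact: L2M (L2_coord i) (LfF i).
  have i2 : intg gam (fun x => `|1 * (h i i x - DF i i x)|).
    by apply: intg_norm; exact: L2M (L2_cst 1) (LhD i i).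
  rewrite RintegralD// mulrDr; apply: lerD.
    exact: (Rintegral_norm_product_le t0 (L2_coord i) (LfF i)).
  have := Rintegral_norm_product_le t0 (L2_cst 1) (LhD i i) (aDF i i).
  by rewrite /b.
Qed.

Lemma measurable_divg : measurable_fun [set: 'rV[R]_n] (divg f h).
Proof.
apply: measurable_sum => i; apply: measurable_funB; last by have [] := Lh i i.
by apply: measurable_funM; [exact: measurable_coord|have [] := Lf i].
Qed.

(** On the event, either [u] or the error [divg f h - u] is at least eta / 2 in absolute value.
    Chebyshev's inequality for [u] produces the factor 4, and the contribution of the error, by
    Markov's inequality, tends to 0 with [t]. *)
Theorem divg_tail eta : 0 < eta ->
  (gam [set x | (eta < `|divg f h x|)%R] <= (4 * energy f h / eta ^+ 2)%:E)%E.
Proof.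
move=> eta0; have [C C0 hC] := divg_approx.
have mA : measurable [set x | eta < `|divg f h x|].
  by apply: measurable_gt_set; apply: measurableT_comp => //; exact: measurable_divg.
apply/lee_addgt0Pr => e e0.
(* The total coefficient of [t] in the two bounds, plus 1 for positivity. *)
pose K := 4 * C / eta ^+ 2 + 2 * C / eta + 1.
have K0 : 0 < K by rewrite ltr_wpDl// addr_ge0// divr_ge0 ?mulr_ge0 ?sqr_ge0// ltW.
pose t := Num.min 1 (e / K).
have t0 : 0 < t by rewrite lt_min ltr01 divr_gt0.
have t01 : 0 < t <= 1 by rewrite t0 ge_min lexx.
have tK : t * K <= e by rewrite -ler_pdivlMr// ge_min lexx orbT.
have [u [Lu iu h1 h2]] := hC t t01.
have i1 := L2M Lu Lu.
have i2 := intg_norm iu.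
apply: le_trans (measure_le_Rintegral mA (intgD (intgZ (4 / eta ^+ 2) i1) (intgZ (2 / eta) i2)) _) _.
  move=> x; rewrite /indic; case: (boolP (x \in _)) => [|_]; last first.
    have c1 : 0 <= 4 / eta ^+ 2 by rewrite divr_ge0 ?sqr_ge0.
    have c2 : 0 <= 2 / eta by rewrite divr_ge0// ltW.
    by apply: addr_ge0; apply: mulr_ge0 => //; rewrite -expr2 sqr_ge0.
  rewrite inE/= => xA.
  have : eta <= `|u x| + `|divg f h x - u x|.
    by apply: (le_trans (ltW xA)); rewrite -{1}[divg f h x](subrK (u x)) addrC ler_normD.
  have e20 : 0 < eta ^+ 2 by rewrite exprn_gt0.
  rewrite -(ler_pM2l e20) mulr1 mulrDr.
  have -> : eta ^+ 2 * (4 / eta ^+ 2 * (u x * u x)) = 4 * `|u x| ^+ 2.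
    by rewrite real_normK ?num_real//; field; rewrite gt_eqF.
  have -> : eta ^+ 2 * (2 / eta * `|divg f h x - u x|) = 2 * eta * `|divg f h x - u x|.
    by field; rewrite gt_eqF.
  have : 0 <= `|divg f h x - u x| by []; have : 0 <= `|u x| by [].
  move: `|u x| `|divg f h x - u x| => a b a0 b0 ab.
  case: (leP eta (2 * b)) => hb; first by nra.
  have : eta <= 2 * a by lra.
  nra.
rewrite lee_fin RintegralD//; [|exact: (intgZ _ i1)|exact: (intgZ _ i2)].
rewrite RintegralZl// RintegralZl//.
have ei : 0 < eta^-1 by rewrite invr_gt0.
have e2i : 0 < (eta ^+ 2)^-1 by rewrite invr_gt0 exprn_gt0.
have k1 : 4 / eta ^+ 2 * (\int[gam]_x (u x * u x))%R <= 4 / eta ^+ 2 * (energy f h + C * t).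
  by rewrite ler_wpM2l// mulr_ge0// ltW.
have k2 : 2 / eta * (\int[gam]_x `|divg f h x - u x|)%R <= 2 / eta * (C * t).
  by rewrite ler_wpM2l// mulr_ge0// ltW.
apply: (le_trans (lerD k1 k2)); apply: le_trans (_ : _ <= 4 * energy f h / eta ^+ 2 + t * K) _.
  by rewrite /K; lra.
by rewrite lerD2l.
Qed.

End second_order_stein.

(** * Anticoncentration of the chi-square distribution *)

Section fubini_row.
Context {R : realType}.

(** With the first coordinate integrated innermost, a one-dimensional identity can be applied while
    the remaining coordinates are frozen. *)
Lemma integral_rowS_swap (m : {sigma_finite_measure set (measurableTypeR R) -> \bar R})
    n (f : 'rV[R]_n.+1 -> \bar R) :
  (row_prod m n.+1).-integrable [set: 'rV[R]_n.+1] f ->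
  (\int[row_prod m n.+1]_x f x =
   \int[row_prod m n]_x \int[m]_a f (row_cons (a, x)))%E.
Proof.
move=> /integrable_rowS[mf foo].
have mfc : measurable_fun setT (f \o @row_cons R n).
  by apply: measurableT_comp => //; exact: measurable_row_cons.
have intf : (m \x row_prod m n)%E.-integrable setT (f \o @row_cons R n).
  exact/integrable12ltyP.
rewrite /= /row_prod_step.
rewrite (@integral_pushforward _ _ _ _ _ _ (@measurable_row_cons R n))//.
by rewrite preimage_setT -integral21_prod_meas1.
Qed.

End fubini_row.

Section chi_square_stein.
Context {R : realType}.
Local Notation N01 := (normal_prob (0 : R) 1).

Definition ssq n (x : 'rV[R]_n) : R := \sum_i x 0 i ^+ 2.

Lemma ssq_row_cons n a (x : 'rV[R]_n) : ssq (row_cons (a, x)) = a ^+ 2 + ssq x.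
Proof.
rewrite /ssq big_ord_recl row_cons0; congr (_ + _).
by apply: eq_bigr => i _; rewrite row_consS.
Qed.

Lemma ssq_ge0 n (x : 'rV[R]_n) : 0 <= ssq x.
Proof. by apply: sumr_ge0 => i _; exact: sqr_ge0. Qed.

Lemma measurable_ssq n : measurable_fun [set: 'rV[R]_n] (@ssq n).
Proof.
by apply: measurable_sum => i; apply: measurable_funX; exact: measurable_coord.
Qed.

Lemma intg_ssq n : intg (gaussian n (1 : R)) (@ssq n).
Proof. by apply: intg_sum => i; apply: L2_sqr; exact: L2_coord. Qed.

Lemma intg_sqr_coord n i : intg (gaussian n (1 : R)) (fun x => x 0 i ^+ 2).
Proof. exact/L2_sqr/L2_coord. Qed.

Variables (h h' : R -> R) (B : R).
Hypothesis dh : forall t : R, is_derive t 1 h (h' t).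
Hypothesis ch' : continuous h'.
Hypothesis bh : forall t, `|h t| <= B.
Hypothesis bh' : forall t, `|h' t| <= B.

Let mh : measurable_fun [set: R] h.
Proof. by apply: continuous_measurable; exact: is_derive_continuous dh. Qed.
Let mh' : measurable_fun [set: R] h'.
Proof. exact: continuous_measurable. Qed.

Let intg_bounded_mul d (T : measurableType d) (m : {measure set T -> \bar R}) (u : T -> R)
    (g : R -> R) (v : T -> R) : measurable_fun [set: R] g -> (forall t, `|g t| <= B) ->
  intg m u -> measurable_fun setT v -> intg m (fun x => u x * g (v x)).
Proof.
move=> mg bg iu mv; have mu := intg_measurable iu.
apply: (le_intg _ (intgZ B (intg_norm iu))).
  by apply: measurable_funM => //; exact: measurableT_comp.
by move=> x; rewrite normrM mulrC ler_wpM2r.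
Qed.

(** Stein's identity for [a * h (a ^+ 2 + s)]: its derivative consists of the right-hand integrand
    and of [h (a ^+ 2 + s)], and the latter is moved to the left. *)
Let stein1 (s : R) :
  (\int[N01]_a ((a ^+ 2 - 1) * h (a ^+ 2 + s))%:E =
   \int[N01]_a (2 * (a ^+ 2 * h' (a ^+ 2 + s)))%:E)%E.
Proof.
have mv : measurable_fun [set: R] (fun a : R => a ^+ 2 + s).
  by apply: measurable_funD => //; exact: measurable_funX.
have i1 : intg N01 (fun=> 1) by exact: finite_measure_integrable_cst.
have i2 : intg N01 (fun a : R => a ^+ 2) by exact: intg_pow.
have ih : intg N01 (fun a : R => h (a ^+ 2 + s)).
  by have := intg_bounded_mul mh bh i1 mv; under eq_fun do rewrite mul1r.
have ia2h : intg N01 (fun a : R => a ^+ 2 * h (a ^+ 2 + s)) by exact: intg_bounded_mul.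
have ia2h' : intg N01 (fun a : R => a ^+ 2 * h' (a ^+ 2 + s)) by exact: intg_bounded_mul.
have iah : intg N01 (fun a : R => a * h (a ^+ 2 + s)).
  by apply: intg_bounded_mul => //; exact: (@intg_pow R 1).
pose phi (a : R) := a * h (a ^+ 2 + s).
pose phi' (a : R) := h (a ^+ 2 + s) + 2 * (a ^+ 2 * h' (a ^+ 2 + s)).
have dphi (a : R) : is_derive a 1 phi (phi' a).
  have d0 : is_derive a 1 (fun a : R => a ^+ 2 + s) (2 * a).
    have hX : is_derive a 1 (fun t : R => t ^+ 2) _ := is_deriveX 2 (is_derive_id a (1 : R)).
    have := is_deriveD hX (is_derive_cst s a (1 : R)).
    by move=> hd; apply: is_derive_eq hd _; rewrite /GRing.scale/= mulr1 addr0 expr1.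
  have d1 := @is_derive1_comp _ h _ a _ _ (dh (a ^+ 2 + s)) d0.
  have := is_deriveM (is_derive_id a (1 : R)) d1.
  move=> hd; apply: is_derive_eq hd _.
  by rewrite /phi' /GRing.scale/= addrC; ring.
have cphi' : continuous phi'.
  have cv : continuous (fun a : R => a ^+ 2 + s).
    by move=> a; apply: cvgD; [exact: exprn_continuous|exact: cvg_cst].
  move=> a; apply: cvgD.
    apply: (@continuous_comp _ _ _ (fun a : R => a ^+ 2 + s) h); first exact: cv.
    exact: is_derive_continuous dh _.
  apply: cvgM; first exact: cvg_cst.
  apply: cvgM; first exact: exprn_continuous.
  by apply: (@continuous_comp _ _ _ (fun a : R => a ^+ 2 + s) h'); [exact: cv|exact: ch'].
have iphi' : intg N01 phi' by apply: intgD => //; exact: intgZ.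
have iaphi : intg N01 (fun a => a * phi a).
  by have := ia2h; congr intg; apply/funext => a; rewrite /phi; ring.
have := stein dphi cphi' iah iphi' iaphi => E.
have i3 : intg N01 (fun a : R => (a ^+ 2 - 1) * h (a ^+ 2 + s)).
  by apply: intg_bounded_mul => //; exact: intgB.
have i4 : intg N01 (fun a : R => 2 * (a ^+ 2 * h' (a ^+ 2 + s))) by exact: intgZ.
rewrite -[LHS]fineK; last exact: integrable_fin_num i3.
rewrite -[RHS]fineK; last exact: integrable_fin_num i4.
congr EFin; apply: (@addIr _ (\int[N01]_a h (a ^+ 2 + s))%R).
transitivity (\int[N01]_a (a * phi a))%R.
  rewrite -[fine _]/(Rintegral _ _ _) -RintegralD//.
  by apply: eq_Rintegral => a _; rewrite /phi; ring.
rewrite E -[fine _]/(Rintegral _ _ _) -RintegralD//.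
by apply: eq_Rintegral => a _; rewrite /phi' addrC.
Qed.

Let mssqD n r : measurable_fun [set: 'rV[R]_n] (fun x : 'rV[R]_n => ssq x + r).
Proof. by apply: measurable_funD => //; exact: measurable_ssq. Qed.

Let intg1 n : intg (gaussian n (1 : R)) (fun=> 1).
Proof. by apply: intg_bounded; split => //; exists 1 => x; rewrite normr1. Qed.

(* the shift r makes the induction on n go through *)
Lemma chi_square_stein n (r : R) :
  (\int[gaussian n 1]_x ((ssq x - n%:R) * h (ssq x + r))%:E =
   \int[gaussian n 1]_x (2 * (ssq x * h' (ssq x + r)))%:E)%E.
Proof.
elim: n r => [|n IH] r.
  have ssq0 (x : 'rV[R]_0) : ssq x = 0 by rewrite /ssq big_ord0.
  by apply: eq_integral => x _; rewrite ssq0 subrr !mul0r mulr0.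
pose gam := gaussian n.+1 (1 : R).
have mv := @mssqD n.+1 r.
have i2 := @intg_sqr_coord n.+1 ord0.
have iss := @intg_ssq n.+1.
have j1 : intg gam (fun x => (x 0 ord0 ^+ 2 - 1) * h (ssq x + r)).
  by apply: intg_bounded_mul => //; apply: intgB => //; exact: intg1.
have j2 : intg gam (fun x => ((ssq x - x 0 ord0 ^+ 2) - n%:R) * h (ssq x + r)).
  apply: intg_bounded_mul => //; apply: intgB; first exact: intgB.
  by have := intgZ n%:R (intg1 n.+1); under eq_fun do rewrite mulr1.
have j3 : intg gam (fun x => 2 * (x 0 ord0 ^+ 2 * h' (ssq x + r))).
  by apply: intgZ; exact: intg_bounded_mul.
have j4 : intg gam (fun x => 2 * ((ssq x - x 0 ord0 ^+ 2) * h' (ssq x + r))).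
  by apply: intgZ; apply: intg_bounded_mul => //; exact: intgB.
(* First coordinate: [stein1], with the other coordinates frozen in the shift. *)
have e1 : (\int[gam]_x ((x 0%R ord0 ^+ 2 - 1) * h (ssq x + r))%:E =
           \int[gam]_x (2 * (x 0%R ord0 ^+ 2 * h' (ssq x + r)))%:E)%E.
  rewrite (integral_rowS_swap j1) (integral_rowS_swap j3).
  apply: eq_integral => x _.
  have := stein1 (ssq x + r).
  under eq_integral do rewrite addrA -ssq_row_cons.
  under [in RHS]eq_integral do rewrite addrA -ssq_row_cons.
  move=> E; etransitivity; last (etransitivity; first exact: E).
    by apply: eq_integral => a _; rewrite /= row_cons0.
  by apply: eq_integral => a _; rewrite /= row_cons0.
(* Remaining coordinates: the induction hypothesis with the first one frozen, the shift becoming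
   [a ^+ 2 + r]. *)
have e2 : (\int[gam]_x (((ssq x - x 0%R ord0 ^+ 2) - n%:R) * h (ssq x + r))%:E =
           \int[gam]_x (2 * ((ssq x - x 0%R ord0 ^+ 2) * h' (ssq x + r)))%:E)%E.
  rewrite (integral_rowS j2) (integral_rowS j4).
  apply: eq_integral => a _.
  etransitivity; last (etransitivity; first exact: (IH (a ^+ 2 + r))).
    apply: eq_integral => x _; rewrite /= row_cons0 ssq_row_cons/=; congr (_ * h _)%:E; ring.
  apply: eq_integral => x _; rewrite /= row_cons0 ssq_row_cons/=; congr (2 * (_ * h' _))%:E; ring.
transitivity (\int[gam]_x (((x 0%R ord0 ^+ 2 - 1) * h (ssq x + r))%:E +
    (((ssq x - x 0%R ord0 ^+ 2) - n%:R) * h (ssq x + r))%:E))%E.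
  by apply: eq_integral => x _; rewrite -EFinD; congr EFin; rewrite -natr1; ring.
rewrite integralD_EFin// e1 e2 -integralD_EFin//.
by apply: eq_integral => x _; rewrite -EFinD; congr EFin; ring.
Qed.

End chi_square_stein.

(** * Variance and small-window probabilities of the chi-square law *)

Section chi_square_concentration.
Context {R : realType} (n : nat).
Local Notation gam := (gaussian n (1 : R)).
Local Notation N01 := (normal_prob (0 : R) 1).
Implicit Types (i j k : 'I_n) (x : 'rV[R]_n).

(** Distinct coordinates are independent and [g] is centred, so the off-diagonal terms vanish. *)
Let prodg (g : R -> R) : intg N01 g -> intg N01 (fun t => g t ^+ 2) ->
  (\int[N01]_t g t = 0)%R -> forall i j,
  intg gam (fun x => g (x 0 i) * g (x 0 j)) /\
  (\int[gam]_x (g (x 0 i) * g (x 0 j)))%R = (i == j)%:R * (\int[N01]_t (g t ^+ 2))%R.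
Proof.
move=> ig ig2 g0 i j.
pose phi k (t : R) := (if k == i then g t else 1) * (if k == j then g t else 1).
have i1 : intg N01 (fun=> 1) by exact: finite_measure_integrable_cst.
have iphi k : intg N01 (phi k).
  rewrite /phi; case: eqP => _; case: eqP => _.
  - by under eq_fun do rewrite -expr2.
  - by under eq_fun do rewrite mulr1.
  - by under eq_fun do rewrite mul1r.
  - by under eq_fun do rewrite mulr1.
have [it Et] := integrable_tensor iphi.
have E : (fun x : 'rV[R]_n => g (x 0 i) * g (x 0 j)) = tensor phi.
  apply/funext => x; rewrite /tensor /phi big_split/=; congr (_ * _).
    by rewrite (bigD1 i)//= eqxx big1 ?mulr1// => k /negbTE ->.
  by rewrite (bigD1 j)//= eqxx big1 ?mulr1// => k /negbTE ->.
rewrite E; split=> //; rewrite Et /phi.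
have [->|ij] := eqVneq i j.
  rewrite (bigD1 j)//= eqxx mul1r big1 ?mulr1//= => k /negbTE ->.
  rewrite (_ : (fun=> 1 * 1) = cst 1); last by apply/funext => t; rewrite mulr1.
  rewrite Rintegral_cst// mul1r.
  exact: (congr1 fine (@probability_setT _ _ _ N01)).
rewrite mul0r (bigD1 i)//= eqxx (negbTE ij).
under eq_Rintegral do rewrite mulr1.
by rewrite g0 mul0r.
Qed.

Let g (t : R) := t ^+ 2 - 1.

Let ig : intg N01 g.
Proof. by apply: intgB; [exact: intg_pow|exact: finite_measure_integrable_cst]. Qed.

Let g2E t : g t ^+ 2 = t ^+ 4 + (- 2 * t ^+ 2 + 1).
Proof. by rewrite /g; ring. Qed.

Let ig2' : intg N01 (fun t : R => - 2 * t ^+ 2 + 1).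
Proof.
by apply: intgD; [apply: intgZ; exact: intg_pow|exact: finite_measure_integrable_cst].
Qed.

Let ig2 : intg N01 (fun t => g t ^+ 2).
Proof. by under eq_fun do rewrite g2E; apply: intgD => //; exact: intg_pow. Qed.

Let N1 : (\int[N01]_t 1)%R = 1 :> R.
Proof.
rewrite Rintegral_cst// mul1r.
exact: (congr1 fine (@probability_setT _ _ _ N01)).
Qed.

Let g0 : (\int[N01]_t g t)%R = 0.
Proof.
rewrite /g RintegralB//; [|exact: intg_pow|exact: finite_measure_integrable_cst].
by rewrite normal_pow2 N1 subrr.
Qed.

Let g22 : (\int[N01]_t (g t ^+ 2))%R = 2.
Proof.
under eq_Rintegral do rewrite g2E.
rewrite RintegralD//; last exact: intg_pow.
rewrite RintegralD//; [|by apply: intgZ; exact: intg_pow|exact: finite_measure_integrable_cst].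
rewrite RintegralZl//; last exact: intg_pow.
by rewrite normal_pow2 normal_pow4 N1; ring.
Qed.

Let ssqB x : (ssq x - n%:R) ^+ 2 = \sum_i \sum_j g (x 0 i) * g (x 0 j).
Proof.
have -> : ssq x - n%:R = \sum_i g (x 0 i).
  by rewrite sumrB sumr_const card_ord.
rewrite expr2 big_distrl/=; apply: eq_bigr => i _.
by rewrite big_distrr.
Qed.

Lemma intg_chi_square_dev2 : intg gam (fun x => (ssq x - n%:R) ^+ 2).
Proof.
under eq_fun do rewrite ssqB.
apply: intg_sum => i; apply: intg_sum => j.
by have [] := prodg ig ig2 g0 i j.
Qed.

Lemma chi_square_variance : (\int[gam]_x ((ssq x - n%:R) ^+ 2))%R = 2 * n%:R.
Proof.
under eq_Rintegral do rewrite ssqB.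
have ip i j := proj1 (prodg ig ig2 g0 i j).
rewrite Rintegral_sum; last by move=> i; exact: intg_sum.
rewrite (eq_bigr (fun=> 2)) ?sumr_const ?card_ord ?mulr_natr// => i _.
rewrite Rintegral_sum//.
rewrite (eq_bigr _ (fun j _ => proj2 (prodg ig ig2 g0 i j))).
rewrite (bigD1 i)//= eqxx mul1r big1 ?addr0// => j /negbTE.
by rewrite eq_sym => ->; rewrite mul0r.
Qed.

(* Stein's identity for h = atan ((. - m) / L), a bounded function whose
   derivative is at least 1 / (2 L) on the window [m - L, m + L] *)
Lemma chi_square_anticoncentration (m L : R) : (0 < n)%N -> 0 < L ->
  (gam [set x | (`|ssq x - m| <= L)%R] <=
    (4 * L * Num.sqrt (2 * n%:R) / n%:R + 8 / n%:R)%:E)%E.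
Proof.
move=> n0 L0; have nR0 : 0 < n%:R :> R by rewrite ltr0n.
set s := Num.sqrt _.
have s0 : 0 < s by rewrite sqrtr_gt0 mulr_gt0.
have s2 : s ^+ 2 = 2 * n%:R by rewrite sqr_sqrtr// mulr_ge0.
have Li : 0 < L^-1 by rewrite invr_gt0.
pose h (t : R) := atan (L^-1 * t + - (L^-1 * m)).
pose h' (t : R) := L^-1 * (1 + (L^-1 * t + - (L^-1 * m)) ^+ 2)^-1.
have q0 (y : R) : 0 < 1 + y ^+ 2 by rewrite ltr_pwDl ?sqr_ge0.
have dh (t : R) : is_derive t 1 h (h' t).
  have hd : is_derive (L^-1 * t + - (L^-1 * m)) 1 (@atan R) (1 + (L^-1 * t + - (L^-1 * m)) ^+ 2)^-1.
    by apply: DeriveDef; [exact: derivable_atan|rewrite -derive1E derive1_atan].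
  exact: is_derive_comp_affine hd.
have ch' : continuous h'.
  move=> t; apply: cvgM; first exact: cvg_cst.
  apply: cvgV; first by rewrite gt_eqF.
  apply: cvgD; first exact: cvg_cst.
  apply: (@continuous_comp _ _ _ (fun t => L^-1 * t + - (L^-1 * m)) (fun y => y ^+ 2)).
    apply: cvgD; last exact: cvg_cst.
    by apply: cvgM; [exact: cvg_cst|exact: cvg_id].
  exact: exprn_continuous.
have h'0 t : 0 <= h' t by rewrite mulr_ge0 ?invr_ge0 ?(ltW (q0 _)) ?(ltW L0).
(* A common bound for both functions, as [chi_square_stein] requires: |h| < pi / 2 < 2 and |h'| <= 1
   / L. *)
pose B := 2 + L^-1.
have bh2 t : `|h t| <= 2.
  have := @atan_gtNpi2 R (L^-1 * t + - (L^-1 * m)); have := @atan_ltpi2 R (L^-1 * t + - (L^-1 * m)).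
  have := @pihalf_lt2 R; rewrite ler_norml /h => *; apply/andP; split; lra.
have bh t : `|h t| <= B by apply: (le_trans (bh2 t)); rewrite lerDl ltW.
have bh' t : `|h' t| <= B.
  rewrite ger0_norm//; apply: (@le_trans _ _ L^-1); last by rewrite lerDr.
  by rewrite /h' ler_piMr ?(ltW Li)// invf_le1// lerDl sqr_ge0.
have i2 := intg_chi_square_dev2.
have mdev : measurable_fun [set: 'rV[R]_n] (fun x => ssq x - n%:R).
  by apply: measurable_funB => //; exact: measurable_ssq.
have i1 : intg gam (fun x => ssq x - n%:R).
  apply: intgB; first exact: intg_ssq.
  by apply: intg_bounded; split => //; exists n%:R => x; rewrite ger0_norm.
have mh : measurable_fun [set: R] h by apply: continuous_measurable; exact: is_derive_continuous dh.
have mh' : measurable_fun [set: R] h' by exact: continuous_measurable.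
have mr : measurable_fun [set: 'rV[R]_n] (fun x => ssq x + 0).
  by apply: measurable_funD => //; exact: measurable_ssq.
have j1 : intg gam (fun x => (ssq x - n%:R) * h (ssq x + 0)).
  apply: (le_intg _ (intgZ 2 (intg_norm i1))).
    by apply: measurable_funM => //; exact: measurableT_comp.
  by move=> x; rewrite normrM mulrC ler_wpM2r.
have j2 : intg gam (fun x => ssq x * h' (ssq x + 0)).
  apply: (le_intg _ (intgZ B (intg_norm (intg_ssq n)))).
    by apply: measurable_funM; [exact: measurable_ssq|exact: measurableT_comp].
  by move=> x; rewrite normrM mulrC ler_wpM2r.
have E : (\int[gam]_x ((ssq x - n%:R) * h (ssq x + 0)) = 2 * \int[gam]_x (ssq x * h' (ssq x + 0)))%R.
  by rewrite -RintegralZl// /Rintegral (chi_square_stein dh ch' bh bh').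
(* By Stein's identity this is half the mean of (X - n) h(X), where |h| <= 2. The inequality 2 |y|
   <= y^2 / s + s, with s^2 the variance of X, bounds that mean by 2 s. *)
have bE : (\int[gam]_x (ssq x * h' (ssq x + 0)))%R <= s.
  suff : (\int[gam]_x ((ssq x - n%:R) * h (ssq x + 0)))%R <= 2 * s by lra.
  have i3 : intg gam (fun=> s) by apply: intg_bounded; split => //; exists s => x; rewrite gtr0_norm.
  apply: (@le_trans _ _ (\int[gam]_x (s^-1 * (ssq x - n%:R) ^+ 2 + s))%R).
    apply: le_Rintegral => //; first exact: (intgD (intgZ s^-1 i2) i3).
    move=> x _; move: (ssq x - n%:R) (h (ssq x + 0)) (bh2 (ssq x + 0)) => y z bz.
    apply: (le_trans (ler_norm _)); rewrite normrM.
    apply: (@le_trans _ _ (`|y| * 2)); first by rewrite ler_wpM2l.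
    rewrite -(real_normK (num_real y)); move: `|y| => Y; rewrite -subr_ge0.
    have -> : s^-1 * Y ^+ 2 + s - Y * 2 = s^-1 * (Y - s) ^+ 2 by field; rewrite gt_eqF.
    by rewrite mulr_ge0 ?sqr_ge0 ?invr_ge0 ?ltW.
  rewrite RintegralD//; last exact: (intgZ s^-1 i2).
  rewrite RintegralZl// chi_square_variance -s2.
  rewrite (_ : (\int[gam]_x s)%R = s); first by rewrite expr2 mulKf ?gt_eqF//; lra.
  rewrite /Rintegral integral_cst// [X in (_ * X)%E](_ : _ = 1%E) ?mule1//.
  exact: gaussian_setT.
have mA : measurable [set x : 'rV[R]_n | `|ssq x - m| <= L].
  apply: measurable_le_set; apply: measurableT_comp => //.
  by apply: measurable_funB => //; exact: measurable_ssq.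
(* The two terms dominate the indicator of the window. If X >= n / 2, then X h'(X) >= n / (4 L)
   there; if X < n / 2, then (X - n)^2 >= n^2 / 4. The second term costs 4 / n^2 times the variance,
   that is 8 / n. *)
have ki := intgD (intgZ (4 * L / n%:R) j2) (intgZ (4 / n%:R ^+ 2) i2).
have c1 : 0 <= 4 * L / n%:R by rewrite divr_ge0 ?mulr_ge0 ?ltW.
have c2 : 0 <= 4 / n%:R ^+ 2 :> R by rewrite divr_ge0 ?sqr_ge0.
apply: (le_trans (measure_le_Rintegral mA ki _)).
  move=> x; have p1 : 0 <= 4 * L / n%:R * (ssq x * h' (ssq x + 0)).
    by rewrite mulr_ge0// mulr_ge0// ssq_ge0.
  have p2 : 0 <= 4 / n%:R ^+ 2 * (ssq x - n%:R) ^+ 2 by rewrite mulr_ge0// sqr_ge0.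
  rewrite /indic; case: (boolP (x \in _)) => [|_]; last by rewrite addr_ge0.
  rewrite inE/= => xA.
  case: (lerP (n%:R / 2) (ssq x)) => xn.
    rewrite -[leLHS]addr0 lerD// addr0.
    have h2 : (2 * L)^-1 <= h' (ssq x).
      rewrite /h' invfM mulrC; apply: ler_wpM2l; first exact: ltW.
      rewrite lef_pV2 ?posrE//.
      have -> : L^-1 * ssq x + - (L^-1 * m) = L^-1 * (ssq x - m) by ring.
      have : `|L^-1 * (ssq x - m)| <= 1 by rewrite normrM gtr0_norm// ler_pdivrMl// mulr1.
      rewrite -real_normK ?num_real//; move: `|_| (normr_ge0 (L^-1 * (ssq x - m))) => y; nra.
    have e1 : 4 * L / n%:R * (n%:R / 2 * (2 * L)^-1) = 1 :> R.
      by field; rewrite !gt_eqF.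
    rewrite -[leLHS]e1; apply: ler_wpM2l => //; apply: ler_pM => //.
    by rewrite invr_ge0 mulr_ge0// ltW.
  rewrite -[leLHS]add0r lerD//.
  have : (n%:R / 2) ^+ 2 <= (ssq x - n%:R) ^+ 2.
    rewrite -[leRHS]sqrrN ler_sqr ?nnegrE; lra.
  move=> hx; rewrite mulrAC ler_pdivlMr ?exprn_gt0//; move: hx.
  by rewrite mul1r expr_div_n; lra.
rewrite lee_fin RintegralD//; [|exact: (intgZ _ j2)|exact: (intgZ _ i2)].
rewrite RintegralZl// RintegralZl// chi_square_variance; apply: lerD.
  by rewrite [leRHS]mulrAC ler_wpM2l.
by rewrite le_eqVlt; apply/orP; left; apply/eqP; field; rewrite gt_eqF.
Qed.

End chi_square_concentration.

(** * Weak gradients: uniqueness and affine changes of variables *)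

Section weak_gradient_uniqueness.
Context {R : realType} (n : nat).
Local Notation leb := (row_prod (@lebesgue_measure R) n).
Local Notation gam := (gaussian n (1 : R)).
Implicit Types (u g h : 'rV[R]_n -> R) (x : 'rV[R]_n) (phi : 'I_n -> R -> R).

Lemma tensor_neq0 phi x : tensor phi x != 0 -> forall i, phi i (x 0 i) != 0.
Proof. by move=> p0 i; move: p0; apply: contra => /eqP p0; rewrite /tensor (bigD1 i)//= p0 mul0r. Qed.

Lemma intg_mul_tensor u phi : box_integrable u -> (forall i, test1 (phi i)) ->
  intg leb (fun x => u x * tensor phi x).
Proof.
move=> bu nphi; have [mt [B hB]] := bounded_mfun_tensor nphi.
have [M hM] := choice (fun i => proj2 (nphi i)).
apply: (@integrable_conv R n u (tensor phi) (\sum_i `|M i|) B) => // w /tensor_neq0 w0 i.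
rewrite leNgt; apply/negP => Mw; have := w0 i; rewrite hM ?eqxx//.
apply: le_lt_trans Mw; apply: (le_trans (ler_norm _)).
by rewrite (bigD1 i)//= lerDl sumr_ge0.
Qed.

(** A rise at [c] and, by reflection, a fall at [M]: a test function of one variable that tends to
    the indicator of [c, M] as the scale shrinks. *)
Let cut_upper (c M e t : R) := step1 e c t * step1 e (- M) (- t).

Let cut_upper_out c M e t : 0 < e <= 1 -> `|c| + `|M| + 1 < `|t| -> cut_upper c M e t = 0.
Proof.
move=> /andP[e0 e1]; rewrite lter_normr /cut_upper => /orP[] ht.
  have := ler_norm M; have := normr_ge0 c => c0 M1.
  rewrite (_ : step1 e (- M) (- t) = 0) ?mulr0//.
  by apply: step1_lt => //; lra.
have := ler_norm (- c); have := normr_ge0 M; rewrite normrN => M0 c1.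
rewrite (_ : step1 e c t = 0) ?mul0r//.
by apply: step1_lt => //; lra.
Qed.

Let test1_cut_upper c M e : 0 < e <= 1 -> test1 (cut_upper c M e).
Proof.
move=> e01.
have smooth_step a : smooth1 (step1 e a).
  case=> // m; exists (fun t => ker1 e t a); first by move=> t; exact: is_derive_step1.
  apply: (@diffn_ext _ _ (fun t => e^-1 * bumpR (- e^-1 * t + e^-1 * a))).
    by move=> t; rewrite /ker1; congr (_ * bumpR _); ring.
  by apply: diffnM; [exact: diffn_cst|apply: diffn_affine; exact: smooth_bump].
split; last by exists (`|c| + `|M| + 1) => t; exact: cut_upper_out.
move=> m; apply: diffnM; first exact: smooth_step.
apply: (@diffn_ext _ _ (fun t => step1 e (- M) (-1 * t + 0))).
  by move=> t; rewrite mulN1r addr0.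
by apply: diffn_affine; exact: smooth_step.
Qed.

Let cut_upper_itv c M e t : 0 <= cut_upper c M e t <= 1.
Proof.
have /andP[a0 a1] := step1_itv e c t.
have /andP[b0 b1] := step1_itv e (- M) (- t).
by rewrite /cut_upper mulr_ge0//= mulr_ile1.
Qed.

Let cut_upper_near c M t : \forall k \near \oo, cut_upper (Num.max c (- M)) M k.+1%:R^-1 t =
  \1_`[- M, M] t * \1_`[c, +oo[ t.
Proof.
near=> k; rewrite /cut_upper.
have -> : step1 k.+1%:R^-1 (Num.max c (- M)) t = \1_`[Num.max c (- M), +oo[ t.
  by near: k; exact: step1_near.
have -> : step1 k.+1%:R^-1 (- M) (- t) = \1_`[- M, +oo[ (- t).
  by near: k; exact: step1_near.
rewrite /indic !mem_setE !in_itv/= !andbT ge_max lerN2.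
by case: (c <= t); case: (- M <= t); case: (t <= M); rewrite /= ?mulr0 ?mulr1.
Unshelve. all: by end_near. Qed.

Variable u : 'rV[R]_n -> R.
Hypothesis bu : box_integrable u.
Hypothesis u0 : forall phi, (forall i, test1 (phi i)) ->
  (\int[leb]_x (u x * tensor phi x)%:E = 0)%E.

Let mu : measurable_fun [set: 'rV[R]_n] u.
Proof. by case: bu. Qed.

Let null M (v : 'rV[R]_n -> R) := (\int[leb]_x (box M x * u x * v x)%:E = 0)%E.

Let ibox M (v : 'rV[R]_n -> R) : measurable_fun [set: 'rV[R]_n] v -> (forall x, `|v x| <= 1) ->
  intg leb (fun x => box M x * u x * v x).
Proof.
move=> mv v1; have iu := proj2 bu M.
apply: (le_intg _ (intg_norm iu)).
  by apply: measurable_funM => //; apply: measurable_funM => //; exact: measurable_box.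
by move=> x; rewrite normrM ler_piMr.
Qed.

Let null_upper M c : null M \1_(upper c).
Proof.
pose phi k i := cut_upper (Num.max (c i) (- M)) M k.+1%:R^-1.
have e01 (k : nat) : 0 < (k.+1%:R^-1 : R) <= 1.
  by apply/andP; split; [rewrite invr_gt0|rewrite invf_le1// ler1n].
have nphi k i : test1 (phi k i) by exact: test1_cut_upper.
(* The size of a cube outside which [tensor (phi k)] vanishes for every [k], so that one integrable
   function dominates the whole sequence. *)
pose L := \sum_i `|c i| + `|M| + `|M| + 1.
have phiL k x : tensor (phi k) x != 0 -> box L x = 1.
  move=> /tensor_neq0 p0; apply: box1 => i; rewrite leNgt; apply/negP => Lx.
  have ci : `|c i| <= \sum_i `|c i| by rewrite (bigD1 i)//= lerDl sumr_ge0.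
  have h : `|Num.max (c i) (- M)| <= `|c i| + `|M|.
    by rewrite maxEle; case: ifP => _; rewrite ?normrN ?lerDl ?lerDr.
  have := p0 i; rewrite /phi cut_upper_out ?eqxx//.
  by move: Lx ci h; rewrite /L; lra.
have [| | | |_ _ H] := @dominated_convergence _ _ _ leb setT measurableT
    (fun k x => (u x * tensor (phi k) x)%:E) (fun x => (box M x * u x * \1_(upper c) x)%:E)
    (EFin \o (fun x => `|box L x * u x|)) _ _ _ (intg_norm (proj2 bu L)) _.
- move=> k; apply/measurable_EFinP; apply: measurable_funM => //.
  by apply: measurable_tensor => i; exact: measurable_test1.
- apply/measurable_EFinP; apply: measurable_funM; last by apply: measurable_indic; exact: measurable_upper.
  by apply: measurable_funM => //; exact: measurable_box.
- apply: aeW => x _; apply: cvg_near_cst.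
  have : \forall k \near \oo, forall i, phi k i (x 0 i) = \1_`[- M, M] (x 0 i) * \1_`[c i, +oo[ (x 0 i).
    by apply: filter_forall => i; exact: cut_upper_near.
  apply: filterS => k hk; congr EFin; rewrite indic_upper_tensor /box mulrAC mulrC; congr (_ * _).
  by rewrite tensorM /tensor; apply: eq_bigr => i _; rewrite hk.
- apply: aeW => x k _; rewrite /= lee_fin normrM.
  have [->|t0] := eqVneq (tensor (phi k) x) 0; first by rewrite normr0 mulr0.
  rewrite (phiL _ _ t0) mul1r ler_piMr//.
  rewrite normr_prod; apply: prodr_ile1 => i _; rewrite normr_ge0/=.
  by have /andP[a0 a1] := cut_upper_itv (Num.max (c i) (- M)) M k.+1%:R^-1 (x 0 i); rewrite ger0_norm.
have : (fun k => \int[leb]_x (u x * tensor (phi k) x)%:E)%E @ \oo -->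
  (\int[leb]_x (box M x * u x * \1_(upper c) x)%:E)%E by exact: H.
under eq_fun do rewrite u0//.
by rewrite /null => /cvg_lim <-//; rewrite lim_cst.
Qed.

Let null_limit M (v : nat -> 'rV[R]_n -> R) (w : 'rV[R]_n -> R) :
  measurable_fun [set: 'rV[R]_n] w ->
  (forall k, measurable_fun [set: 'rV[R]_n] (v k)) -> (forall k x, `|v k x| <= 1) ->
  (forall x, \forall k \near \oo, v k x = w x) -> (forall k, null M (v k)) -> null M w.
Proof.
move=> mw mv v1 vw nv.
have [| | | |_ _ H] := @dominated_convergence _ _ _ leb setT measurableT
    (fun k x => (box M x * u x * v k x)%:E) (fun x => (box M x * u x * w x)%:E)
    (EFin \o (fun x => `|box M x * u x|)) _ _ _ (intg_norm (proj2 bu M)) _.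
- by move=> k; apply/measurable_EFinP; exact: intg_measurable (ibox M (mv k) (v1 k)).
- apply/measurable_EFinP; apply: measurable_funM => //.
  by apply: measurable_funM => //; exact: measurable_box.
- by apply: aeW => x _; apply: cvg_near_cst; have := vw x; apply: filterS => k ->.
- by apply: aeW => x k _; rewrite /= lee_fin normrM ler_piMr.
have : (fun k => \int[leb]_x (box M x * u x * v k x)%:E)%E @ \oo -->
  (\int[leb]_x (box M x * u x * w x)%:E)%E by exact: H.
under eq_fun do rewrite nv.
by rewrite /null => /cvg_lim <-//; rewrite lim_cst.
Qed.

Let v1 (A : set 'rV[R]_n) x : `|\1_A x| <= 1 :> R.
Proof. by rewrite /indic; case: (_ \in _); rewrite ?normr1 ?normr0. Qed.

Let mv A : measurable A -> measurable_fun [set: 'rV[R]_n] (\1_A : _ -> R).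
Proof. exact: measurable_indic. Qed.

Let nullD M (v w : 'rV[R]_n -> R) (a : R) :
  intg leb (fun x => box M x * u x * v x) -> intg leb (fun x => box M x * u x * w x) ->
  null M v -> null M w -> null M (fun x => v x + a * w x).
Proof.
move=> iv iw nv nw; rewrite /null.
have iaw : intg leb (fun x => a * (box M x * u x * w x)) by exact: intgZ.
transitivity (\int[leb]_x ((box M x * u x * v x)%:E + (a * (box M x * u x * w x))%:E))%E.
  by apply: eq_integral => x _; rewrite -EFinD; congr EFin; ring.
rewrite integralD_EFin// nv add0e.
rewrite (_ : (fun x => _) = (fun x => a%:E * (box M x * u x * w x)%:E)%E)//.
by rewrite integralZl// nw mule0.
Qed.

(** The pi-lambda argument again, now for the functional defined by [u] on a cube; a countable
    disjoint union is reached through its finite unions. *)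
Let null_indic M A : measurable A -> null M \1_A.
Proof.
have iA B : measurable B -> intg leb (fun x => box M x * u x * \1_B x).
  by move=> mB; apply: ibox; [exact: mv|exact: v1].
have nT : null M \1_setT.
  apply: (@null_limit M (fun k => \1_(upper (fun=> - k%:R)))) => //.
    by move=> k; apply: mv; exact: measurable_upper.
  move=> x; have [K hK] := row_bound x; exists K => // k /= Kk.
  rewrite /indic in_setT mem_set// => j.
  by rewrite lerNl (le_trans _ (le_trans (hK j) _)) ?ler_nat// -normrN ler_norm.
rewrite {1}measurable_row_upper.
move=> sA; apply: (@dynkin_induction _ 'rV[R]_n (range (@upper R n)) (fun A : set 'rV[R]_n => null M \1_A) _ _ _ _ _ _ A sA).
- exact: measurable_row_upper.
- exact: setI_closed_upper.
- by [].
- by move=> _ [c _ <-].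
- move=> S mS nS.
  have -> : \1_(~` S) = (fun x => \1_(setT : set 'rV[R]_n) x + (-1) * \1_S x) :> (_ -> R).
    apply/funext => x; rewrite /indic in_setT in_setC; case: (_ \in _) => /=; lra.
  by apply: nullD => //; exact: iA.
- move=> F mF tF nF.
  pose G k := \bigcup_(i in `I_k) F i.
  have mG k : measurable (G k) by apply: bigcup_measurable => i _.
  apply: (@null_limit M (fun k => \1_(G k))) => //.
  + by apply: mv; exact: bigcupT_measurable.
  + move=> x; have [[j _ Fjx]|NF] := pselect ((\bigcup_i F i) x).
      exists j.+1 => // k /= jk; rewrite /indic !mem_set//; first by exists j.
      by exists j.
    by near=> k; rewrite /indic !memNset// => -[j _ Fjx]; apply: NF; exists j.
  + elim=> [|k IH].
      rewrite /null integral0_eq// => x _.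
      by rewrite /indic memNset ?mulr0// => -[i].
    have -> : \1_(G k.+1) = (fun x => \1_(G k) x + 1 * \1_(F k) x) :> (_ -> R).
      apply/funext => x; rewrite mul1r /indic.
      have [Fk|NFk] := pselect (F k x).
        have NG : ~ G k x.
          by move=> [i /= ik Fi]; move: ik; rewrite (tF i k I I (ex_intro _ x (conj Fi Fk))) ltnn.
        have GS : G k.+1 x by exists k => /=.
        by rewrite (mem_set Fk) (mem_set GS) (memNset NG) add0r.
      rewrite (memNset NFk) addr0; case: (pselect (G k x)) => Gx.
        have GS : G k.+1 x by case: Gx => i /= ik Fi; exists i => //=; exact: ltnW.
        by rewrite (mem_set Gx) (mem_set GS).
      have NGS : ~ G k.+1 x.
        move=> [i /=]; rewrite ltnS leq_eqVlt => /orP[/eqP -> //|ik Fi].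
        by apply: Gx; exists i.
      by rewrite (memNset Gx) (memNset NGS).
    by apply: nullD => //; exact: iA.
Unshelve. all: by end_near. Qed.

(** The fundamental lemma of the calculus of variations for product test functions: on each cube the
    integral of [u] over every measurable set vanishes, and countably many cubes exhaust the
    space. *)
Lemma tensor_null_ae_eq0 : ae_eq leb setT (EFin \o u) (cst 0%E).
Proof.
have h (k : nat) : \forall x \ae leb, setT x -> (box k%:R x * u x)%:E = 0%E.
  apply: (@integral_ae_eq _ _ _ leb setT measurableT (cst 0%E) (fun x => (box k%:R x * u x)%:E)) => //.
    exact: (proj2 bu k%:R).
  move=> E _ mE; rewrite integral0 integral_mkcond.
  rewrite -[RHS](null_indic k%:R mE); apply: eq_integral => x _.
  by rewrite patchE /indic; case: (_ \in _); rewrite ?mulr1 ?mulr0.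
have := ae_foralln h; apply: filterS => x hx _.
have [K hK] := row_bound x.
by have := hx K Logic.I; rewrite box1 ?mul1r.
Qed.

End weak_gradient_uniqueness.

(** * Calculus of weak derivatives *)

Section weak_partial_calculus.
Context {R : realType} (n : nat).
Local Notation leb := (row_prod (@lebesgue_measure R) n).
Local Notation gam := (gaussian n (1 : R)).
Local Notation der f := (f^`()%classic).
Implicit Types (u g h : 'rV[R]_n -> R) (x t : 'rV[R]_n) (phi : 'I_n -> R -> R) (s : R).

Lemma box_integrableD (a : R) u v : box_integrable u -> box_integrable v ->
  box_integrable (fun x => a * u x + v x).
Proof.
move=> [mu bu] [mv bv]; split.
  by apply: measurable_funD => //; exact: measurable_funM.
move=> M; have : intg leb (fun x => a * (box M x * u x) + box M x * v x).
  by apply: intgD; [apply: intgZ; exact: bu|exact: bv].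
by congr (leb.-integrable _ _); apply/funext => x /=; congr EFin; ring.
Qed.

Lemma box_integrable_cst (c : R) : box_integrable (cst c : 'rV[R]_n -> R).
Proof.
split=> // M.
have iI : lebesgue_measure.-integrable setT (EFin \o (\1_`[- M, M] : R -> R)).
  exact: integrable_indic_itv.
have [ib _] := integrable_tensor (fun _ : 'I_n => iI).
have : intg leb (fun x => c * box M x) by apply: intgZ; exact: ib.
by congr (leb.-integrable _ _); apply/funext => x /=; rewrite mulrC.
Qed.

Lemma test1_dtensor_out phi j : (forall i, test1 (phi i)) ->
  exists psi, (forall i, test1 (psi i)) /\ dtensor phi j = tensor psi.
Proof.
move=> nphi; exists (fun k => if k == j then der (phi k) else phi k); split => // k.
exact: test1_dtensor.
Qed.

Lemma intg_mul_dtensor u phi j : box_integrable u -> (forall i, test1 (phi i)) ->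
  intg leb (fun x => u x * dtensor phi j x).
Proof.
move=> bu nphi; have [psi [npsi ->]] := test1_dtensor_out j nphi.
exact: intg_mul_tensor.
Qed.

Lemma integral_derive_test1 (f : R -> R) : test1 f ->
  lebesgue_measure.-integrable setT (EFin \o der f) /\ (\int[lebesgue_measure]_t (der f t) = 0)%R.
Proof.
move=> nf; have [sf [M hM]] := nf; have [sf' [M' hM']] := test1_derive nf.
pose L := `|M| + `|M'| + 1.
have L1 (t : R) : L <= `|t| -> f t = 0 /\ der f t = 0.
  have := ler_norm M; have := ler_norm M'; have := normr_ge0 M; have := normr_ge0 M'.
  by rewrite /L => *; split; [apply: hM|apply: hM']; lra.
have L0 : 0 < L by rewrite ltr_wpDl// addr_ge0.
have [| | | | |i1 e1] := @FTC2_line R (der f) f (- L) L.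
- by lra.
- exact: smooth1_continuous.
- by move=> t; exact: is_derive_test1.
- by move=> t Lt; apply: (proj2 (L1 t _)); exact: le_trans Lt (ler_norm t).
- by move=> t tL; apply: (proj2 (L1 t _)); rewrite -normrN (le_trans _ (ler_norm _))// lerNr.
split=> //; rewrite /Rintegral e1.
have [|-> _] := L1 L; first by rewrite ger0_norm// ltW.
have [|e2 _] := L1 (- L); first by rewrite normrN ger0_norm// ltW.
by rewrite e2 subrr.
Qed.

Lemma integral_dtensor phi j : (forall i, test1 (phi i)) ->
  (\int[leb]_x (dtensor phi j x)%:E = 0)%E.
Proof.
move=> nphi; have [psi [npsi E]] := test1_dtensor_out j nphi.
have iphi k : lebesgue_measure.-integrable setT
    (EFin \o (if k == j then der (phi k) else phi k)).
  case: ifP => _; first by have [] := integral_derive_test1 (nphi k).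
  have [M hM] := proj2 (nphi k); have [B hB] := test1_bounded (nphi k).
  have iI : lebesgue_measure.-integrable setT (EFin \o (\1_`[- M, M] : R -> R)).
    exact: integrable_indic_itv.
  have iB := integrableZl measurableT B iI.
  apply: (le_integrable measurableT _ _ iB).
    by apply/measurable_EFinP; exact: measurable_test1.
  move=> t _; rewrite /= lee_fin normrM /indic mem_setE in_itv/= -ler_norml.
  case: (leP `|t : R| M) => tM /=; first by rewrite (@normr1 R) mulr1 (le_trans (hB t)) ?ler_norm.
  by rewrite hM ?normr0 ?mulr0.
have [it Et] := integrable_tensor iphi.
have fin : (\int[leb]_x (dtensor phi j x)%:E)%E \is a fin_num by exact: integrable_fin_num it.
rewrite -[LHS]fineK//; congr EFin.
transitivity (\int[leb]_x dtensor phi j x)%R; first by [].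
rewrite Et (bigD1 j)//= eqxx.
by have [_ ->] := integral_derive_test1 (nphi j); rewrite mul0r.
Qed.

(** The constant [b] drops out because a partial derivative of a product test function has integral
    0. *)
Lemma tensor_weak_partial_affine_val j g h (a b : R) : tensor_weak_partial j g h ->
  tensor_weak_partial j (fun x => a * (g x - b)) (fun x => a * h x).
Proof.
move=> [bg bh gh].
have E : (fun x => a * (g x - b)) = (fun x => a * g x + cst (- (a * b)) x).
  by apply/funext => x /=; ring.
split.
- by rewrite E; apply: box_integrableD => //; exact: box_integrable_cst.
- have := box_integrableD a bh (box_integrable_cst 0).
  by congr box_integrable; apply/funext => x /=; rewrite addr0.
move=> phi nphi.
have i1 := intg_mul_dtensor j bg nphi; have i2 := intg_mul_tensor bh nphi.
have i3 := intg_mul_dtensor j (box_integrable_cst 1) nphi.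
have i1' := intgZ a i1; have i3' := intgZ (- (a * b)) i3.
transitivity (\int[leb]_x ((a * (g x * dtensor phi j x))%:E + (- (a * b) * (cst 1 x * dtensor phi j x))%:E))%E.
  by apply: eq_integral => x _; rewrite -EFinD; congr EFin; rewrite /=; ring.
rewrite integralD_EFin//.
have Z (c : R) (f : 'rV[R]_n -> R) : intg leb f -> (\int[leb]_x (c * f x)%:E = c%:E * \int[leb]_x (f x)%:E)%E.
  move=> fi; rewrite -integralZl//.
rewrite Z// Z// [X in (_ + _ * X)%E](_ : _ = 0%E); last first.
  by rewrite -(integral_dtensor j nphi); apply: eq_integral => x _; rewrite /= mul1r.
rewrite mule0 adde0 gh// [RHS](_ : _ = (- (\int[leb]_x (a * (h x * tensor phi x))%:E))%E); last first.
  by congr (- _)%E; apply: eq_integral => x _; rewrite mulrA.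
by rewrite Z// muleN.
Qed.

(** The two derivatives agree Lebesgue-almost everywhere, hence Gaussian-almost everywhere by
    domination. This carries square integrability from the gradient supplied by [gaussian_W12] to
    the given one. *)
Lemma tensor_weak_partial_unique_L2 j g h h' :
  tensor_weak_partial j g h -> tensor_weak_partial j g h' -> L2 gam h' -> L2 gam h.
Proof.
move=> [_ bh gh] [_ bh' gh'] [_ oo].
have [mh _] := bh; have [mh' _] := bh'; split=> //.
pose u x := -1 * h' x + h x.
have bu : box_integrable u by exact: box_integrableD.
have [mu _] := bu.
have u0 phi : (forall i, test1 (phi i)) -> (\int[leb]_x (u x * tensor phi x)%:E = 0)%E.
  move=> nphi; have i1 := intg_mul_tensor bh nphi; have i2 := intg_mul_tensor bh' nphi.
  transitivity (\int[leb]_x ((h x * tensor phi x)%:E - (h' x * tensor phi x)%:E))%E.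
    by apply: eq_integral => x _; rewrite -EFinB; congr EFin; rewrite /u; ring.
  rewrite integralB_EFin//.
  have -> : (\int[leb]_x (h x * tensor phi x)%:E = \int[leb]_x (h' x * tensor phi x)%:E)%E.
    by apply: oppe_inj; rewrite -gh// -gh'.
  by rewrite subee//; exact: integrable_fin_num i2.
have au := tensor_null_ae_eq0 bu u0.
have mue : measurable_fun [set: 'rV[R]_n] (EFin \o u) by exact/measurable_EFinP.
have gu : (\int[gam]_x `|(EFin \o u) x| = 0)%E.
  apply/eqP; rewrite eq_le integral_ge0// andbT.
  apply: (le_trans (ge0_gaussian_le_lebesgue _ _)) => //.
    by apply: measurableT_comp.
  by have /(ae_eq_integral_abs leb measurableT mue) -> := au.
have ag : ae_eq gam setT (EFin \o u) (cst 0%E) by apply/ae_eq_integral_abs.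
rewrite /sqnorm (@ge0_ae_eq_integral _ _ _ gam setT (fun x => (h x ^+ 2)%:E) (fun x => (h' x ^+ 2)%:E))//.
- exact: measurable_sqr.
- exact: measurable_sqr.
- by move=> x _; rewrite lee_fin sqr_ge0.
- by move=> x _; rewrite lee_fin sqr_ge0.
apply: filterS ag => x /(_ Logic.I) [ux] _; congr (_ ^+ 2)%:E.
by move: ux; rewrite /u mulN1r addrC => /eqP; rewrite subr_eq0 => /eqP.
Qed.

End weak_partial_calculus.

(** * Affine changes of variables *)

Section change_of_variables.
Context {R : realType} (n : nat).
Local Notation leb := (row_prod (@lebesgue_measure R) n).
Local Notation der f := (f^`()%classic).
Implicit Types (u g h : 'rV[R]_n -> R) (x t : 'rV[R]_n) (phi : 'I_n -> R -> R) (s : R).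

Lemma measurable_row_affine s t : measurable_fun [set: 'rV[R]_n] (fun x => t + s *: x).
Proof.
apply: measurable_fun_rowP => i; under eq_fun do rewrite !mxE.
by apply: measurable_funD => //; apply: measurable_funM => //; exact: measurable_coord.
Qed.

Lemma integral_row_affine s t u : 0 < s -> intg leb u ->
  intg leb (fun x => u (t + s *: x)) /\
  (\int[leb]_x (u (t + s *: x)%R)%:E = (s^-1 ^+ n)%:E * \int[leb]_x (u x)%:E)%E.
Proof.
move=> s0 iu; have mu := intg_measurable iu; have ma := measurable_row_affine s t.
have mue : measurable_fun [set: 'rV[R]_n] (EFin \o u) by exact/measurable_EFinP.
split.
  apply/integrableP; split.
    by apply/measurable_EFinP; exact: measurableT_comp.
  have := @lebesgue_row_affine R n s t (fun x => `|(u x)%:E|%E) s0.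
  move=> ->//; last by apply: measurableT_comp.
  apply: lte_mul_pinfty; rewrite ?lee_fin ?exprn_ge0 ?invr_ge0 ?(ltW s0)//.
  by have /integrableP[] := iu.
rewrite integralE [in RHS]integralE.
have -> : (\int[leb]_x ((fun x => (u (t + s *: x)%R)%:E)^\+ x) = (s^-1 ^+ n)%:E * \int[leb]_x ((EFin \o u)^\+ x))%E.
  rewrite -(@lebesgue_row_affine R n s t _ s0)//; last exact: measurable_funepos.
  by apply: eq_integral => x _; rewrite !funeposE.
have -> : (\int[leb]_x ((fun x => (u (t + s *: x)%R)%:E)^\- x) = (s^-1 ^+ n)%:E * \int[leb]_x ((EFin \o u)^\- x))%E.
  rewrite -(@lebesgue_row_affine R n s t _ s0)//; last exact: measurable_funeneg.
  by apply: eq_integral => x _; rewrite !funenegE.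
transitivity ((s^-1 ^+ n)%:E * (\int[leb]_x (EFin \o u)^\+ x - \int[leb]_x (EFin \o u)^\- x))%E; last by [].
rewrite -(fineK (integrable_pos_fin_num measurableT iu)) -(fineK (integrable_neg_fin_num measurableT iu)).
by rewrite -!(EFinM, EFinB) mulrBr.
Qed.

Lemma box_integrable_row_affine s t u : 0 < s -> box_integrable u ->
  box_integrable (fun x => u (t + s *: x)).
Proof.
move=> s0 [mu bu]; have ma := measurable_row_affine s t; split; first exact: measurableT_comp.
move=> M; have [K hK] := row_bound t.
have sV : 0 < s^-1 by rewrite invr_gt0.
pose k (y : 'rV[R]_n) := box M (s^-1 *: (y - t)).
have kE x : k (t + s *: x) = box M x.
  by rewrite /k addrAC subrr add0r scalerA mulVf ?gt_eqF// scale1r.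
have mk : measurable_fun [set: 'rV[R]_n] k.
  rewrite (_ : k = (fun y => box M (- (s^-1 *: t) + s^-1 *: y))).
    by apply: measurableT_comp; [exact: measurable_box|exact: measurable_row_affine].
  by apply/funext => y; rewrite /k scalerBr addrC.
have ik : intg leb (fun y => u y * k y).
  (* The affine map sends the cube of size [M] into the cube of size [s * M + K%:R], where [K]
     bounds the entries of [t]. *)
  apply: (@integrable_conv R n u k (s * M + K%:R) 1) => //.
    move=> w; have /andP[b0 b1] := box_itv M (s^-1 *: (w - t)).
    by rewrite ger0_norm.
  move=> w /box_neq0 h i; have := h i; rewrite !mxE normrM gtr0_norm// ler_pdivrMl// => hi.
  have -> : w 0 i = (w 0 i - t 0 i) + t 0 i by rewrite subrK.
  by apply: (le_trans (ler_normD _ _)); apply: lerD.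
have [+ _] := integral_row_affine t s0 ik.
by congr (leb.-integrable _ _); apply/funext => x /=; rewrite kE mulrC.
Qed.

(** The change of variables is transferred to the test functions. Dilation and translation act on
    each coordinate separately, so these remain products. *)
Lemma tensor_weak_partial_row_affine j g h s t : 0 < s -> tensor_weak_partial j g h ->
  tensor_weak_partial j (fun x => g (t + s *: x)) (fun x => s * h (t + s *: x)).
Proof.
move=> s0 [bg bh gh].
have sV : 0 < s^-1 by rewrite invr_gt0.
have sN0 : s != 0 by rewrite gt_eqF.
split; first exact: box_integrable_row_affine.
  have := box_integrableD s (box_integrable_row_affine t s0 bh) (box_integrable_cst n 0).
  by congr box_integrable; apply/funext => x /=; rewrite addr0.
move=> phi nphi.
pose psi i (y : R) := phi i (s^-1 * y + - (s^-1 * t 0 i)).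
have psiE i a : psi i (t 0 i + s * a) = phi i a.
  by rewrite /psi; congr phi; field.
have npsi i : test1 (psi i).
  have [sp [M hM]] := nphi i; split; first by move=> k; apply: diffn_affine; exact: sp.
  exists (`|t 0 i| + s * `|M|) => y hy; apply: hM.
  have -> : s^-1 * y + - (s^-1 * t 0 i) = s^-1 * (y - t 0 i) by ring.
  rewrite normrM gtr0_norm// ltr_pdivlMl//.
  apply: (@le_lt_trans _ _ (s * `|M|)); first by rewrite ler_wpM2l ?ler_norm// ltW.
  have := ler_normD (y - t 0 i) (t 0 i); rewrite subrK; lra.
have tE x : tensor phi x = tensor psi (t + s *: x).
  by apply: eq_bigr => i _; rewrite !mxE psiE.
have dpsi i a : der (psi i) (t 0 i + s * a) = s^-1 * der (phi i) a.
  rewrite derive1E; have e1 : s^-1 * (t 0 i + s * a) + - (s^-1 * t 0 i) = a by field.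
  have hd : is_derive (s^-1 * (t 0 i + s * a) + - (s^-1 * t 0 i)) 1 (phi i) (der (phi i) a).
    by rewrite e1; exact: is_derive_test1.
  by have [_ ->] := is_derive_comp_affine hd.
have dE x : dtensor phi j x = s * dtensor psi j (t + s *: x).
  rewrite /dtensor /tensor (bigD1 j)//= [in RHS](bigD1 j)//= !eqxx !mxE dpsi !mulrA divff// mul1r.
  congr (_ * _); apply: eq_bigr => i /negbTE ->; by rewrite !mxE psiE.
have i1 := intg_mul_dtensor j bg npsi; have i2 := intg_mul_tensor bh npsi.
have [j1 e1] := integral_row_affine t s0 (intgZ s i1).
have [j2 e2] := integral_row_affine t s0 (intgZ s i2).
transitivity (\int[leb]_x (s * (g (t + s *: x) * dtensor psi j (t + s *: x)))%:E)%E.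
  by apply: eq_integral => x _; rewrite dE; congr EFin; ring.
rewrite e1 [RHS](_ : _ = (- (\int[leb]_x (s * (h (t + s *: x) * tensor psi (t + s *: x)))%:E))%E); last first.
  by congr (- _)%E; apply: eq_integral => x _; rewrite tE mulrA.
rewrite e2 -muleN; congr (_ * _)%E.
have Z (f : 'rV[R]_n -> R) : intg leb f -> (\int[leb]_x (s * f x)%:E = s%:E * \int[leb]_x (f x)%:E)%E.
  by move=> fi; rewrite -integralZl.
by rewrite Z// Z// gh// muleN.
Qed.

End change_of_variables.

(** * Coverage *)

Section gaussian_noise.
Context d (T : measurableType d) (R : realType) (P : probability T R) (n : nat) (s : R).
Variable eps : {RV P >-> 'rV[R]_n}.
Hypothesis s0 : 0 < s.
Hypothesis law : forall A : set 'rV[R]_n, measurable A ->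
  distribution P eps A = gaussian n s A.
Local Notation gam := (gaussian n (1 : R)).

Let mscale : measurable_fun [set: 'rV[R]_n] (fun x : 'rV[R]_n => s *: x).
Proof.
have := @measurable_row_affine R n s 0.
by under eq_fun do rewrite add0r.
Qed.

Lemma ge0_integral_noise (f : 'rV[R]_n -> \bar R) : measurable_fun [set: 'rV[R]_n] f ->
  (forall x, 0 <= f x)%E -> (\int[P]_w f (eps w) = \int[gam]_x f (s *: x)%R)%E.
Proof.
move=> mf f0; rewrite gaussian_scale//.
rewrite -(ge0_integral_distribution eps mf f0).
by apply: eq_measure_integral => A mA _; exact: law.
Qed.

Lemma integral_noise (q : 'rV[R]_n -> R) : measurable_fun [set: 'rV[R]_n] q ->
  (\int[P]_w (q (eps w))%:E = \int[gam]_x (q (s *: x)%R)%:E)%E.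
Proof.
move=> mq; have mqe : measurable_fun [set: 'rV[R]_n] (EFin \o q) by exact/measurable_EFinP.
rewrite integralE [RHS]integralE; congr (_ - _)%E.
  have := ge0_integral_noise (measurable_funepos mqe) (fun x => funepos_ge0 _ x).
  move=> E; etransitivity; last (etransitivity; first exact: E).
    by apply: eq_integral => w _; rewrite !funeposE.
  by apply: eq_integral => w _; rewrite !funeposE.
have := ge0_integral_noise (measurable_funeneg mqe) (fun x => funeneg_ge0 _ x).
move=> E; etransitivity; last (etransitivity; first exact: E).
  by apply: eq_integral => w _; rewrite !funenegE.
by apply: eq_integral => w _; rewrite !funenegE.
Qed.

Lemma noise_prob (S : set 'rV[R]_n) : measurable S ->
  P [set w | S (eps w)] = gam [set x | S (s *: x)].
Proof.
move=> mS; have mS1 : measurable [set w | S (eps w)].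
  by have := measurable_funPT eps measurableT S mS; rewrite setTI.
have mS2 : measurable [set x | S (s *: x)] by have := mscale measurableT mS; rewrite setTI.
have m1S : measurable_fun [set: 'rV[R]_n] (fun x : 'rV[R]_n => (\1_S x)%:E : \bar R).
  by apply/measurable_EFinP; exact: measurable_indic.
have E := ge0_integral_noise m1S (fun x => ltac:(by rewrite lee_fin)).
have e1 : (P [set w | S (eps w)] = \int[P]_w (\1_S (eps w))%:E)%E.
  by rewrite -(setIT [set w | _]) -integral_indic.
have e2 : (gam [set x | S (s *: x)] = \int[gam]_x (\1_S (s *: x)%R)%:E)%E.
  by rewrite -(setIT [set x | _]) -integral_indic.
by rewrite e1 e2.
Qed.

End gaussian_noise.

(** * Comparison of level sets *)

Section level_sets.
Context {R : realType} (n : nat).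
Local Notation gam := (gaussian n (1 : R)).

Lemma gaussian_le1 (A : set 'rV[R]_n) : measurable A -> (gam A <= 1)%E.
Proof.
by move=> mA; rewrite -(@gaussian_setT R n 1); apply: le_measure; rewrite ?inE.
Qed.

(** Outside [T], the events Z <= c and Z' <= c can differ only where Z is within [L] of [c]; the
    exceptional set therefore has probability at most a + b. *)
Lemma level_set_perturbation (Z Z' : 'rV[R]_n -> R) (T : set 'rV[R]_n) (c L a b alpha : R) :
  measurable_fun [set: 'rV[R]_n] Z -> measurable_fun [set: 'rV[R]_n] Z' -> measurable T ->
  (forall x, ~ T x -> `|Z' x - Z x| <= L) -> (gam T <= a%:E)%E ->
  (gam [set x | (`|Z x - c| <= L)%R] <= b%:E)%E -> gam [set x | c < Z x] = alpha%:E ->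
  exists2 p : R, gam [set x | Z' x <= c] = p%:E & `|p - (1 - alpha)| <= a + b.
Proof.
move=> mZ mZ' mT TZ Ta Zb Za.
pose A := [set x | Z' x <= c]; pose B := [set x | Z x <= c].
pose S := [set x | `|Z x - c| <= L]; pose C := [set x | c < Z x].
have mA : measurable A by exact: measurable_le_set.
have mB : measurable B by exact: measurable_le_set.
have mC : measurable C by exact: measurable_gt_set.
have mS : measurable S.
  by apply: measurable_le_set; apply: measurableT_comp => //; exact: measurable_funB.
have gE X : measurable X -> exists p : R, gam X = p%:E.
  move=> mX; have gX : gam X \is a fin_num.
    by rewrite ge0_fin_numE// (le_lt_trans (gaussian_le1 mX))// ltry.
  by exists (fine (gam X)); rewrite fineK.
have gB : gam B = (1 - alpha)%:E.
  have [q qE] := gE _ mB.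
  have BC : B `|` C = setT.
    by apply/seteqP; split => x // _; rewrite /B /C /=; case: (leP (Z x) c) => ?; [left|right].
  have : gam (B `|` C) = (gam B + gam C)%E.
    apply: measureU => //; apply/seteqP; split => x //= -[].
    by rewrite /B /C /= leNgt => /negP.
  rewrite BC gaussian_setT Za qE -EFinD => -[e].
  by congr EFin; lra.
have cover X Y : measurable X -> measurable Y -> X `<=` Y `|` (T `|` S) ->
    (gam X <= gam Y + (a + b)%:E)%E.
  move=> mX mY XY.
  apply: (@le_trans _ _ (gam (Y `|` (T `|` S)))).
    by apply: le_measure; rewrite ?inE//; apply: measurableU => //; exact: measurableU.
  apply: (le_trans (measureU2 _ _ _)) => //; first exact: measurableU.
  apply: leeD => //; rewrite EFinD; apply: (le_trans (measureU2 _ _ _)) => //.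
  exact: leeD.
have [p pE] := gE _ mA; exists p => //.
have up : (gam A <= gam B + (a + b)%:E)%E.
  apply: cover => // x; rewrite /A /B /S /= => Ax.
  have [Tx|/TZ zx] := pselect (T x); first by right; left.
  case: (leP (Z x) c) => Zc; [by left|right; right].
  by move: zx; rewrite !ler_norml => /andP[? ?]; apply/andP; split; lra.
have low : (gam B <= gam A + (a + b)%:E)%E.
  apply: cover => // x; rewrite /A /B /S /= => Bx.
  have [Tx|/TZ zx] := pselect (T x); first by right; left.
  case: (leP (Z' x) c) => Zc; [by left|right; right].
  by move: zx; rewrite !ler_norml => /andP[? ?]; apply/andP; split; lra.
move: up low; rewrite gB pE -!EFinD !lee_fin ler_norml => up low.
by apply/andP; split; lra.
Qed.

End level_sets.

(** * Coverage error in a fixed dimension *)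

Section fixed_dimension.
Context d (T : measurableType d) (R : realType) (P : probability T R) (n : nat).
Variables (s rho : R) (m : 'rV[R]_n) (eps : {RV P >-> 'rV[R]_n})
  (f : 'rV[R]_n -> 'rV[R]_n) (D : 'rV[R]_n -> 'M[R]_n).
Hypothesis n0 : (0 < n)%N.
Hypothesis s0 : 0 < s.
Hypothesis law : forall A : set 'rV[R]_n, measurable A ->
  distribution P eps A = gaussian n s A.
Hypothesis fW12 : forall j : 'I_n, gaussian_W12 (fun x => f (m + s *: x) 0 j).
Hypothesis fD : weak_gradient f D.
Hypothesis risk : ('E_P[fun w => (4 * enorm (f (m + eps w) - m) ^+ 2 / (n%:R * s ^+ 2) +
  4 * \tr (D (m + eps w) *m D (m + eps w)) / n%:R)%R] <= rho%:E)%E.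
Local Notation gam := (gaussian n (1 : R)).

Let F (j : 'I_n) x := s^-1 * (f (m + s *: x) 0 j - m 0 j).
(** Transposed, because the gradients are the columns of [D] while [energy] takes the index of the
    component first. The factor [s^-1] in [F] cancels the factor [s] of the chain rule. *)
Let H (j i : 'I_n) x := D (m + s *: x) i j.

Let sN0 : s != 0. Proof. by rewrite gt_eqF. Qed.

Let enorm2 (x : 'rV[R]_n) : enorm x ^+ 2 = \sum_i x 0 i ^+ 2.
Proof. by rewrite sqr_sqrtr// sumr_ge0// => i _; exact: sqr_ge0. Qed.

Let weakF j i : tensor_weak_partial i (F j) (H j i).
Proof.
have := weak_partial_tensor (fD i j).
move=> /(tensor_weak_partial_row_affine m s0)/(tensor_weak_partial_affine_val s^-1 (m 0 j)).
by congr tensor_weak_partial; apply/funext => x; rewrite /H mulKf.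
Qed.

Let L2_cst (c : R) : L2 gam (fun=> c).
Proof. by split => //; exact: sqnorm_cst. Qed.

Let L2F j : L2 gam (F j).
Proof.
have [[mg _] [G [wG goo]]] := fW12 j.
have mG i : measurable_fun [set: 'rV[R]_n] (fun x => G x 0 i) by have [_ []] := wG i.
have mgG : measurable_fun [set: 'rV[R]_n]
    (fun x => (f (m + s *: x) 0 j ^+ 2 + enorm (G x) ^+ 2)%:E : \bar R).
  apply/measurable_EFinP; apply: measurable_funD; first exact: measurable_funX.
  under eq_fun do rewrite enorm2.
  by apply: measurable_sum => i; exact: measurable_funX.
have L2g : L2 gam (fun x => f (m + s *: x) 0 j).
  split=> //; apply: le_lt_trans goo; apply: ge0_le_integral => //.
  - by move=> x _; rewrite lee_fin sqr_ge0.
  - exact: measurable_sqr.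
  - by move=> x _; rewrite lee_fin lerDl sqr_ge0.
have := L2Z s^-1 (L2B L2g (L2_cst (m 0 j))); exact.
Qed.

(** The Sobolev hypothesis provides some square-integrable gradient [G], which need not be the given
    version; uniqueness of weak derivatives transfers the bound to [D]. *)
Let L2H j i : L2 gam (H j i).
Proof.
have [[mg _] [G [wG goo]]] := fW12 j.
have mG k : measurable_fun [set: 'rV[R]_n] (fun x => G x 0 k) by have [_ []] := wG k.
have mgG : measurable_fun [set: 'rV[R]_n]
    (fun x => (f (m + s *: x) 0 j ^+ 2 + enorm (G x) ^+ 2)%:E : \bar R).
  apply/measurable_EFinP; apply: measurable_funD; first exact: measurable_funX.
  under eq_fun do rewrite enorm2.
  by apply: measurable_sum => k; exact: measurable_funX.
have L2G : L2 gam (fun x => G x 0 i).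
  split=> //; apply: le_lt_trans goo; apply: ge0_le_integral => //.
  - by move=> x _; rewrite lee_fin sqr_ge0.
  - exact: measurable_sqr.
  - move=> x _; rewrite lee_fin enorm2 (bigD1 i)//= addrCA lerDl addr_ge0 ?sqr_ge0//.
    by rewrite sumr_ge0// => k _; exact: sqr_ge0.
have wF := tensor_weak_partial_affine_val s^-1 (m 0 j) (weak_partial_tensor (wG i)).
exact: (tensor_weak_partial_unique_L2 (weakF j i) wF (L2Z s^-1 L2G)).
Qed.

Let J := energy F H.

Let mcoord j : measurable_fun [set: 'rV[R]_n] (fun x => f x 0 j).
Proof. by have [[]] := fD j j. Qed.

Let mD i j : measurable_fun [set: 'rV[R]_n] (fun x => D x i j).
Proof. by have [_ []] := fD i j. Qed.

Let mshift : measurable_fun [set: 'rV[R]_n] (fun x : 'rV[R]_n => m + x).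
Proof.
have := @measurable_row_affine R n 1 m.
by under eq_fun do rewrite scale1r.
Qed.

Let mcoordm j : measurable_fun [set: 'rV[R]_n] (fun x => f (m + x) 0 j).
Proof. exact: (measurableT_comp (mcoord j) mshift). Qed.

Let mDm i j : measurable_fun [set: 'rV[R]_n] (fun x => D (m + x) i j).
Proof. exact: (measurableT_comp (mD i j) mshift). Qed.

Let Q (e : 'rV[R]_n) := 4 * enorm (f (m + e) - m) ^+ 2 / (n%:R * s ^+ 2) +
  4 * \tr (D (m + e) *m D (m + e)) / n%:R.

Let mQ : measurable_fun [set: 'rV[R]_n] Q.
Proof.
apply: measurable_funD; apply: measurable_funM => //; apply: measurable_funM => //.
  under eq_fun do rewrite enorm2.
  apply: measurable_sum => i; apply: measurable_funX.
  by under eq_fun do rewrite !mxE; apply: measurable_funB.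
rewrite /mxtrace; apply: measurable_sum => i.
under eq_fun do rewrite mxE.
by apply: measurable_sum => k; apply: measurable_funM.
Qed.

Let QE x : Q (s *: x) = 4 / n%:R * (\sum_j F j x * F j x + \sum_j \sum_i H j i x * H i j x).
Proof.
have nN0 : n%:R != 0 :> R by rewrite pnatr_eq0 -lt0n.
rewrite /Q mulrDr; congr (_ + _).
  have -> : enorm (f (m + s *: x) - m) ^+ 2 = s ^+ 2 * \sum_j F j x * F j x.
    rewrite enorm2 mulr_sumr; apply: eq_bigr => j _; rewrite !mxE /F.
    by field.
  by field; rewrite nN0.
rewrite mulrAC; congr (_ * _); rewrite /mxtrace exchange_big/=.
by apply: eq_bigr => i _; rewrite mxE; apply: eq_bigr => j _; rewrite /H mulrC.
Qed.

Let J_le : 4 * J <= n%:R * rho.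
Proof.
have nR0 : 0 < n%:R :> R by rewrite ltr0n.
have iF j : intg gam (fun x => F j x * F j x) by exact: L2M.
have iH j i : intg gam (fun x => H j i x * H i j x) by exact: L2M.
have i1 : intg gam (fun x => \sum_j F j x * F j x) by exact: intg_sum.
have i2 : intg gam (fun x => \sum_j \sum_i H j i x * H i j x).
  by apply: intg_sum => j; exact: intg_sum.
have iQ := intgZ (4 / n%:R) (intgD i1 i2).
have E : (\int[gam]_x (4 / n%:R * (\sum_j F j x * F j x + \sum_j \sum_i H j i x * H i j x)))%R = 4 / n%:R * J.
  rewrite RintegralZl//; last exact: intgD.
  rewrite RintegralD// Rintegral_sum// Rintegral_sum; last by move=> j; exact: intg_sum.
  congr (_ * (_ + _)); apply: eq_bigr => j _; exact: Rintegral_sum.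
have := risk; rewrite unlock (integral_noise s0 law mQ).
under eq_integral do rewrite QE.
rewrite -[leLHS]fineK; last exact: integrable_fin_num iQ.
rewrite lee_fin -[fine _]/(Rintegral _ _ _) E.
by rewrite mulrAC ler_pdivrMr// [rho * _]mulrC.
Qed.

Let sN := Num.sqrt (2 * n%:R) : R.

Let sN_gt0 : 0 < sN.
Proof. by rewrite sqrtr_gt0 mulr_gt0// ltr0n. Qed.

Let sN2 : sN ^+ 2 = 2 * n%:R.
Proof. by rewrite sqr_sqrtr// mulr_ge0. Qed.

(** The threshold makes [2 * divg F H] at most [de * sN] in absolute value off the event. As sN^2 =
    2 n, the tail bound equals 8 J / (n de^2), and 4 J <= n rho. *)
Let divg_small (de : R) : 0 < de ->
  (gam [set x | (de * sN / 2 < `|divg F H x|)%R] <= (2 * rho / de ^+ 2)%:E)%E.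
Proof.
move=> de0; have nR0 : 0 < n%:R :> R by rewrite ltr0n.
have eta0 : 0 < de * sN / 2 by rewrite divr_gt0// mulr_gt0.
have bF j : box_integrable (F j) by have [] := weakF j j.
apply: (le_trans (divg_tail bF (fun i j => weakF i j) L2F L2H eta0)).
rewrite lee_fin expr_div_n exprMn sN2.
have -> : 2 * rho / de ^+ 2 = n%:R * rho / (de ^+ 2 * (2 * n%:R) / 2 ^+ 2).
  by field; rewrite !gt_eqF.
apply: ler_wpM2r; last exact: J_le.
by rewrite invr_ge0 divr_ge0// ?sqr_ge0// mulr_ge0 ?sqr_ge0// mulr_ge0// ltW.
Qed.

Let SUREE x : SURE s f D (m + s *: x) - enorm (m - f (m + s *: x)) ^+ 2 =
  s ^+ 2 * (ssq x - n%:R - 2 * divg F H x).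
Proof.
rewrite /SURE !enorm2 /mxtrace /ssq /divg.
have -> : \sum_i (m + s *: x - f (m + s *: x)) 0 i ^+ 2 = s ^+ 2 * \sum_i x 0 i ^+ 2
    - 2 * s ^+ 2 * \sum_i (x 0 i * F i x) + \sum_i (m - f (m + s *: x)) 0 i ^+ 2.
  rewrite !mulr_sumr -sumrB -big_split/=; apply: eq_bigr => i _.
  by rewrite !mxE /F; field.
rewrite [\sum_i (x 0 i * F i x - _)]sumrB.
have -> : \sum_i D (m + s *: x) i i = \sum_i H i i x by [].
ring.
Qed.


Let mdivg : measurable_fun [set: 'rV[R]_n] (divg F H).
Proof.
exact: measurable_divg L2F L2H.
Qed.

Let mY : measurable_fun [set: 'rV[R]_n] (fun x => ssq x - n%:R).
Proof. by apply: measurable_funB => //; exact: measurable_ssq. Qed.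

Let mY' : measurable_fun [set: 'rV[R]_n] (fun x => ssq x - n%:R - 2 * divg F H x).
Proof. by apply: measurable_funB => //; exact: measurable_funM. Qed.

Let anticoncentration (c de : R) : 0 < de ->
  (gam [set x | (`|ssq x - c| <= de * sN)%R] <= (8 * de + 8 / n%:R)%:E)%E.
Proof.
move=> de0; have nR0 : 0 < n%:R :> R by rewrite ltr0n.
apply: (le_trans (chi_square_anticoncentration c n0 (mulr_gt0 de0 sN_gt0))).
rewrite lee_fin -/sN lerD2r.
have -> : 4 * (de * sN) * sN / n%:R = 4 * de * sN ^+ 2 / n%:R by ring.
by rewrite sN2 le_eqVlt; apply/orP; left; apply/eqP; field; rewrite gt_eqF.
Qed.

Let mtail de : measurable [set x | de * sN / 2 < `|divg F H x|].
Proof. by apply: measurable_gt_set; exact: measurableT_comp. Qed.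

Let s20 : 0 < s ^+ 2. Proof. by rewrite exprn_gt0. Qed.

Let msure : measurable_fun [set: 'rV[R]_n] (fun e : 'rV[R]_n => SURE s f D (m + e)).
Proof.
apply: measurable_funB => //; apply: measurable_funD.
  under eq_fun do rewrite enorm2.
  apply: measurable_sum => i; apply: measurable_funX.
  under eq_fun do rewrite !mxE.
  by apply: measurable_funB => //; apply: measurable_funD => //; exact: measurable_coord.
by apply: measurable_funM => //; apply: measurable_sum => i.
Qed.

Let mloss : measurable_fun [set: 'rV[R]_n] (fun e : 'rV[R]_n => enorm (m - f (m + e)) ^+ 2).
Proof.
under eq_fun do rewrite enorm2.
apply: measurable_sum => i; apply: measurable_funX.
by under eq_fun do rewrite !mxE; exact: measurable_funB.
Qed.

Lemma two_sided_coverage (v alpha de : R) : 0 < de ->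
  chi_square n [set t | v < (Num.sqrt (2 * n%:R))^-1 * `|t - n%:R|] = alpha%:E ->
  exists2 p : R, P [set w | `|SURE s f D (m + eps w) - enorm (m - f (m + eps w)) ^+ 2|
    <= s ^+ 2 * v * Num.sqrt (2 * n%:R)] = p%:E &
  `|p - (1 - alpha)| <= 2 * rho / de ^+ 2 + 16 * de + 16 / n%:R.
Proof.
move=> de0 chi; rewrite -/sN in chi *.
pose S := [set e : 'rV[R]_n | `|SURE s f D (m + e) - enorm (m - f (m + e)) ^+ 2| <= s ^+ 2 * v * sN].
have mS : measurable S.
  by apply: measurable_le_set; apply: measurableT_comp => //; exact: measurable_funB.
have -> : [set w | `|SURE s f D (m + eps w) - enorm (m - f (m + eps w)) ^+ 2|
    <= s ^+ 2 * v * sN] = [set w | S (eps w)] by [].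
rewrite (noise_prob s0 law mS).
have -> : [set x | S (s *: x)] = [set x | `|ssq x - n%:R - 2 * divg F H x| <= v * sN].
  apply/seteqP; split => x; rewrite /S /= SUREE normrM gtr0_norm// -mulrA ler_pM2l//.
have := @level_set_perturbation R n (fun x => `|ssq x - n%:R|)
  (fun x => `|ssq x - n%:R - 2 * divg F H x|) [set x | de * sN / 2 < `|divg F H x|]
  (v * sN) (de * sN) (2 * rho / de ^+ 2) (16 * de + 16 / n%:R) alpha.
rewrite addrA; apply => //.
- exact: measurableT_comp.
- exact: measurableT_comp.
- move=> x /negP; rewrite -leNgt => dx.
  apply: (le_trans (ler_dist_dist _ _)); rewrite [_ - _ - (_ - _)](_ : _ = - (2 * divg F H x)); last by ring.
  by rewrite normrN normrM gtr0_norm//; lra.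
- exact: divg_small.
- have -> : 16 * de + 16 / n%:R = (8 * de + 8 / n%:R) + (8 * de + 8 / n%:R) :> R by lra.
  rewrite EFinD.
  (* |X - n| is close to v sN only if X is close to n + v sN or to n - v sN: two windows, hence
     twice the bound for one. *)
  pose S1 := [set x : 'rV[R]_n | `|ssq x - (n%:R + v * sN)| <= de * sN].
  pose S2 := [set x : 'rV[R]_n | `|ssq x - (n%:R - v * sN)| <= de * sN].
  have mS' c : measurable [set x : 'rV[R]_n | `|ssq x - c| <= de * sN].
    apply: measurable_le_set; apply: measurableT_comp => //.
    by apply: measurable_funB => //; exact: measurable_ssq.
  apply: (@le_trans _ _ (gam (S1 `|` S2))).
    apply: le_measure; rewrite ?inE.
    + apply: measurable_le_set; apply: measurableT_comp => //.
      by apply: measurable_funB => //; exact: measurableT_comp.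
    + by apply: measurableU; exact: mS'.
    + move=> x; rewrite /S1 /S2 /= => h; case: (lerP 0 (ssq x - n%:R)) => y0.
        left; move: h; rewrite (ger0_norm y0) => h.
        by rewrite opprD addrA.
      right; move: h; rewrite (ltr0_norm y0) => h.
      by rewrite (_ : ssq x - _ = - (- (ssq x - n%:R) - v * sN)) ?normrN//; ring.
  apply: (le_trans (measureU2 _ _ _)); [exact: mS'|exact: mS'|].
  by apply: leeD; exact: anticoncentration.
- rewrite -chi /chi_square /pushforward; congr (gam _); apply/seteqP; split => x /=.
    by rewrite enorm2 -/(ssq x) ltr_pdivlMl// mulrC.
  by rewrite enorm2 -/(ssq x) ltr_pdivlMl// mulrC.
Qed.

Lemma upper_coverage (v alpha de : R) : 0 < de ->
  chi_square n [set t | v < (Num.sqrt (2 * n%:R))^-1 * (n%:R - t)] = alpha%:E ->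
  exists2 p : R, P [set w | enorm (m - f (m + eps w)) ^+ 2 <= SURE s f D (m + eps w)
    + s ^+ 2 * v * Num.sqrt (2 * n%:R)] = p%:E &
  `|p - (1 - alpha)| <= 2 * rho / de ^+ 2 + 16 * de + 16 / n%:R.
Proof.
move=> de0 chi; rewrite -/sN in chi *.
have nR0 : 0 < n%:R :> R by rewrite ltr0n.
pose S := [set e : 'rV[R]_n | enorm (m - f (m + e)) ^+ 2 - SURE s f D (m + e) <= s ^+ 2 * v * sN].
have mS : measurable S.
  by apply: measurable_le_set; exact: measurable_funB.
have -> : [set w | enorm (m - f (m + eps w)) ^+ 2 <= SURE s f D (m + eps w)
    + s ^+ 2 * v * sN] = [set w | S (eps w)].
  by apply/seteqP; split => w; rewrite /S /= lerBlDl.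
rewrite (noise_prob s0 law mS).
have -> : [set x | S (s *: x)] = [set x | - (ssq x - n%:R - 2 * divg F H x) <= v * sN].
  have E x : enorm (m - f (m + s *: x)) ^+ 2 - SURE s f D (m + s *: x) =
      s ^+ 2 * - (ssq x - n%:R - 2 * divg F H x).
    by have := SUREE x; lra.
  by apply/seteqP; split => x; rewrite /S /= E -mulrA ler_pM2l.
have := @level_set_perturbation R n (fun x => - (ssq x - n%:R))
  (fun x => - (ssq x - n%:R - 2 * divg F H x)) [set x | de * sN / 2 < `|divg F H x|]
  (v * sN) (de * sN) (2 * rho / de ^+ 2) (8 * de + 8 / n%:R) alpha.
case.
- exact: measurableT_comp.
- exact: measurableT_comp.
- exact: mtail.
- move=> x /negP; rewrite -leNgt => dx.
  rewrite [_ - - _](_ : _ = 2 * divg F H x); last by ring.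
  by rewrite normrM gtr0_norm//; lra.
- exact: divg_small.
- rewrite (_ : [set x | _] = [set x | `|ssq x - (n%:R - v * sN)| <= de * sN]).
    exact: anticoncentration.
  apply/funext => x /=; rewrite (_ : ssq x - (n%:R - v * sN) = - (- (ssq x - n%:R) - v * sN)) ?normrN//.
  by ring.
- rewrite -chi /chi_square /pushforward; congr (gam _); apply/seteqP; split => x /=.
    by rewrite enorm2 -/(ssq x) ltr_pdivlMl// mulrC opprB.
  by rewrite enorm2 -/(ssq x) ltr_pdivlMl// mulrC opprB.
(* A single window gives 8 de + 8 / n, relaxed here to the two-sided constants so that one lemma
   yields both limits. *)
move=> p pE hp; exists p => //; apply: (le_trans hp); rewrite -addrA lerD2l.
have : 0 <= n%:R^-1 :> R by rewrite invr_ge0 ltW.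
by lra.
Qed.

End fixed_dimension.

(** The parameter [de] is free for each [n]: fix it from the tolerance, then let [n] grow so that
    rho n / de^2 and 1 / n become small. *)
Lemma cvg_coverage (R : realType) (u : nat -> \bar R) (rho : nat -> R) (a : R) :
  rho n @[n --> \oo] --> (0 : R) ->
  (forall n (de : R), (0 < n)%N -> 0 < de -> exists2 p : R, u n = p%:E &
    `|p - a| <= 2 * rho n / de ^+ 2 + 16 * de + 16 / n%:R) ->
  u n @[n --> \oo] --> a%:E.
Proof.
move=> g0 H.
have inv_small (e x : R) : 64 <= x * e -> 16 <= e / 4 * x by lra.
have sum_small (e x y : R) : 0 < e -> x <= e / 4 -> y <= e / 4 -> x + 16 * (e / 64) + y <= e.
  by lra.
have ngt0 : \forall n \near \oo, (0 < n)%N by exists 1%N.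
apply/fine_cvgP; split.
  near=> n; have n0 : (0 < n)%N by near: n.
  by have [p -> _] := H n 1 n0 ltr01.
apply/cvgrPdist_le => e e0; near=> n.
have n0 : (0 < n)%N by near: n.
(* With de = e / 64 the middle term of the bound is e / 4; each of the other two is at most e / 4
   for large [n]. *)
have de0 : 0 < e / 64 by rewrite divr_gt0.
have [p pE hp] := H n _ n0 de0; rewrite /= pE distrC; apply: (le_trans hp).
have de2 : 0 < (e / 64) ^+ 2 by rewrite exprn_gt0.
have h1 : 2 * rho n / (e / 64) ^+ 2 <= e / 4.
  rewrite ler_pdivrMr//; apply: (@le_trans _ _ (2 * (e / 8 * (e / 64) ^+ 2))); last by lra.
  rewrite ler_pM2l//; apply: (le_trans (ler_norm _)).
  have : `|0 - rho n| <= e / 8 * (e / 64) ^+ 2.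
    near: n; move/cvgrPdist_le : g0; apply.
    by apply: mulr_gt0; [exact: divr_gt0|apply: exprn_gt0; exact: divr_gt0].
  by rewrite sub0r normrN.
have nR0 : 0 < n%:R :> R by rewrite ltr0n.
have h2 : 16 / n%:R <= e / 4.
  rewrite ler_pdivrMr//.
  have : 64 / e <= n%:R.
    near: n; exists (Num.truncn (64 / e)).+1 => // k /= tk.
    by apply: (le_trans (ltW (truncnS_gt _))); rewrite ler_nat.
  by rewrite ler_pdivrMr//; exact: inv_small.
exact: sum_small.
Unshelve. all: by end_near. Qed.

Unset Implicit Arguments.
Set Strict Implicit.
Set Printing Implicit Defensive.

Theorem corollary3p5 (R : realType)
  (d : nat -> measure_display) (T : forall n, measurableType (d n))
  (P : forall n, probability (T n) R)
  (sigma : nat -> R) (mu : forall n, 'rV[R]_n)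
  (eps : forall n, {RV (P n) >-> 'rV[R]_n})
  (muhat : forall n, 'rV[R]_n -> 'rV[R]_n)
  (Dmuhat : forall n, 'rV[R]_n -> 'M[R]_n)
  (gammas : nat -> R)
  (sigma_gt0 : forall n, (0 < n)%N -> 0 < sigma n)
  (eps_normal : forall n, (0 < n)%N ->
     forall A : set 'rV[R]_n, measurable A ->
       distribution (P n) (eps n) A = gaussian n (sigma n) A)
  (muhat_W12 : forall n, (0 < n)%N -> forall j : 'I_n,
     gaussian_W12 (fun x => muhat n (mu n + sigma n *: x) 0 j))
  (Dmuhat_grad : forall n, (0 < n)%N -> weak_gradient (muhat n) (Dmuhat n))
  (gammas_cvg0 : gammas n @[n --> \oo] --> (0 : R)) :
  let y n (w : T n) : 'rV[R]_n := mu n + eps n w in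
  (forall n, (0 < n)%N ->
     ('E_(P n)[fun w =>
        (4 * enorm (muhat n (y n w) - mu n) ^+ 2 / (n%:R * sigma n ^+ 2) +
         4 * \tr (Dmuhat n (y n w) *m Dmuhat n (y n w)) / n%:R)%R]
      <= (gammas n)%:E)%E) ->
  forall alpha : R, 0 < alpha < 1 ->
  forall v vminus : nat -> R,
  (forall n, (0 < n)%N ->
     chi_square n [set t | v n < (Num.sqrt (2 * n%:R))^-1 * `|t - n%:R|]
     = alpha%:E) ->
  (forall n, (0 < n)%N ->
     chi_square n [set t | vminus n < (Num.sqrt (2 * n%:R))^-1 * (n%:R - t)]
     = alpha%:E) ->
  (P n [set w | `|SURE (sigma n) (muhat n) (Dmuhat n) (y n w)
                  - enorm (mu n - muhat n (y n w)) ^+ 2|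
                <= sigma n ^+ 2 * v n * Num.sqrt (2 * n%:R)]
     @[n --> \oo] --> (1 - alpha)%:E) /\
  (P n [set w | enorm (mu n - muhat n (y n w)) ^+ 2
                <= SURE (sigma n) (muhat n) (Dmuhat n) (y n w)
                   + sigma n ^+ 2 * vminus n * Num.sqrt (2 * n%:R)]
     @[n --> \oo] --> (1 - alpha)%:E).
Proof.
move=> y risk alpha _ v vminus hv hvminus; split.
  apply: (cvg_coverage gammas_cvg0) => n de n0 de0.
  exact: (two_sided_coverage n0 (sigma_gt0 n n0) (eps_normal n n0) (muhat_W12 n n0)
    (Dmuhat_grad n n0) (risk n n0) de0 (hv n n0)).
apply: (cvg_coverage gammas_cvg0) => n de n0 de0.
exact: (upper_coverage n0 (sigma_gt0 n n0) (eps_normal n n0) (muhat_W12 n n0)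
  (Dmuhat_grad n n0) (risk n n0) de0 (hvminus n n0)).
Qed.
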